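(* Let $[\underline b,\overline b]\subset\mathcal I_0$ with $0<\underline b<\overline b$, and let $u^0\in BV(\mathbb R)$ with $\mathrm{Range}(u^0)\subset[\underline b,\overline b]$. Then any weak solution of $u_t+(f(u))_x=0$ with initial value $u^0$ belonging to the class $$\{v:\ v\in L^\infty([0,T];BV(\mathbb R))\text{ for all }T>0,\ v\text{ is }\eta\text{-entropic and }\eta_{\phi^\natural(\underline b)}\text{-entropic}\}$$ is unique in this class among weak solutions with the same initial data; that is, any two weak solutions in this class with initial value $u^0$ coincide.
   Context: Setting. Fix $M>0$ and the state space $\mathcal I_0=[-M,M]$. The flux $f:\mathbb R\to\mathbb R$ is of class $C^4$ and concave-convex: $uf''(u)>0$ for $u\ne0$, $f'''(0)\neq0$, and $f'(u)\to+\infty$ as $|u|\to+\infty$. Consider the scalar conservation law $u_t+(f(u))_x=0$, $t>0$, $x\in\mathbb R$; all weak solutions considered are in $L^\infty(\mathbb R^+\times\mathbb R)$ with values in $\mathcal I_0$. Fix a strictly convex entropy $\eta\in C^3$ ($\eta''>0$) with entropy flux $q$, $q'=\eta'f'$. For $k\in\mathbb R$ the Kruzkov entropy is $\eta_k(u)=|u-k|$ with flux $q_k(u)=\mathrm{sgn}(u-k)(f(u)-f(k))$. A weak solution $u$ is $\eta$-entropic (resp. $\eta_k$-entropic) if $(\eta(u))_t+(q(u))_x\le0$ (resp. with $\eta_k,q_k$) in the sense of distributions on $(0,\infty)\times\mathbb R$. $BV(\mathbb R)$ refers to finite total variation (functions need not be integrable on $\mathbb R$). For $u\neq0$, $\phi^\natural(u)$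 is the unique $v\ne u$ with $f'(v)=\frac{f(u)-f(v)}{u-v}$; $\phi^\natural(0)=0$. *)

(* Defs.v *)
From HB Require Import structures.
From mathcomp Require Import all_boot all_order all_algebra.
From mathcomp Require Import all_classical all_reals all_analysis.

Set Implicit Arguments.
Unset Strict Implicit.
Unset Printing Implicit Defensive.

Import Order.TTheory GRing.Theory Num.Theory.
Import numFieldTopology.Exports numFieldNormedType.Exports.

Local Open Scope classical_set_scope.
Local Open Scope ring_scope.

Section Calculus.
Context {R : realType}.

Definition Cn_line (n : nat) (g : R -> R) : Prop :=
  (forall i, (i < n)%N -> forall x, derivable (derive1n i g) x 1) /\
  continuous (derive1n n g).

(* Points of the plane are pairs (t, x): (1, 0) is the time direction and
   (0, 1) the space direction. *)
Definition dt (phi : R * R -> R) : R * R -> R := fun p => 'D_(1, 0) phi p.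
Definition dx (phi : R * R -> R) : R * R -> R := fun p => 'D_(0, 1) phi p.

Fixpoint Cn_plane (n : nat) (phi : R * R -> R) : Prop :=
  continuous phi /\
  if n is m.+1 then
    [/\ forall p, derivable phi p (1, 0), forall p, derivable phi p (0, 1),
        Cn_plane m (dt phi) & Cn_plane m (dx phi)]
  else True.

Definition supp (phi : R * R -> R) : set (R * R) :=
  closure [set p | phi p != 0].

Definition test_function (phi : R * R -> R) : Prop :=
  (forall n, Cn_plane n phi) /\ compact (supp phi).

End Calculus.

Section ConservationLaw.
Context {R : realType}.

Definition mu1 := @lebesgue_measure R.
Definition mu2 := (@lebesgue_measure R \x @lebesgue_measure R)%E.

Definition half_plane : set (R * R) := [set p | 0 < p.1].

Definition concave_convex_flux (f : R -> R) : Prop :=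
  [/\ Cn_line 4 f,
      forall u, u != 0 -> 0 < u * derive1n 2 f u,
      derive1n 3 f 0 != 0,
      derive1 f x @[x --> +oo] --> +oo
    & derive1 f x @[x --> -oo] --> +oo].

Definition strictly_convex_entropy_pair (f eta q : R -> R) : Prop :=
  [/\ Cn_line 3 eta,
      forall u, 0 < derive1n 2 eta u,
      forall u, derivable q u 1
    & forall u, derive1 q u = derive1 eta u * derive1 f u].

Definition kruzkov_entropy (k : R) : R -> R := fun u => `|u - k|.

Definition kruzkov_flux (f : R -> R) (k : R) : R -> R :=
  fun u => Num.sg (u - k) * (f u - f k).

(* For a concave-convex flux the set below is a singleton when u != 0. *)
Definition phi_nat (f : R -> R) (u : R) : R :=
  if u == 0 then 0
  else xget 0 [set v | v != u /\ derive1 f v = (f u - f v) / (u - v)].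

(* Test functions are defined on the whole plane and need not vanish at t = 0;
   this is how the initial datum is attained. *)
Definition weak_solution (M : R) (f u0 : R -> R) (u : R * R -> R) : Prop :=
  [/\ measurable_fun half_plane u,
      {ae mu2, forall p, half_plane p -> - M <= u p <= M}
    & forall phi, test_function phi ->
        \int[mu2]_(p in half_plane) (u p * dt phi p + f (u p) * dx phi p)
        + \int[mu1]_(x in setT) (u0 x * phi (0, x)) = 0].

Definition entropic (eta q : R -> R) (u : R * R -> R) : Prop :=
  forall phi, test_function phi -> supp phi `<=` half_plane ->
    (forall p, 0 <= phi p) ->
    0 <= \int[mu2]_(p in half_plane)
           (eta (u p) * dt phi p + q (u p) * dx phi p).

(* Functions are considered up to null sets, so the total variation is that of
   some representative of g. *)
Definition ess_variation_le (C : R) (g : R -> R) : Prop :=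
  exists w : R -> R, {ae mu1, forall x, g x = w x} /\
    forall a b, a <= b -> (total_variation a b w <= C%:E)%E.

Definition BV (g : R -> R) : Prop :=
  measurable_fun setT g /\ exists C, ess_variation_le C g.

Definition locally_bounded_in_BV (u : R * R -> R) : Prop :=
  forall T, 0 < T -> exists C, {ae mu1, forall t,
    0 <= t <= T -> ess_variation_le C (fun x => u (t, x))}.

Definition uniqueness_class (f eta q : R -> R) (k : R) (u : R * R -> R) : Prop :=
  [/\ locally_bounded_in_BV u,
      entropic eta q u
    & entropic (kruzkov_entropy k) (kruzkov_flux f k) u].

End ConservationLaw.

(* Main.v *)
(* A weak solution u has a Lipschitz potential w with w_x = u and w_t = - f(u), and it is
   determined almost everywhere by w. Entropy inequalities yield one-sided information on w,
   in the manner of De Lellis, Otto and Westdickenberg: if w is touched at a point, from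
   below (sg = 1) or above (sg = -1), by a paraboloid with derivatives (b, a), then testing
   an entropy inequality E_t + Q_x <= 0 against a function of the distance from w to the
   paraboloid contradicts a negative upper bound for sg ((b + f(u)) E + (a - u) Q).

   The Kruzkov pair at k, the tangent point of bl, thus forbids w to violate
   w_t + f(w_x) = 0 in either direction at the slope k; since the initial slopes exceed k,
   a comparison of w with itself gives u >= k. For p >= bl the graph of f above [k, M] lies
   below its chords ending at p, by the choice of k, and above its tangent at p. The first
   fact provides the required negative bound from below at the slope p, for a multiple of
   the pair (eta, q) shifted by constants; the second provides it from above, for a
   constant pair.
   All initial slopes being at least bl, the potentials of two solutions can be compared
   by doubling variables with a penalisation whose slopes stay above bl, so they coincide. *)
Require Import Defs.
From mathcomp Require Import all_boot all_order all_algebra.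
From mathcomp Require Import all_classical all_reals all_analysis measurable_realfun.
From mathcomp Require Import ring lra.

Set Implicit Arguments.
Unset Strict Implicit.
Unset Printing Implicit Defensive.

Import Order.TTheory GRing.Theory Num.Theory.
Import numFieldTopology.Exports numFieldNormedType.Exports.
Local Open Scope classical_set_scope.
Local Open Scope ring_scope.

(** * Smooth functions *)

(** With one entropy, the sign of (u - p) (q(u) - q(p)) - (f(u) - f(p)) (eta(u) - eta(p)) is known
    only when f lies on one side of its chord between u and p. For p below bl and u down to k this
    may fail, so the comparison must never meet such a slope. A symmetric penalisation would; the
    one used here has a linear part of slope - bl, and the doubled functional remains nonnegative at
    time 0 because the initial slopes are at least bl. The Kruzkov pair at k acts in both directions
    because, for E = |u - k| and Q = sgn(u - k) (f(u) - f(k)), the products (f(u) - f(k)) E and (k -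
    u) Q cancel exactly. What remains is linear in the excess e of the time slope over - f(k) and
    has a strict sign once a small constant is added to E. This excess is bounded below but not
    above, so nonconstant pairs are divided by e. This keeps them uniformly bounded, and the
    negative bound, hence the admissible contact error, is the same for all contacts. *)

Section Smooth.
Context {R : realType}.

(** A single criterion for the directional derivatives computed by hand below: flat functions at 0,
    convolutions, polynomials. *)
Lemma is_derive_quadratic (V : normedModType R) (f : V -> R) (p v : V) (d C r : R) :
  0 < r -> (forall h, `|h| < r -> `|f (h *: v + p) - f p - h * d| <= C * h ^+ 2) ->
  is_derive p v f d.
Proof.
move=> r0 fC.
have C0 : 0 <= C.
  have r2 : `|r / 2| < r by rewrite ger0_norm; lra.
  have := le_trans (normr_ge0 _) (fC _ r2).
  by rewrite pmulr_lge0// exprn_gt0// divr_gt0.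
have lim : (fun h : R => h^-1 *: ((f \o shift p) (h *: v) - f p)) @ 0^' --> d.
  apply/cvgrPdist_le => e e0; near=> h.
  have h0 : h != 0 by near: h; exact: nbhs_dnbhs_neq.
  have hr : `|h| < r.
    by near: h; apply: dnbhs0_lt.
  have he : C * `|h| <= e.
    have : `|h| <= e / (C + 1).
      by near: h; apply: dnbhs0_le; rewrite divr_gt0// ltr_wpDl.
    rewrite ler_pdivlMr ?ltr_wpDl// => he; apply: le_trans he.
    by rewrite mulrC ler_wpM2l// lerDl.
  rewrite /=; have := fC _ hr.
  rewrite (_ : d - _ = - (h^-1 * (f (h *: v + p) - f p - h * d))); last first.
    by rewrite /= /GRing.scale/=; field.
  rewrite normrN normrM normfV => H; apply: le_trans he.
  rewrite mulrC ler_pdivrMr ?normr_gt0//.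
  by rewrite -mulrA -expr2 real_normK ?num_real.
apply: DeriveDef; first by apply/cvg_ex; exists d.
by rewrite /derive; apply/cvg_lim.
Unshelve. all: by end_near. Qed.

Lemma is_derive_line (V : normedModType R) (f : V -> R) (p v : V) (d : R) :
  is_derive p v f d <-> is_derive (0 : R) 1 (fun h => f (h *: v + p)) d.
Proof.
have E : (fun h : R => h^-1 *: ((f \o shift p) (h *: v) - f p)) =
    (fun h : R => h^-1 *: (((fun h => f (h *: v + p)) \o shift 0) (h *: (1:R)) -
       f (0 *: v + p))).
  apply/funext => h /=; rewrite addr0 scale0r add0r.
  by rewrite /GRing.scale/= mulr1.
by split=> -[H1 H2]; apply: DeriveDef;
  move: H1 H2; rewrite /derivable /derive E.
Qed.

(** Derivatives are required to be bounded on the whole line. The class is then stable under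
    products and under inverses of functions bounded below by a positive constant, and every kernel
    has global Lipschitz and Taylor constants. *)
Fixpoint smooth_upto (n : nat) (g : R -> R) : Prop :=
  (exists B, forall x, `|g x| <= B) /\
  if n is m.+1 then
    exists g' : R -> R, (forall x : R, is_derive x 1 g (g' x)) /\ smooth_upto m g'
  else True.

Lemma smooth_upto_bounded n g : smooth_upto n g -> exists B, forall x, `|g x| <= B.
Proof. by case: n => [|n] []. Qed.

Lemma smooth_uptoS n g : smooth_upto n.+1 g -> smooth_upto n g.
Proof.
elim: n g => [|n IH] g /= [Bg [g' [dg sg']]]; split=> //.
by exists g'; split=> //; exact: IH.
Qed.

Lemma smooth_upto_cst n c : smooth_upto n (fun=> c).
Proof.
elim: n c => [|n IH] c /=; (split; first by exists `|c|) => //.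
by exists (fun=> 0); split=> // x; exact: is_derive_cst.
Qed.

Lemma smooth_uptoD n f g : smooth_upto n f -> smooth_upto n g ->
  smooth_upto n (fun x => f x + g x).
Proof.
elim: n f g => [|n IH] f g [[B fB] sf] [[B' gB'] sg] /=;
  (split; first by exists (B + B') => x; rewrite (le_trans (ler_normD _ _))// lerD) => //.
move: sf sg => [f' [df sf]] [g' [dg sg]].
exists (fun x => f' x + g' x); split; last exact: IH.
by move=> x; exact: is_deriveD.
Qed.

Lemma smooth_uptoM n f g : smooth_upto n f -> smooth_upto n g ->
  smooth_upto n (fun x => f x * g x).
Proof.
elim: n f g => [|n IH] f g sf sg.
  split => //; have [B fB] := smooth_upto_bounded sf.
  have [B' gB'] := smooth_upto_bounded sg; exists (B * B') => x.
  by rewrite normrM ler_pM.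
have [Sf Sg] := (smooth_uptoS sf, smooth_uptoS sg).
move: sf sg => [[B fB] [f' [df sf]]] [[B' gB'] [g' [dg sg]]] /=.
split; first by exists (B * B') => x; rewrite normrM ler_pM.
exists (fun x => f x * g' x + g x * f' x); split.
  by move=> x; exact: is_deriveM.
by apply: smooth_uptoD; exact: IH.
Qed.

Lemma smooth_uptoZ n c f : smooth_upto n f -> smooth_upto n (fun x => c * f x).
Proof. by apply: smooth_uptoM; exact: smooth_upto_cst. Qed.

Lemma smooth_upto_affine n a b g : smooth_upto n g ->
  smooth_upto n (fun x => g (a * x + b)).
Proof.
elim: n g => [|n IH] g [[B gB] sg] /=; (split; first by exists B) => //.
move: sg => [g' [dg sg]]; exists (fun x => a * g' (a * x + b)); split.
  move=> x; have : is_derive x (1:R) (fun y : R => a * y + b) (a *: (1:R) + 0).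
    by apply: is_deriveD; exact: is_deriveZ.
  rewrite addr0 /GRing.scale/= mulr1 => da.
  by rewrite mulrC; exact: (@is_derive1_comp _ g (fun y => a * y + b) x _ _ (dg _) da).
by apply: smooth_uptoZ; exact: IH.
Qed.

Lemma smooth_uptoV n d g : 0 < d -> (forall x, d <= g x) -> smooth_upto n g ->
  smooth_upto n (fun x => (g x)^-1).
Proof.
move=> d0 dg.
have g0 x : 0 < g x by apply: lt_le_trans d0 _.
have gb : exists B, forall x, `|(g x)^-1| <= B.
  by exists d^-1 => x; rewrite ger0_norm; [rewrite lef_pV2 ?posrE|rewrite invr_ge0 ltW].
elim: n => [|n IH] //= sg; split => //.
have IHn := IH (smooth_uptoS sg); move: sg => [_ [g' [dg' sg]]].
exists (fun x => ((-1 * (g x)^-1) * (g x)^-1) * g' x); split.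
  move=> x; have := @is_deriveV R g x (g' x) 1 (lt0r_neq0 (g0 x)) (dg' x).
  move=> /is_derive_eq; apply; rewrite /GRing.scale/=.
  by field; rewrite gt_eqF.
by apply: smooth_uptoM => //; apply: smooth_uptoM => //; exact: smooth_uptoZ.
Qed.

Definition smooth (g : R -> R) : Prop := forall n, smooth_upto n g.

Lemma smoothP g : smooth g -> [/\ exists B, forall x, `|g x| <= B,
  smooth (derive1 g) & forall x : R, is_derive x 1 g (derive1 g x)].
Proof.
move=> sg; split; first exact: (smooth_upto_bounded (sg 0%N)).
  move=> n; have [_ [g' [dg' sg']]] := sg n.+1.
  rewrite (_ : derive1 g = g')//; apply/funext => x.
  by rewrite derive1E; exact: (@derive_val _ _ _ _ _ _ _ (dg' x)).
move=> x; have [_ [g' [/(_ x) dg' _]]] := sg 1%N.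
by rewrite derive1E; exact: (derivableP (@ex_derive _ _ _ _ _ _ _ dg')).
Qed.

(* exp (-1/x) multiplied by powers of 1/x, so that the family is closed under
   differentiation. *)
Definition flat (k : nat) (x : R) : R :=
  if x <= 0 then 0 else (x^-1) ^+ k * expR (- x^-1).

Lemma flat_ge0 k x : 0 <= flat k x.
Proof.
rewrite /flat; case: ifPn => //; rewrite -ltNge => x0.
by rewrite mulr_ge0 ?expR_ge0// exprn_ge0// invr_ge0 ltW.
Qed.

Lemma flat_gt0 k x : 0 < x -> 0 < flat k x.
Proof.
by move=> x0; rewrite /flat leNgt x0/= mulr_gt0 ?expR_gt0// exprn_gt0// invr_gt0.
Qed.

Lemma flat_eq0 k x : x <= 0 -> flat k x = 0.
Proof. by rewrite /flat => ->. Qed.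

(** With y = 1 / x this is y ^ k <= k! exp y, a single term of the exponential series. *)
Lemma flat_bounded k x : `|flat k x| <= k`!%:R.
Proof.
rewrite ger0_norm ?flat_ge0// /flat; case: ifPn => [_|].
  by rewrite ler0n.
rewrite -ltNge -invr_gt0; set y := x^-1 => y0.
rewrite expRN ler_pdivrMr ?expR_gt0//.
case: k => [|k]; first by rewrite expr0 mul1r -expR0 ler_expR ltW.
have := expR_ge1Dxn k (ltW y0); rewrite -ler_pdivrMl ?ltr0n ?fact_gt0//.
by move=> H; rewrite mulrC; apply: le_trans H; rewrite lerDr.
Qed.

Lemma flatS k x : x * flat k.+1 x = flat k x.
Proof.
rewrite /flat; case: ifPn => [_|]; first by rewrite mulr0.
by rewrite -ltNge => x0; rewrite exprS !mulrA mulfV ?mul1r// gt_eqF.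
Qed.

Lemma is_derive_flat k (x : R) :
  is_derive x 1 (flat k) (- k%:R * flat k.+1 x + flat k.+2 x).
Proof.
have [x0|x0|->] := ltgtP x 0.
- rewrite !flat_eq0 ?ltW// mulr0 addr0.
  apply: (@near_eq_is_derive _ _ _ (cst 0)).
  near=> y; rewrite flat_eq0// ltW//; near: y.
  exact: lt_nbhsl.
- pose g (y : R) := (y^-1) ^+ k * expR (- y^-1).
  apply: (@near_eq_is_derive _ _ _ g).
    near=> y; rewrite /flat /g leNgt ifF//; apply/negbF; near: y.
    exact: lt_nbhsr.
  have xN0 : x != 0 by rewrite gt_eqF.
  have dV : is_derive x 1 (fun y : R => y^-1) (- x ^- 2 *: 1).
    exact: (@is_deriveV R id x 1 1 xN0 (is_derive_id _ _)).
  have dX := @is_deriveX _ _ _ k _ _ _ dV.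
  have dE := @is_derive1_comp _ expR (fun y : R => - y^-1) x _ _
    (is_derive_expR _) (is_deriveN dV).
  have D := is_deriveM dX dE.
  rewrite (_ : g = (fun y : R => y^-1) ^+ k * (expR \o (fun y : R => - y^-1))); last first.
    by apply/funext => y; rewrite /g !fctE.
  apply: (is_derive_eq D); rewrite /GRing.scale/= /flat leNgt x0/= !fctE !mulr1.
  case: k {g dX D} => [|k] /=; last first.
    rewrite !exprS; move: (x^-1 ^+ k) (expR _) (k.+1%:R) => a b c.
    by field.
  by rewrite !exprS !expr0; move: (expR _) => b; field.
- rewrite !flat_eq0// mulr0 addr0.
  (* At 0 one has [flat k h] = h ^ 2 [flat k.+2 h] with a bounded last factor, so the increment is
     quadratic. *)
  apply: (@is_derive_quadratic _ _ _ _ _ (k.+2)`!%:R 1) => // h _.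
  rewrite addr0 /GRing.scale/= mulr1 (flat_eq0 k (lexx 0)) mulr0 !subr0.
  rewrite -flatS -flatS mulrA normrM mulrC ler_pM//; first exact: flat_bounded.
  by rewrite normrM -expr2 real_normK ?num_real.
Unshelve. all: by end_near. Qed.

Lemma smooth_flat k : smooth (flat k).
Proof.
move=> n; elim: n k => [|n IH] k /=;
  (split; first by exists k`!%:R => x; exact: flat_bounded) => //.
exists (fun x => - k%:R * flat k.+1 x + flat k.+2 x); split.
  exact: is_derive_flat.
by apply: smooth_uptoD; last exact: IH; apply: smooth_uptoZ; exact: IH.
Qed.

Lemma flat0_homo (x y : R) : x <= y -> flat 0 x <= flat 0 y.
Proof.
move=> xy; have [x0|x0] := leP x 0; first by rewrite (flat_eq0 _ x0) flat_ge0.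
have y0 := lt_le_trans x0 xy.
rewrite /flat (lt_geF x0) (lt_geF y0) !expr0 !mul1r ler_expR lerN2 lef_pV2 ?posrE//.
Qed.

Definition step (x : R) : R := flat 0 x / (flat 0 x + flat 0 (1 - x)).

(** As the derivative of a step from 0 to 1 it has integral 1, so no normalising constant is needed,
    and its primitive is explicit. *)
Definition bump (x : R) : R := derive1 step x.

(** One of x and 1 - x is at least 1 / 2; the uniform positive bound is what [smooth_uptoV] asks
    for. *)
Let den_ge (x : R) : flat 0 (1 / 2) <= flat 0 x + flat 0 (1 - x).
Proof.
have [H|H] := leP (1 / 2) x.
  by rewrite (le_trans (flat0_homo H))// lerDl flat_ge0.
by rewrite (@le_trans _ _ (flat 0 (1 - x)))//; [apply: flat0_homo; lra|
  rewrite lerDr flat_ge0].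
Qed.

Let den_gt0 (x : R) : 0 < flat 0 x + flat 0 (1 - x).
Proof. by apply: lt_le_trans (den_ge x); apply: flat_gt0; lra. Qed.

Lemma smooth_step : smooth step.
Proof.
move=> n; apply: smooth_uptoM; first exact: smooth_flat.
apply: (@smooth_uptoV _ (flat 0 (1 / 2))) => //.
  by apply: flat_gt0; lra.
apply: smooth_uptoD; first exact: smooth_flat.
have := @smooth_upto_affine n (-1) 1 _ (smooth_flat 0 n).
by congr smooth_upto; apply/funext => x; congr flat; lra.
Qed.

Lemma step0 x : x <= 0 -> step x = 0.
Proof. by move=> x0; rewrite /step flat_eq0// mul0r. Qed.

Lemma step1 x : 1 <= x -> step x = 1.
Proof.
move=> x1; rewrite /step [flat 0 (1 - x)]flat_eq0 ?subr_le0// addr0 divff//.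
by rewrite gt_eqF// flat_gt0// (lt_le_trans ltr01).
Qed.

Lemma step_ge0 x : 0 <= step x.
Proof. by rewrite /step divr_ge0 ?flat_ge0// ltW. Qed.

Lemma step_le1 x : step x <= 1.
Proof. by rewrite /step ler_pdivrMr// mul1r lerDl flat_ge0. Qed.

Lemma smooth_bump : smooth bump.
Proof. by have [] := smoothP smooth_step. Qed.

Lemma is_derive_step (x : R) : is_derive x 1 step (bump x).
Proof. by have [] := smoothP smooth_step. Qed.

(** At these points [step] attains its minimum 0 or its maximum 1, so its derivative vanishes; the
    end points 0 and 1 are covered as well. *)
Lemma bump_eq0 x : x <= 0 \/ 1 <= x -> bump x = 0.
Proof.
have dS t : derivable step t 1 by exact: (@ex_derive _ _ _ _ _ _ _ (is_derive_step t)).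
have xi : x \in `]x - 1, x + 1[ by rewrite in_itv/=; lra.
have xx : x - 1 <= x + 1 by lra.
case=> xb.
- have D : is_derive x 1 step 0.
    apply: (derive1_at_min xx _ xi) => // t _.
    by rewrite (step0 xb) step_ge0.
  by rewrite /bump derive1E (@derive_val _ _ _ _ _ _ _ D).
- have D : is_derive x 1 step 0.
    apply: (derive1_at_max xx _ xi) => // t _.
    by rewrite (step1 xb) step_le1.
  by rewrite /bump derive1E (@derive_val _ _ _ _ _ _ _ D).
Qed.

Lemma bump_ge0 x : 0 <= bump x.
Proof.
have d0 (y : R) : is_derive y 1 (flat 0) (flat 2 y).
  by apply: (is_derive_eq (is_derive_flat 0 y)); rewrite oppr0 mul0r add0r.
have d1 : is_derive x (1 : R) (fun y : R => 1 - y) (- 1).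
  have D := @is_deriveB _ _ _ _ _ _ _ _ _ (is_derive_cst (1 : R) x (1 : R)) (is_derive_id x (1 : R)).
  by apply: (is_derive_eq D); rewrite sub0r.
have d2 := @is_derive1_comp _ (flat 0) (fun y : R => 1 - y) x _ _ (d0 (1 - x)) d1.
have d3 := @is_deriveV _ (fun y => flat 0 y + flat 0 (1 - y)) x _ 1
  (lt0r_neq0 (den_gt0 x)) (is_deriveD (d0 x) d2).
have d4 := is_deriveM (d0 x) d3.
rewrite /bump derive1E (@derive_val _ _ _ _ _ _ _ d4) /GRing.scale/=.
rewrite (_ : _ + _ = (flat 2 x * flat 0 (1 - x) + flat 0 x * flat 2 (1 - x)) /
  (flat 0 x + flat 0 (1 - x)) ^+ 2).
  by rewrite divr_ge0 ?exprn_ge0 ?addr_ge0 ?mulr_ge0 ?flat_ge0.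
have := lt0r_neq0 (den_gt0 x); move: (flat 0 x) (flat 0 (1 - x)) => a b ab.
by field.
Qed.

End Smooth.

(** * Smooth functions of two variables and compact supports *)

Section SmoothPlane.
Context {R : realType}.
Implicit Types (s f g : R * R -> R) (a : R -> R).

Lemma smooth_derivable a x : smooth a -> derivable a x 1.
Proof. by case/smoothP => _ _ /(_ x) H; exact: (@ex_derive _ _ _ _ _ _ _ H). Qed.

Lemma smooth_continuous a : smooth a -> continuous a.
Proof.
move=> sa x; apply: differentiable_continuous; apply/derivable1_diffP.
exact: smooth_derivable.
Qed.

Lemma is_derive_comp1 (V : normedModType R) (a : R -> R) (s : V -> R) (p v : V) (d e : R) :
  is_derive (s p) 1 a d -> is_derive p v s e ->
  is_derive p v (fun q => a (s q)) (d * e).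
Proof.
move=> da /is_derive_line ds; apply/is_derive_line.
apply: (@is_derive1_comp _ a (fun h => s (h *: v + p))) => //.
by rewrite scale0r add0r.
Qed.

Lemma Cn_plane_intro n s st sx : continuous s ->
  (forall p : R * R, is_derive p (1, 0) s (st p)) ->
  (forall p : R * R, is_derive p (0, 1) s (sx p)) ->
  Cn_plane n st -> Cn_plane n sx -> Cn_plane n.+1 s.
Proof.
move=> cs ds dx Ct Cx /=; split=> //.
have -> : dt s = st.
  by apply/funext => p; rewrite /dt (@derive_val _ _ _ _ _ _ _ (ds p)).
have -> : Defs.dx s = sx.
  by apply/funext => p; rewrite /Defs.dx (@derive_val _ _ _ _ _ _ _ (dx p)).
by split.
Qed.

Lemma Cn_plane_elim n s : Cn_plane n.+1 s ->
  [/\ continuous s, forall p : R * R, is_derive p (1, 0) s (dt s p),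
    forall p : R * R, is_derive p (0, 1) s (dx s p), Cn_plane n (dt s) & Cn_plane n (dx s)].
Proof.
move=> [cs [d1 d2 C1 C2]]; by split.
Qed.

Lemma Cn_plane_continuous n s : Cn_plane n s -> continuous s.
Proof. by case: n => [|n] []. Qed.

Lemma Cn_planeS n s : Cn_plane n.+1 s -> Cn_plane n s.
Proof.
elim: n s => [|n IH] s; first by case.
case/Cn_plane_elim => cs d1 d2 C1 C2.
by apply: Cn_plane_intro d1 d2 _ _ => //; exact: IH.
Qed.

Lemma Cn_plane_cst n c : Cn_plane n (fun=> c : R).
Proof.
elim: n c => [|n IH] c; first by split => // p; exact: cvg_cst.
apply: (@Cn_plane_intro _ _ (fun=> 0) (fun=> 0)) => // p.
exact: cvg_cst.
Qed.

Lemma Cn_planeD n f g : Cn_plane n f -> Cn_plane n g -> Cn_plane n (fun p => f p + g p).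
Proof.
elim: n f g => [|n IH] f g Cf Cg.
  split=> // p; apply: cvgD; [exact: (Cn_plane_continuous Cf)|exact: (Cn_plane_continuous Cg)].
have [cf f1 f2 Cf1 Cf2] := Cn_plane_elim Cf.
have [cg g1 g2 Cg1 Cg2] := Cn_plane_elim Cg.
apply: (@Cn_plane_intro _ _ (fun p => dt f p + dt g p) (fun p => dx f p + dx g p)).
- by move=> p; apply: cvgD; [exact: cf|exact: cg].
- exact: IH.
- exact: IH.
Qed.

Lemma Cn_planeM n f g : Cn_plane n f -> Cn_plane n g -> Cn_plane n (fun p => f p * g p).
Proof.
elim: n f g => [|n IH] f g Cf Cg.
  split=> // p; apply: cvgM; [exact: (Cn_plane_continuous Cf)|exact: (Cn_plane_continuous Cg)].
have [cf f1 f2 Cf1 Cf2] := Cn_plane_elim Cf.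
have [cg g1 g2 Cg1 Cg2] := Cn_plane_elim Cg.
have Cf' := Cn_planeS Cf; have Cg' := Cn_planeS Cg.
apply: (@Cn_plane_intro _ _ (fun p => f p * dt g p + g p * dt f p)
  (fun p => f p * dx g p + g p * dx f p)).
- by move=> p; apply: cvgM; [exact: cf|exact: cg].
- by apply: Cn_planeD; exact: IH.
- by apply: Cn_planeD; exact: IH.
Qed.

Lemma Cn_plane_comp n a s : smooth a -> Cn_plane n s -> Cn_plane n (fun p => a (s p)).
Proof.
elim: n a s => [|n IH] a s sa Cs.
  split=> // p; apply: continuous_comp; [exact: (Cn_plane_continuous Cs)|exact: smooth_continuous].
have [cs d1 d2 C1 C2] := Cn_plane_elim Cs.
have [_ sa' da] := smoothP sa.
apply: (@Cn_plane_intro _ _ (fun p => derive1 a (s p) * dt s p)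
  (fun p => derive1 a (s p) * dx s p)).
- by move=> p; apply: continuous_comp; [exact: cs|exact: smooth_continuous].
- by move=> p; exact: is_derive_comp1.
- by move=> p; exact: is_derive_comp1.
- by apply: Cn_planeM => //; apply: IH => //; exact: Cn_planeS.
- by apply: Cn_planeM => //; apply: IH => //; exact: Cn_planeS.
Qed.

Lemma is_derive_fst (p v : R * R) : is_derive p v fst v.1.
Proof.
apply: (@is_derive_quadratic _ _ _ _ _ _ 0 1) => // h _ /=.
by rewrite addrK /GRing.scale/= subrr normr0 mul0r.
Qed.

Lemma is_derive_snd (p v : R * R) : is_derive p v snd v.2.
Proof.
apply: (@is_derive_quadratic _ _ _ _ _ _ 0 1) => // h _ /=.
by rewrite addrK /GRing.scale/= subrr normr0 mul0r.
Qed.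

Lemma Cn_plane_fst n : Cn_plane n (fst : R * R -> R).
Proof.
case: n => [|n]; first by split => // p; exact: cvg_fst.
apply: (@Cn_plane_intro _ _ (fun=> 1) (fun=> 0)) => [p|p|p||]; try exact: Cn_plane_cst.
- exact: cvg_fst.
- exact: (is_derive_fst p (1, 0)).
- exact: (is_derive_fst p (0, 1)).
Qed.

Lemma Cn_plane_snd n : Cn_plane n (snd : R * R -> R).
Proof.
case: n => [|n]; first by split => // p; exact: cvg_snd.
apply: (@Cn_plane_intro _ _ (fun=> 0) (fun=> 1)) => [p|p|p||]; try exact: Cn_plane_cst.
- exact: cvg_snd.
- exact: (is_derive_snd p (1, 0)).
- exact: (is_derive_snd p (0, 1)).
Qed.

Lemma dtE s d (p : R * R) : is_derive p (1, 0) s d -> dt s p = d.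
Proof. by move=> H; rewrite /dt (@derive_val _ _ _ _ _ _ _ H). Qed.

Lemma dxE s d (p : R * R) : is_derive p (0, 1) s d -> dx s p = d.
Proof. by move=> H; rewrite /dx (@derive_val _ _ _ _ _ _ _ H). Qed.

Lemma supp_sub_box s (a b c d : R) :
  (forall p, s p != 0 -> a <= p.1 <= b /\ c <= p.2 <= d) ->
  supp s `<=` [set p | a <= p.1 <= b /\ c <= p.2 <= d].
Proof.
move=> H; have cl : closed [set p : R * R | a <= p.1 <= b /\ c <= p.2 <= d].
  rewrite (_ : [set p : R * R | _] = (fst @^-1` `[a, b]%classic) `&` (snd @^-1` `[c, d]%classic)).
    apply: closedI.
      apply: preimage_closed; last exact: itv_closed.
      by move=> p _; exact: cvg_fst.
    apply: preimage_closed; last exact: itv_closed.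
    by move=> p _; exact: cvg_snd.
  by apply/seteqP; split => p /=; rewrite !in_itv.
rewrite [X in _ `<=` X](closure_id _).1//.
exact: closure_subset.
Qed.

Lemma compact_supp_box s (a b c d : R) :
  (forall p, s p != 0 -> a <= p.1 <= b /\ c <= p.2 <= d) -> compact (supp s).
Proof.
move=> H; have := supp_sub_box H.
apply: (subclosed_compact (@closed_closure _ _)).
rewrite (_ : [set p : R * R | _] = `[a, b]%classic `*` `[c, d]%classic).
  apply: compact_setX; exact: segment_compact.
by apply/seteqP; split => p /=; rewrite !in_itv.
Qed.

End SmoothPlane.

(** * Integrals of bounded functions with bounded support *)

Section Integrals.
Context {R : realType}.
Implicit Types (g : R -> R) (Z : R * R -> R) (A C : R).

Local Notation mu := (@lebesgue_measure R).
Local Notation mm := (@lebesgue_measure R \x @lebesgue_measure R)%E.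
Local Notation I g := (Rintegral (@lebesgue_measure R) setT g).
Local Notation II Z := (Rintegral mm setT Z).

Local Notation seg A := (`[(- A)%R, A%R]%classic : set R).

(** Integrability, Fubini and dominated convergence all follow from the two constants A and C, which
    can be tracked through every construction. *)
Definition bounded_on1 A C g :=
  [/\ measurable_fun setT g, forall x, `|g x| <= C & forall x, A < `|x| -> g x = 0].

Definition bounded_on2 A C Z :=
  [/\ measurable_fun setT Z, forall p, `|Z p| <= C &
      forall p, A < `|p.1| \/ A < `|p.2| -> Z p = 0].

Lemma bounded_integrable d (T : measurableType d) (nu : {measure set T -> \bar R})
    (D : set T) C (f : T -> R) :
  measurable D -> (nu D < +oo)%E -> measurable_fun setT f ->
  (forall x, `|f x| <= C) -> (forall x, ~ D x -> f x = 0) ->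
  nu.-integrable setT (EFin \o f).
Proof.
move=> mD Doo mf fC fD.
apply: (@le_integrable _ _ _ nu setT _ _ (EFin \o (cst C \* \1_D)%R)) => //.
- exact/measurable_EFinP.
- move=> x _ /=; rewrite lee_fin indicE.
  have [xD|xD] := pselect (D x); first by rewrite mem_set// mulr1 (le_trans (fC x))// ler_norm.
  by rewrite memNset// fD// mulr0 normr0.
- apply/integrableP; split; first by apply/measurable_EFinP; apply: measurable_funM.
  rewrite (eq_integral (fun x => `|C|%:E * (\1_D x)%:E)%E).
    rewrite ge0_integralZl//; last exact/measurable_EFinP.
    by rewrite integral_indic// setIT lte_mul_pinfty.
  by move=> x _ /=; rewrite normrM [`|\1_D x|]ger0_norm// EFinM.
Qed.

Lemma itv_finite A : (mu (seg A) < +oo)%E.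
Proof. by rewrite lebesgue_measure_itv; case: ifP => _; rewrite ?ltry. Qed.

Lemma bounded_integrable1 A C g : bounded_on1 A C g -> mu.-integrable setT (EFin \o g).
Proof.
move=> [mg gC gA]; have := @bounded_integrable _ _ (@lebesgue_measure R) (seg A) C g; apply => //.
- exact: itv_finite.
- move=> x xA; apply: gA; rewrite ltNge; apply/negP => /=.
  by rewrite ler_norml => h; apply: xA; rewrite /= in_itv.
Qed.

Lemma bounded_integrable2 A C Z : bounded_on2 A C Z -> mm.-integrable setT (EFin \o Z).
Proof.
move=> [mZ ZC ZA].
have := @bounded_integrable _ _ mm (seg A `*` seg A) C Z; apply => //.
- exact: measurableX.
- rewrite [X in (X < _)%E](_ : _ = (mu (seg A) * mu (seg A))%E); last exact: product_measure1E.
  by apply: lte_mul_pinfty => //; [rewrite ge0_fin_numE// itv_finite|exact: itv_finite].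
- move=> p pA; apply: ZA; apply: contrapT => /not_orP[/negP + /negP]; rewrite -!leNgt !ler_norml.
  by move=> h1 h2; apply: pA; split; rewrite /= in_itv.
Qed.

Lemma bounded_on2_section1 A C Z t : bounded_on2 A C Z -> bounded_on1 A C (fun x => Z (t, x)).
Proof.
move=> [mZ ZC ZA]; split => //.
- by apply: (measurableT_comp mZ); exact: measurable_pair1.
- by move=> x h; apply: ZA; right.
Qed.

Lemma bounded_on2_section2 A C Z x : bounded_on2 A C Z -> bounded_on1 A C (fun t => Z (t, x)).
Proof.
move=> [mZ ZC ZA]; split => //.
- by apply: (measurableT_comp mZ); exact: measurable_pair2.
- by move=> t h; apply: ZA; left.
Qed.

Lemma Rintegral_bound A C g : bounded_on1 A C g -> `|I g| <= C * (2 * `|A|).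
Proof.
move=> H; have ig := bounded_integrable1 H; move: H => [mg gC gA].
apply: le_trans (le_normr_Rintegral _ ig) _ => //.
have mD : measurable (seg A) by [].
have E : I (fun x => C * \1_(seg A) x) = C * fine (mu (seg A)).
  rewrite RintegralZl//; last first.
    have := @bounded_integrable _ _ mu (seg A) 1 \1_(seg A); apply => //.
    - exact: itv_finite.
    - by move=> x; rewrite ger0_norm// indicE; case: (_ \in _).
    - by move=> x xA; rewrite indicE memNset.
  by rewrite /Rintegral integral_indic// setIT.
have C0 : 0 <= C by exact: le_trans (normr_ge0 _) (gC 0).
apply: (@le_trans _ _ (I (fun x => C * \1_(seg A) x))).
  apply: le_Rintegral => //.
  - by apply: (integrable_norm ig).
  - have := @bounded_integrable _ _ mu (seg A) C (fun x => C * \1_(seg A) x); apply => //.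
    + exact: itv_finite.
    + by apply: measurable_funM.
    + move=> x; rewrite normrM (ger0_norm C0) ger0_norm// indicE; case: (_ \in _); rewrite ?mulr1// mulr0//.
    + by move=> x xA; rewrite indicE memNset// mulr0.
  - move=> x _; rewrite indicE; have [xA|xA] := boolP (x \in _); first by rewrite mulr1.
    rewrite gA ?normr0 ?mulr0// ltNge ler_norml.
    by apply: contra xA => xA; rewrite inE/= in_itv.
rewrite E ler_wpM2l// lebesgue_measure_itv/= lte_fin.
case: ifPn => /= [h|_]; last by rewrite mulr_ge0.
by rewrite /= opprK; have := ler_norm A; lra.
Qed.

Lemma fubini12 A C Z : bounded_on2 A C Z -> II Z = I (fun t => I (fun x => Z (t, x))).
Proof.
move=> H; have iZ := bounded_integrable2 H.
rewrite /Rintegral -[in LHS](integral12_prod_meas1 iZ).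
congr fine; apply: eq_integral => t _; rewrite /fubini_F fineK//.
apply: integrable_fin_num => //.
exact: (bounded_integrable1 (bounded_on2_section1 t H)).
Qed.

Lemma fubini21 A C Z : bounded_on2 A C Z -> II Z = I (fun x => I (fun t => Z (t, x))).
Proof.
move=> H; have iZ := bounded_integrable2 H.
rewrite /Rintegral -[in LHS](integral21_prod_meas1 iZ).
congr fine; apply: eq_integral => t _; rewrite /fubini_G fineK//.
apply: integrable_fin_num => //.
exact: (bounded_integrable1 (bounded_on2_section2 t H)).
Qed.

Lemma bounded_on1_Rintegral1 A C Z : bounded_on2 A C Z ->
  bounded_on1 A (C * (2 * `|A|)) (fun t => I (fun x => Z (t, x))).
Proof.
move=> H; have iZ := bounded_integrable2 H; split.
- have := measurable_fubini_F iZ; move=> /(measurableT_comp (@fine_measurable R _ measurableT)).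
  by [].
- by move=> t; apply: Rintegral_bound; exact: bounded_on2_section1.
- move=> t tA; case: H => _ _ ZA.
  rewrite (@eq_Rintegral _ _ _ _ _ (cst 0)) ?Rintegral_cst ?mul0r//.
  by move=> x _; apply: ZA; left.
Qed.

Lemma bounded_on1_Rintegral2 A C Z : bounded_on2 A C Z ->
  bounded_on1 A (C * (2 * `|A|)) (fun x => I (fun t => Z (t, x))).
Proof.
move=> H; have iZ := bounded_integrable2 H; split.
- have := measurable_fubini_G iZ; move=> /(measurableT_comp (@fine_measurable R _ measurableT)).
  by [].
- by move=> t; apply: Rintegral_bound; exact: bounded_on2_section2.
- move=> t tA; case: H => _ _ ZA.
  rewrite (@eq_Rintegral _ _ _ _ _ (cst 0)) ?Rintegral_cst ?mul0r//.
  by move=> x _; apply: ZA; right.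
Qed.

Lemma dominated1 A C (g_ : nat -> R -> R) g : (forall n, bounded_on1 A C (g_ n)) ->
  measurable_fun setT g -> {ae mu, forall x, g_ n x @[n --> \oo] --> g x} ->
  I (g_ n) @[n --> \oo] --> I g.
Proof.
move=> H mg gg.
have C0 : 0 <= C by have [_ h _] := H 0%N; exact: le_trans (normr_ge0 _) (h 0).
pose G := EFin \o (fun x : R => C * \1_(seg A) x).
have [] := @dominated_convergence _ _ R mu setT measurableT (fun n => EFin \o g_ n) (EFin \o g) G.
- by move=> n; have [h _ _] := H n; exact/measurable_EFinP.
- exact/measurable_EFinP.
- move: gg; apply: filterS; first exact: (ae_filter_ringOfSetsType mu).
  by move=> x gx _; apply/fine_cvgP; split => //; exact: nearW.
- have := @bounded_integrable _ _ mu (seg A) C (fun x => C * \1_(seg A) x); apply => //.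
  + exact: itv_finite.
  + by apply: measurable_funM.
  + move=> x; rewrite normrM (ger0_norm C0) ger0_norm// indicE; case: (_ \in _); rewrite ?mulr1// mulr0//.
  + by move=> x xA; rewrite indicE memNset// mulr0.
- apply: aeW => x n _; rewrite lee_fin; have [_ h1 h2] := H n.
  rewrite indicE; have [xA|xA] := boolP (x \in _); first by rewrite mulr1.
  rewrite h2 ?normr0 ?mulr0// ltNge ler_norml.
  by apply: contra xA => xA; rewrite inE/= in_itv.
move=> ig _ h; apply: fine_cvg; rewrite fineK//.
exact: integrable_fin_num.
Qed.

(** Convergence is asked for almost every t at each fixed x: this is the form in which
    one-dimensional Lebesgue differentiation delivers it for a mollification in t alone.
    [dominated2_x] is its counterpart for x. *)
Lemma dominated2_t A C (Z_ : nat -> R * R -> R) Z : (forall n, bounded_on2 A C (Z_ n)) ->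
  bounded_on2 A C Z -> (forall x, {ae mu, forall t, Z_ n (t, x) @[n --> \oo] --> Z (t, x)}) ->
  II (Z_ n) @[n --> \oo] --> II Z.
Proof.
move=> H HZ cv; rewrite (fubini21 HZ).
under eq_cvg do rewrite (fubini21 (H _)).
apply: (dominated1 (fun n => bounded_on1_Rintegral2 (H n))).
  by have [] := bounded_on1_Rintegral2 HZ.
apply: aeW => x; apply: (dominated1 (fun n => bounded_on2_section2 x (H n))) => //.
by have [] := bounded_on2_section2 x HZ.
Qed.

Lemma dominated2_x A C (Z_ : nat -> R * R -> R) Z : (forall n, bounded_on2 A C (Z_ n)) ->
  bounded_on2 A C Z -> (forall t, {ae mu, forall x, Z_ n (t, x) @[n --> \oo] --> Z (t, x)}) ->
  II (Z_ n) @[n --> \oo] --> II Z.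
Proof.
move=> H HZ cv; rewrite (fubini12 HZ).
under eq_cvg do rewrite (fubini12 (H _)).
apply: (dominated1 (fun n => bounded_on1_Rintegral1 (H n))).
  by have [] := bounded_on1_Rintegral1 HZ.
apply: aeW => t; apply: (dominated1 (fun n => bounded_on2_section1 t (H n))) => //.
by have [] := bounded_on2_section1 t HZ.
Qed.

End Integrals.

(** * Mollification *)

Section Convolution.
Context {R : realType}.
Implicit Types (g : R -> R) (Z : R * R -> R) (A C : R) (a b : R -> R).

Local Notation mu := (@lebesgue_measure R).
Local Notation mm := (@lebesgue_measure R \x @lebesgue_measure R)%E.
Local Notation I g := (Rintegral (@lebesgue_measure R) setT g).
Local Notation II Z := (Rintegral mm setT Z).

(** The plane carries the product sigma-algebra, so an open set has to be exhibited as a countable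
    union of boxes with rational corners. *)
Lemma open_plane_measurable (U : set (R * R)) : open U -> measurable U.
Proof.
move=> oU.
pose B (r : rat * rat * (rat * rat)) : set (R * R) :=
  `]ratr r.1.1, ratr r.1.2[%classic `*` `]ratr r.2.1, ratr r.2.2[%classic.
have -> : U = \bigcup_r (if `[< B r `<=` U >] then B r else set0).
  apply/seteqP; split; last first.
    by move=> p [r _]; case: asboolP => // rU /rU.
  move=> p Up; have : nbhs p U by exact: open_nbhs_nbhs.
  move=> /nbhs_ballP[e /= e0 eU].
  have lt1 (z : R) : z - e < z by rewrite ltrBlDr ltrDl.
  have lt2 (z : R) : z < z + e by rewrite ltrDl.
  have [a1 ha1] := rat_in_itvoo (lt1 p.1); have [b1 hb1] := rat_in_itvoo (lt2 p.1).
  have [a2 ha2] := rat_in_itvoo (lt1 p.2); have [b2 hb2] := rat_in_itvoo (lt2 p.2).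
  move: ha1 hb1 ha2 hb2; rewrite !in_itv/= => /andP[? ?] /andP[? ?] /andP[? ?] /andP[? ?].
  exists ((a1, b1), (a2, b2)) => //; rewrite asboolT; first by split; rewrite /= in_itv/=; apply/andP.
  move=> q [/=]; rewrite !in_itv/= => /andP[? ?] /andP[? ?]; apply: eU.
  split; rewrite /ball/= ltr_norml; lra.
apply: countable_bigcupT_measurable; first exact: countableP.
move=> r; case: asboolP => // _; by apply: measurableX; exact: measurable_itv.
Qed.

Lemma continuous_plane_measurable Z : continuous Z -> measurable_fun setT Z.
Proof.
move=> cZ; apply: (measurability _ (RGenOpens.measurableE R)).
move=> _ [_ [c [d ->] <-]]; rewrite setTI; apply: open_plane_measurable.
by apply: open_comp => //; exact: interval_open.
Qed.

(** Tonelli is applied to the positive and negative parts separately, so that no integrability of F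
    has to be known. *)
Lemma measurable_Rintegral d (T : measurableType d) (F : T * R -> R) :
  measurable_fun setT F -> measurable_fun setT (fun t => I (fun y => F (t, y))).
Proof.
move=> mF; have mE : measurable_fun setT (EFin \o F) by exact/measurable_EFinP.
have m1 := @measurable_fun_fubini_tonelli_F _ _ _ _ _ mu _ (measurable_funepos mE)
  (funepos_ge0 _).
have m2 := @measurable_fun_fubini_tonelli_F _ _ _ _ _ mu _ (measurable_funeneg mE)
  (funeneg_ge0 _).
have := measurableT_comp (@fine_measurable R _ measurableT) (emeasurable_funB m1 m2).
apply: eq_measurable_fun => t _ /=; rewrite /Rintegral [in RHS]integralE.
by congr (fine (_ - _)); rewrite /fubini_F; apply: eq_integral => y _; rewrite ?funeposE ?funenegE.
Qed.

Lemma lipschitz_derive a a' B : (forall x : R, is_derive x 1 a (a' x)) ->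
  (forall x, `|a' x| <= B) -> forall x y, `|a x - a y| <= B * `|x - y|.
Proof.
move=> da aB.
have ca : continuous a.
  move=> x; apply: differentiable_continuous; apply/derivable1_diffP.
  exact: (@ex_derive _ _ _ _ _ _ _ (da x)).
suff H x y : x < y -> `|a y - a x| <= B * `|y - x|.
  move=> x y; have [xy|xy|->] := ltgtP x y; last by rewrite !subrr normr0 mulr0.
    by rewrite distrC (distrC x); exact: H.
  exact: H.
move=> xy; have [c _ ->] := MVT xy (fun z _ => da z) (continuous_subspaceT ca).
by rewrite normrM ler_wpM2r.
Qed.

Lemma smooth_lipschitz a : smooth a -> exists2 B, 0 <= B & forall x y, `|a x - a y| <= B * `|x - y|.
Proof.
move=> /smoothP[_ /smoothP[[B aB] _ _] da]; exists B.
  exact: le_trans (normr_ge0 _) (aB 0).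
exact: lipschitz_derive da aB.
Qed.

Lemma smooth_taylor a : smooth a -> exists2 B, 0 <= B &
  forall z h, `|a (z + h) - a z - h * derive1 a z| <= B * h ^+ 2.
Proof.
move=> sa; have [_ sa' da] := smoothP sa.
have [B B0 aB] := smooth_lipschitz sa'.
have ca := smooth_continuous sa; exists B => // z h.
have [h0|h0|->] := ltgtP h 0; last by rewrite addr0 subrr mul0r subr0 normr0 expr0n mulr0.
- have zh : z + h < z by rewrite gtrDl.
  have [c] := MVT zh (fun z _ => da z) (continuous_subspaceT ca).
  rewrite in_itv/= => /andP[c1 c2] E.
  rewrite (_ : _ - _ = h * (derive1 a c - derive1 a z)); last first.
    by move: E; lra.
  rewrite normrM -[h ^+ 2]real_normK ?num_real// expr2 mulrCA ler_wpM2l//.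
  apply: le_trans (aB _ _) _; rewrite ler_wpM2l// ltr0_norm// ler_norml; lra.
- have zh : z < z + h by rewrite ltrDl.
  have [c] := MVT zh (fun z _ => da z) (continuous_subspaceT ca).
  rewrite in_itv/= => /andP[c1 c2] E.
  rewrite (_ : _ - _ = h * (derive1 a c - derive1 a z)); last first.
    by move: E; lra.
  rewrite normrM -[h ^+ 2]real_normK ?num_real// expr2 mulrCA ler_wpM2l//.
  apply: le_trans (aB _ _) _; rewrite ler_wpM2l// gtr0_norm// ler_norml; lra.
Qed.

Lemma smooth_measurable a : smooth a -> measurable_fun setT a.
Proof. by move=> sa; apply: continuous_measurable_fun; exact: smooth_continuous. Qed.

Lemma bounded_on2_mul A C B Z (h : R * R -> R) : bounded_on2 A C Z ->
  measurable_fun setT h -> (forall p, `|h p| <= B) ->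
  bounded_on2 A (C * B) (fun p => Z p * h p).
Proof.
move=> [mZ ZC ZA] mh hB; split; first exact: measurable_funM.
  by move=> p; rewrite normrM ler_pM.
by move=> p /ZA ->; rewrite mul0r.
Qed.

Lemma bounded_on1_mul A C B g (h : R -> R) : bounded_on1 A C g ->
  measurable_fun setT h -> (forall p, `|h p| <= B) ->
  bounded_on1 A (C * B) (fun p => g p * h p).
Proof.
move=> [mZ ZC ZA] mh hB; split; first exact: measurable_funM.
  by move=> p; rewrite normrM ler_pM.
by move=> p /ZA ->; rewrite mul0r.
Qed.

Lemma Rintegral2_bound A C Z : bounded_on2 A C Z -> `|II Z| <= C * (2 * `|A|) ^+ 2.
Proof.
move=> H; rewrite (fubini12 H); apply: le_trans (Rintegral_bound (bounded_on1_Rintegral1 H)) _.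
by rewrite expr2 -!mulrA.
Qed.

(** The bounded support is carried by Z; the kernels are only bounded with bounded derivatives. This
    admits primitives of mollifiers and the constant 1 as kernels. *)
Definition conv2 Z a b (p : R * R) : R :=
  II (fun q => Z q * (a (p.1 - q.1) * b (p.2 - q.2))).

Let measurable_shift1 a (t : R) : smooth a -> measurable_fun setT (fun q : R * R => a (t - q.1)).
Proof.
move=> sa; apply: measurableT_comp; first exact: smooth_measurable.
by apply: measurable_funB => //; exact: measurable_fst.
Qed.

Let measurable_shift2 a (t : R) : smooth a -> measurable_fun setT (fun q : R * R => a (t - q.2)).
Proof.
move=> sa; apply: measurableT_comp; first exact: smooth_measurable.
by apply: measurable_funB => //; exact: measurable_snd.
Qed.

Lemma bounded_on2_conv A C Z a b p : bounded_on2 A C Z -> smooth a -> smooth b ->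
  exists C', bounded_on2 A C' (fun q => Z q * (a (p.1 - q.1) * b (p.2 - q.2))).
Proof.
move=> H sa sb; have [[Ba aB] _ _] := smoothP sa; have [[Bb bB] _ _] := smoothP sb.
exists (C * (Ba * Bb)); apply: bounded_on2_mul => //.
  by apply: measurable_funM; [exact: measurable_shift1|exact: measurable_shift2].
by move=> q; rewrite normrM ler_pM.
Qed.

(** Increments are moved onto the kernels, where Taylor bounds are available: c is the increment h
    for the two derivatives and 0 for continuity. *)
Lemma conv2_lincomb A C Z (a1 a2 a3 b1 b2 b3 : R -> R) (p1 p2 p3 : R * R) (c : R) :
  bounded_on2 A C Z -> smooth a1 -> smooth a2 -> smooth a3 ->
  smooth b1 -> smooth b2 -> smooth b3 ->
  conv2 Z a1 b1 p1 - conv2 Z a2 b2 p2 - c * conv2 Z a3 b3 p3 =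
  II (fun q => Z q * (a1 (p1.1 - q.1) * b1 (p1.2 - q.2) -
    a2 (p2.1 - q.1) * b2 (p2.2 - q.2) - c * (a3 (p3.1 - q.1) * b3 (p3.2 - q.2)))).
Proof.
move=> H sa1 sa2 sa3 sb1 sb2 sb3; rewrite /conv2.
have [C1 H1] := bounded_on2_conv p1 H sa1 sb1.
have [C2 H2] := bounded_on2_conv p2 H sa2 sb2.
have [C3 H3] := bounded_on2_conv p3 H sa3 sb3.
have i1 := bounded_integrable2 H1; have i2 := bounded_integrable2 H2.
have i3 := bounded_integrable2 H3.
rewrite -RintegralZl// -RintegralB// -RintegralB//.
- by apply: eq_Rintegral => q _; rewrite !mulrBr; congr (_ - _); rewrite mulrCA.
- exact: (integrableB measurableT i1 i2).
- exact: (integrableZl measurableT c i3).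
Qed.


Lemma is_derive_conv2_t A C Z a b (p : R * R) : bounded_on2 A C Z -> smooth a -> smooth b ->
  is_derive p (1, 0) (conv2 Z a b) (conv2 Z (derive1 a) b p).
Proof.
move=> H sa sb; have [Ba Ba0 aT] := smooth_taylor sa; have [[Bb bB] _ _] := smoothP sb.
have [_ sa' _] := smoothP sa.
apply: (@is_derive_quadratic _ _ _ _ _ _ (C * (Ba * Bb) * (2 * `|A|) ^+ 2) 1) => // h _.
rewrite (conv2_lincomb _ _ _ _ H)//.
rewrite (_ : _ * h ^+ 2 = (C * (Ba * h ^+ 2 * Bb)) * (2 * `|A|) ^+ 2); last by ring.
apply: Rintegral2_bound; apply: bounded_on2_mul => //.
  apply: measurable_funB; [apply: measurable_funB|apply: measurable_funM => //];
   by apply: measurable_funM; [exact: measurable_shift1|exact: measurable_shift2].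
move=> q /=; rewrite /GRing.scale/= mulr1 mulr0 add0r mulrA -!mulrBl normrM ler_pM//.
by have := aT (p.1 - q.1) h; rewrite (_ : p.1 - q.1 + h = h + p.1 - q.1)//; lra.
Qed.

Lemma is_derive_conv2_x A C Z a b (p : R * R) : bounded_on2 A C Z -> smooth a -> smooth b ->
  is_derive p (0, 1) (conv2 Z a b) (conv2 Z a (derive1 b) p).
Proof.
move=> H sa sb; have [Bb Bb0 bT] := smooth_taylor sb; have [[Ba aB] _ _] := smoothP sa.
have [_ sb' _] := smoothP sb.
apply: (@is_derive_quadratic _ _ _ _ _ _ (C * (Ba * Bb) * (2 * `|A|) ^+ 2) 1) => // h _.
rewrite (conv2_lincomb _ _ _ _ H)//.
rewrite (_ : _ * h ^+ 2 = (C * (Ba * (Bb * h ^+ 2))) * (2 * `|A|) ^+ 2); last by ring.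
apply: Rintegral2_bound; apply: bounded_on2_mul => //.
  apply: measurable_funB; [apply: measurable_funB|apply: measurable_funM => //];
   by apply: measurable_funM; [exact: measurable_shift1|exact: measurable_shift2].
move=> q /=; rewrite /GRing.scale/= mulr1 mulr0 add0r mulrCA -!mulrBr normrM ler_pM//.
by have := bT (p.2 - q.2) h; rewrite (_ : p.2 - q.2 + h = h + p.2 - q.2)//; lra.
Qed.

Lemma lipschitz_plane_continuous Z K :
  (forall p q, `|Z p - Z q| <= K * (`|p.1 - q.1| + `|p.2 - q.2|)) -> continuous Z.
Proof.
move=> ZK p; apply/cvgrPdist_le => e e0.
have K0 : 0 < 2 * (`|K| + 1) by rewrite mulr_gt0// ltr_wpDl.
have r0 : 0 < e / (2 * (`|K| + 1)) by exact: divr_gt0.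
have c1 : fst q @[q --> p] --> p.1 by exact: cvg_fst.
have c2 : snd q @[q --> p] --> p.2 by exact: cvg_snd.
near=> q.
have h1 : `|p.1 - q.1| < e / (2 * (`|K| + 1)).
  by near: q; move/cvgrPdist_lt: c1 => /(_ _ r0).
have h2 : `|p.2 - q.2| < e / (2 * (`|K| + 1)).
  by near: q; move/cvgrPdist_lt: c2 => /(_ _ r0).
apply: le_trans (ZK p q) _.
have K1 : 0 < `|K| + 1 by rewrite ltr_wpDl.
have h3 : `|p.1 - q.1| + `|p.2 - q.2| <= e / (`|K| + 1).
  have -> : e / (`|K| + 1) = e / (2 * (`|K| + 1)) + e / (2 * (`|K| + 1)).
    by field; rewrite gt_eqF.
  by apply: lerD; exact: ltW.
apply: (@le_trans _ _ (`|K| * (e / (`|K| + 1)))).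
  apply: (@le_trans _ _ (`|K| * (`|p.1 - q.1| + `|p.2 - q.2|))).
    by rewrite ler_wpM2r ?addr_ge0// ler_norm.
  by rewrite ler_wpM2l.
rewrite mulrA ler_pdivrMr// mulrC ler_wpM2l ?ltW//; lra.
Unshelve. all: by end_near. Qed.

Lemma continuous_conv2 A C Z a b : bounded_on2 A C Z -> smooth a -> smooth b ->
  continuous (conv2 Z a b).
Proof.
move=> H sa sb.
have [Ka Ka0 aK] := smooth_lipschitz sa; have [[Ba aB] _ _] := smoothP sa.
have [Kb Kb0 bK] := smooth_lipschitz sb; have [[Bb bB] _ _] := smoothP sb.
have Ba0 : 0 <= Ba by exact: le_trans (normr_ge0 _) (aB 0).
have Bb0 : 0 <= Bb by exact: le_trans (normr_ge0 _) (bB 0).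
have C0 : 0 <= C by case: H => _ h _; exact: le_trans (normr_ge0 _) (h (0, 0)).
apply: (@lipschitz_plane_continuous _ (C * (Ka * Bb + Ba * Kb) * (2 * `|A|) ^+ 2)) => p q.
have -> : conv2 Z a b p - conv2 Z a b q =
   conv2 Z a b p - conv2 Z a b q - 0 * conv2 Z a b p by rewrite mul0r subr0.
rewrite (conv2_lincomb _ _ _ _ H)//.
apply: (@le_trans _ _ (C * (Ka * `|p.1 - q.1| * Bb + Ba * (Kb * `|p.2 - q.2|)) * (2 * `|A|) ^+ 2)).
  apply: Rintegral2_bound; apply: bounded_on2_mul => //.
    apply: measurable_funB; [apply: measurable_funB|apply: measurable_funM => //];
     by apply: measurable_funM; [exact: measurable_shift1|exact: measurable_shift2].
  move=> r; rewrite mul0r subr0.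
  rewrite (_ : _ - _ = (a (p.1 - r.1) - a (q.1 - r.1)) * b (p.2 - r.2) +
    a (q.1 - r.1) * (b (p.2 - r.2) - b (q.2 - r.2))); last by ring.
  apply: le_trans (ler_normD _ _) _; rewrite !normrM; apply: lerD.
    apply: ler_pM => //; apply: le_trans (aK _ _) _.
    by rewrite (_ : p.1 - r.1 - (q.1 - r.1) = p.1 - q.1)//; ring.
  apply: ler_pM => //; apply: le_trans (bK _ _) _.
  by rewrite (_ : p.2 - r.2 - (q.2 - r.2) = p.2 - q.2)//; ring.
have := normr_ge0 (p.1 - q.1); have := normr_ge0 (p.2 - q.2).
have : 0 <= (2 * `|A|) ^+ 2 by rewrite exprn_ge0// mulr_ge0.
move: (_ ^+ 2) `|p.1 - q.1| `|p.2 - q.2| => D x y D0 y0 x0.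
rewrite (_ : C * _ * D = (C * D) * (Ka * x * Bb + Ba * (Kb * y))); last by ring.
rewrite (_ : _ * (x + y) = (C * D) * ((Ka * Bb + Ba * Kb) * (x + y))); last by ring.
rewrite ler_wpM2l ?mulr_ge0//.
have : 0 <= Ba * Kb * x by rewrite !mulr_ge0.
have : 0 <= Ka * Bb * y by rewrite !mulr_ge0.
by lra.
Qed.

Lemma Cn_plane_conv2 n A C Z a b : bounded_on2 A C Z -> smooth a -> smooth b ->
  Cn_plane n (conv2 Z a b).
Proof.
move=> H; elim: n a b => [|n IH] a b sa sb; first by split=> //; exact: continuous_conv2 H _ _.
have [_ sa' _] := smoothP sa; have [_ sb' _] := smoothP sb.
apply: (@Cn_plane_intro _ _ _ (conv2 Z (derive1 a) b) (conv2 Z a (derive1 b))).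
- exact: continuous_conv2 H _ _.
- by move=> p; exact: is_derive_conv2_t H _ _.
- by move=> p; exact: is_derive_conv2_x H _ _.
- exact: IH.
- exact: IH.
Qed.

End Convolution.

(** * One-sided mollifiers and convergence at Lebesgue points *)

Section Mollifier.
Context {R : realType}.
Implicit Types (g : R -> R) (Z : R * R -> R) (A C : R) (a b : R -> R) (n : nat).

Local Notation mu := (@lebesgue_measure R).
Local Notation mm := (@lebesgue_measure R \x @lebesgue_measure R)%E.
Local Notation I g := (Rintegral (@lebesgue_measure R) setT g).
Local Notation II Z := (Rintegral mm setT Z).

(** Its derivative [bump_n n] lives on [0, 1 / (n + 1)], so a mollification at x sees only points
    before x. In time, for t >= 1 / (m + 1), only nonnegative times are seen. *)
Definition step_n n (z : R) : R := step (n.+1%:R * z).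
Definition bump_n n (z : R) : R := n.+1%:R * bump (n.+1%:R * z).

Lemma smooth_step_n n : smooth (step_n n).
Proof.
move=> k; have := smooth_upto_affine n.+1%:R 0 (@smooth_step R k).
by congr smooth_upto; apply/funext => z; rewrite addr0.
Qed.

Lemma smooth_bump_n n : smooth (bump_n n).
Proof.
move=> k; have := smooth_uptoZ n.+1%:R (smooth_upto_affine n.+1%:R 0 (@smooth_bump R k)).
by congr smooth_upto; apply/funext => z; rewrite addr0.
Qed.

Lemma is_derive_step_n n (z : R) : is_derive z 1 (step_n n) (bump_n n z).
Proof.
have d1 : is_derive z (1 : R) (fun y : R => n.+1%:R * y) n.+1%:R.
  have D := is_deriveZ n.+1%:R (is_derive_id z (1 : R)).
  by apply: (is_derive_eq D); rewrite /GRing.scale/= mulr1.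
have D := @is_derive1_comp _ (@step R) _ _ _ _ (is_derive_step _) d1.
by apply: (is_derive_eq D); rewrite mulrC.
Qed.

Lemma derive_step_n n : derive1 (step_n n) = bump_n n.
Proof.
apply/funext => z; rewrite derive1E.
exact: (@derive_val _ _ _ _ _ _ _ (is_derive_step_n n z)).
Qed.

Lemma step_n_ge0 n z : 0 <= step_n n z. Proof. exact: step_ge0. Qed.
Lemma step_n_le1 n z : step_n n z <= 1. Proof. exact: step_le1. Qed.
Lemma bump_n_ge0 n z : 0 <= bump_n n z.
Proof. by rewrite mulr_ge0// bump_ge0. Qed.
Lemma step_n0 n z : z <= 0 -> step_n n z = 0.
Proof. by move=> z0; rewrite /step_n step0// pmulr_rle0. Qed.
Lemma step_n1 n z : n.+1%:R^-1 <= z -> step_n n z = 1.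
Proof. by move=> z0; rewrite /step_n step1// mulrC -ler_pdivrMr// mul1r. Qed.
Lemma bump_n0 n z : z <= 0 \/ n.+1%:R^-1 <= z -> bump_n n z = 0.
Proof.
move=> H; rewrite /bump_n bump_eq0 ?mulr0//.
case: H => H; [left; by rewrite pmulr_rle0|right; by rewrite mulrC -ler_pdivrMr// mul1r].
Qed.

Lemma inv_n_le1 n : n.+1%:R^-1 <= 1 :> R.
Proof. by rewrite invf_le1// ler1n. Qed.

Lemma Rintegral_derive (F f : R -> R) (a b : R) : a < b ->
  (forall x : R, is_derive x 1 F (f x)) -> continuous f ->
  Rintegral mu `[a, b] f = F b - F a.
Proof.
move=> ab dF cf; rewrite /Rintegral (continuous_FTC2 ab (F := F)) //.
- exact: continuous_subspaceT.
- have cF : continuous F.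
    move=> x; apply: differentiable_continuous; apply/derivable1_diffP.
    exact: (@ex_derive _ _ _ _ _ _ _ (dF x)).
  split; first by move=> x _; exact: (@ex_derive _ _ _ _ _ _ _ (dF x)).
    by apply: cvg_at_right_filter; exact: cF.
  by apply: cvg_at_left_filter; exact: cF.
- by move=> x _; rewrite derive1E; exact: (@derive_val _ _ _ _ _ _ _ (dF x)).
Qed.

Lemma Rintegral_derive_supp (F f : R -> R) (a b : R) : a < b ->
  (forall x : R, is_derive x 1 F (f x)) -> continuous f ->
  (forall x, x < a \/ b < x -> f x = 0) -> I f = F b - F a.
Proof.
move=> ab dF cf f0; rewrite -(Rintegral_derive ab dF cf) [in RHS]Rintegral_mkcond.
apply: eq_Rintegral => x _; rewrite patchE; case: ifPn => // /negP xab.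
apply: f0; apply: contrapT => /not_orP[/negP h1 /negP h2]; apply: xab.
by rewrite inE/= in_itv/= !leNgt h1.
Qed.

Definition conv1 g b (x : R) : R := I (fun y => g y * b (x - y)).

Lemma measurable_reflect b x : smooth b -> measurable_fun setT (fun y : R => b (x - y)).
Proof.
move=> sb; apply: measurableT_comp; first exact: smooth_measurable.
exact: measurable_funB.
Qed.

Lemma bounded_on1_conv A C g b x : bounded_on1 A C g -> smooth b ->
  exists C', bounded_on1 A C' (fun y => g y * b (x - y)).
Proof.
move=> H sb; have [[B bB] _ _] := smoothP sb; exists (C * B).
by apply: bounded_on1_mul => //; exact: measurable_reflect.
Qed.

Lemma bounded_on1_bump_n n x : exists C,
  bounded_on1 (`|x| + 1) C (fun y => bump_n n (x - y)).
Proof.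
have [[B bB] _ _] := smoothP (smooth_bump_n n); exists B; split; [|by move=> y; exact: bB|].
- exact: (measurable_reflect x (smooth_bump_n n)).
- move=> y; have := inv_n_le1 n; have := ler_norm x; have := ler_norm (- x).
  rewrite normrN => h1 h2 h3; rewrite lter_normr => /orP[h|h];
    apply: bump_n0; move: h3; move: (_^-1) => u h3; [left|right]; lra.
Qed.

Lemma Rintegral_bump_n n x : I (fun y => bump_n n (x - y)) = 1.
Proof.
have n1 := inv_n_le1 n.
have lt : x - 1 < x by lra.
have dF (y : R) : is_derive y 1 (fun y => - step_n n (x - y)) (bump_n n (x - y)).
  have d1 : is_derive y (1 : R) (fun y : R => x - y) (- 1).
    have D := @is_deriveB _ _ _ _ _ _ _ _ _ (is_derive_cst x y (1 : R)) (is_derive_id y (1 : R)).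
    by apply: (is_derive_eq D); rewrite sub0r.
  have D := is_deriveN (@is_derive1_comp _ (step_n n) (fun y => x - y) _ _ _
    (is_derive_step_n _ _) d1).
  by apply: (is_derive_eq D); rewrite mulrN1 opprK.
have cf : continuous (fun y => bump_n n (x - y)).
  move=> y; apply: (@continuous_comp _ _ _ (fun y => x - y) (bump_n n)).
    by apply: cvgB; [exact: cvg_cst|exact: cvg_id].
  by apply: smooth_continuous; exact: smooth_bump_n.
rewrite (Rintegral_derive_supp lt dF cf).
  by rewrite subrr (step_n0 n (lexx 0)) step_n1 ?subKr// oppr0 sub0r opprK.
by move=> y h; apply: bump_n0; move: n1; move: (_^-1) => u n1; case: h => h; [right|left]; lra.
Qed.

Lemma conv1_bump_n_bound A C g n x : bounded_on1 A C g -> `|conv1 g (bump_n n) x| <= C.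
Proof.
move=> H; have [C' H'] := bounded_on1_conv x H (smooth_bump_n n).
have i1 := bounded_integrable1 H'.
have [C2 H2] := bounded_on1_bump_n n x.
have i2 := bounded_integrable1 H2.
apply: le_trans (le_normr_Rintegral _ i1) _ => //.
rewrite -[leRHS]mulr1 -(Rintegral_bump_n n x) -RintegralZl//.
apply: le_Rintegral => //.
- exact: (integrable_norm i1).
- exact: (integrableZl measurableT C i2).
- move=> y _; rewrite normrM (ger0_norm (bump_n_ge0 _ _)) ler_wpM2r ?bump_n_ge0//.
  by case: H.
Qed.

Lemma bounded_locally_integrable A C g : bounded_on1 A C g -> locally_integrable setT g.
Proof.
move=> H; apply: open_integrable_locally; first exact: openT.
exact: (bounded_integrable1 H).
Qed.

(** The error is at most (n + 1) B times the integral of |g - g x| over the ball of radius 2 / (n +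
    1), that is 4 B times the average over a ball of measure 4 / (n + 1), which vanishes at a
    Lebesgue point. The kernels need not be translates of one profile: averages over intervals
    around x are covered too. *)
Lemma approximate_identity A C g x B (k : nat -> R -> R) :
  bounded_on1 A C g -> lebesgue_pt g x ->
  (forall n, measurable_fun setT (k n)) -> (forall n y, `|k n y| <= n.+1%:R * B) ->
  (forall n y, ~ ball x (2 * n.+1%:R^-1) y -> k n y = 0) -> (forall n, I (k n) = 1) ->
  I (fun y => g y * k n y) @[n --> \oo] --> g x.
Proof.
move=> H gx mk kB k0 k1.
have B0 : 0 <= B by have := le_trans (normr_ge0 _) (kB 0%N 0); rewrite mul1r.
pose r n : R := 2 * n.+1%:R^-1.
have r0 n : 0 < r n by rewrite mulr_gt0// invr_gt0.
have r2 n : r n <= 2 by have := inv_n_le1 n; rewrite /r; move: (_^-1) => u; lra.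
have rcvg : r n @[n --> \oo] --> (0 : R).
  by rewrite -[0](mulr0 2); apply: cvgM; [exact: cvg_cst|exact: cvg_harmonic].
pose h y := `|g y - g x|.
have Hh n : bounded_on1 (`|x| + 3) (C + `|g x|) (h \_ (ball x (r n))).
  case: H => mg gC gA; split.
  - apply/(measurable_restrictT _ _).1; first exact: measurable_ball.
    apply: measurable_funTS; apply: measurableT_comp => //.
    exact: measurable_funB.
  - move=> y; rewrite patchE; case: ifPn => _.
      by rewrite /h normr_id (le_trans (ler_normB _ _))// lerD2r.
    by rewrite normr0 addr_ge0// (le_trans _ (gC 0)).
  - move=> y xy; rewrite patchE memNset// => /=; rewrite /ball/= => xr.
    have := r2 n; have := ler_normB x (x - y); rewrite subKr; lra.
pose D n := I (h \_ (ball x (r n))).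
have DE n : fine (davg g x (r n)) = D n / (r n *+ 2).
  have fin : (\int[mu]_(y in ball x (r n)) `|((center (g x) \o g) y)%:E|)%E =
      (D n)%:E.
    rewrite /D -Rintegral_mkcond /Rintegral fineK//.
    have := bounded_integrable1 (Hh n); rewrite -restrict_EFin => ih.
    apply: integrable_fin_num; first exact: measurable_ball.
    by apply/(integrable_mkcond _ _).2 => //; exact: measurable_ball.
  rewrite /davg /iavg fin lebesgue_measure_ball ?ltW// inver gt_eqF ?pmulrn_lgt0//.
  by rewrite -EFinM/= mulrC.
move: gx => /fine_cvgP[_ /cvg_at_rightP/(_ r (conj r0 rcvg)) gx].
apply/cvgrPdist_le => e e0.
have e1 : 0 < e / (4 * (B + 1)) by rewrite divr_gt0// mulr_gt0// ltr_wpDl.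
near=> n.
have : `|0 - fine (davg g x (r n))| <= e / (4 * (B + 1)).
  by near: n; move/cvgrPdist_le : gx => /(_ _ e1).
rewrite DE sub0r normrN => Dn.
have : `|g x - I (fun y => g y * k n y)| <= n.+1%:R * B * D n.
  have H1 := bounded_on1_mul H (mk n) (kB n).
  have H2 : bounded_on1 (`|x| + 3) (n.+1%:R * B) (k n).
    split => // y xy; apply: k0; rewrite /ball/= -/(r n) => xr.
    have := r2 n; have := ler_normB x (x - y); rewrite subKr; lra.
  have i1 := bounded_integrable1 H1; have i2 := bounded_integrable1 H2.
  have ih := bounded_integrable1 (Hh n).
  have i3 := integrableZl measurableT (g x) i2.
  have i4 := integrableB measurableT i3 i1.
  rewrite -[X in `|X - _|]mulr1 -[X in `|_ * X - _|](k1 n) -RintegralZl// -RintegralB//.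
  apply: le_trans (le_normr_Rintegral _ i4) _ => //.
  rewrite /D -RintegralZl//; apply: le_Rintegral => //.
  - exact: (integrable_norm i4).
  - exact: (integrableZl measurableT _ ih).
  move=> y _; rewrite -mulrBl normrM; case: ifPn => [_|/negP yr].
    by rewrite /h distrC mulrC ler_wpM2r.
  by rewrite k0 ?normr0 ?mulr0// => xr; apply: yr; rewrite inE.
move=> /le_trans; apply.
have D0 : 0 <= D n.
  by apply: Rintegral_ge0 => y _ /=; case: ifPn => _; [exact: normr_ge0|exact: lexx].
move: Dn; rewrite ger0_norm; last by rewrite divr_ge0// mulrn_wge0// ltW.
rewrite /r mulr2n -mulrDl => Dn.
rewrite (_ : _ * _ * _ = 4 * B * (D n / ((2 + 2) / n.+1%:R))); last first.
  have : (n.+1%:R : R) != 0 by rewrite pnatr_eq0.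
  by move: (n.+1%:R : R) (D n) => u v u0; field; rewrite u0//= -natrD pnatr_eq0.
apply: (@le_trans _ _ (4 * B * (e / (4 * (B + 1))))).
  by rewrite ler_wpM2l ?mulr_ge0.
rewrite mulrA ler_pdivrMr ?mulr_gt0 ?ltr_wpDl//; nra.
Unshelve. all: by end_near. Qed.

Lemma conv1_bump_n_lebesgue_pt A C g x : bounded_on1 A C g -> lebesgue_pt g x ->
  conv1 g (bump_n n) x @[n --> \oo] --> g x.
Proof.
move=> H gx; have [[B bB] _ _] := smoothP (@smooth_bump R).
apply: (@approximate_identity _ _ _ _ B (fun n y => bump_n n (x - y)) H gx).
- by move=> n; apply: measurable_reflect; exact: smooth_bump_n.
- by move=> n y; rewrite /bump_n normrM ger0_norm// ler_wpM2l.
- move=> n y yr; apply: bump_n0; apply: contrapT => /not_orP[/negP + /negP].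
  rewrite -!ltNge => h1 h2; apply: yr.
  rewrite /ball/= gtr0_norm// (lt_trans h2)//.
  have : 0 < n.+1%:R^-1 :> R by rewrite invr_gt0.
  by move: (_^-1) => u; lra.
- by move=> n; exact: Rintegral_bump_n.
Qed.

Lemma conv1_bump_n_cvg A C g : bounded_on1 A C g ->
  {ae mu, forall x, conv1 g (bump_n n) x @[n --> \oo] --> g x}.
Proof.
move=> H; have := lebesgue_differentiation (bounded_locally_integrable H).
apply: filterS; first exact: (ae_filter_ringOfSetsType mu).
by move=> x; exact: conv1_bump_n_lebesgue_pt H.
Qed.

Lemma conv1_step_n_cvg A C g x : bounded_on1 A C g ->
  conv1 g (step_n n) x @[n --> \oo] --> I (fun y => g y * (y < x)%R%:R).
Proof.
move=> H; have [mg gC gA] := H.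
apply: (@dominated1 _ A C (fun n y => g y * step_n n (x - y))).
- move=> n; rewrite -[C]mulr1; apply: bounded_on1_mul => //.
    by apply: measurable_reflect; exact: smooth_step_n.
  by move=> y; rewrite ger0_norm ?step_n_ge0 ?step_n_le1.
- apply: measurable_funM => //.
  rewrite (_ : (fun _ => _) = \1_(`]-oo, x[%classic)); first exact: measurable_indic.
  by apply/funext => y; rewrite indicE mem_setE in_itv.
- apply: aeW => y; apply: cvgMr.
  have [yx|yx] := ltP y x; last first.
    apply: cvg_near_cst; apply: nearW => n; rewrite step_n0//; lra.
  have xy : 0 < x - y by lra.
  apply: cvg_near_cst; near=> n; rewrite step_n1// ltW//.
  by near: n; exact: (near_infty_natSinv_lt (PosNum xy)).
Unshelve. all: by end_near. Qed.

Lemma conv2E12 A C Z a b t x : bounded_on2 A C Z -> smooth a -> smooth b ->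
  conv2 Z a b (t, x) = conv1 (fun s => conv1 (fun y => Z (s, y)) b x) a t.
Proof.
move=> H sa sb; have [C' H'] := bounded_on2_conv (t, x) H sa sb.
rewrite /conv2 (fubini12 H') /conv1; apply: eq_Rintegral => s _.
have [C2 H2] := bounded_on1_conv x (bounded_on2_section1 s H) sb.
rewrite -RintegralZr//; last exact: (bounded_integrable1 H2).
by apply: eq_Rintegral => y _; rewrite mulrCA mulrC -mulrA; congr (_ * _).
Qed.

Lemma conv2E21 A C Z a b t x : bounded_on2 A C Z -> smooth a -> smooth b ->
  conv2 Z a b (t, x) = conv1 (fun y => conv1 (fun s => Z (s, y)) a t) b x.
Proof.
move=> H sa sb; have [C' H'] := bounded_on2_conv (t, x) H sa sb.
rewrite /conv2 (fubini21 H') /conv1; apply: eq_Rintegral => y _.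
have [C2 H2] := bounded_on1_conv t (bounded_on2_section2 y H) sa.
rewrite -RintegralZr//; last exact: (bounded_integrable1 H2).
by apply: eq_Rintegral => s _; rewrite mulrA.
Qed.

End Mollifier.

(** * The potential of a weak solution *)

Section Potential.
Context {R : realType}.
Implicit Types (g b : R -> R) (Z : R * R -> R) (A C t x y z : R) (m n : nat) (p : R * R).

Local Notation mu := (@lebesgue_measure R).
Local Notation mm := (@lebesgue_measure R \x @lebesgue_measure R)%E.
Local Notation I g := (Rintegral (@lebesgue_measure R) setT g).
Local Notation II Z := (Rintegral mm setT Z).

(** The functions of interest have unbounded support, while the integration lemmas require a bounded
    one. All identities below are local, so they are proved for data cut off to a box large enough
    to contain the supports of the kernels. *)
Definition cutoff1 (A : R) (g : R -> R) (y : R) : R := g y * (`|y| <= A)%R%:R.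
Definition cutoff2 (A : R) (Z : R * R -> R) (p : R * R) : R :=
  Z p * ((`|p.1| <= A) && (`|p.2| <= A))%R%:R.

Lemma measurable_ltn (d : measure_display) (X : measurableType d) (f g : X -> R) :
  measurable_fun setT f -> measurable_fun setT g ->
  measurable_fun setT (fun x : X => (f x < g x)%R%:R : R).
Proof.
move=> mf mg; rewrite (_ : (fun _ => _) = (fun x : X => if f x < g x then 1 else 0)).
  by apply: measurable_fun_ifT => //; exact: measurable_fun_ltr.
by apply/funext => x; case: ifP.
Qed.

Lemma bounded_on1_cutoff1 A C g : measurable_fun setT g -> (forall x, `|g x| <= C) ->
  bounded_on1 A C (cutoff1 A g).
Proof.
move=> mg gC; split.
- rewrite (_ : cutoff1 A g = (fun x => if `|x| <= A then g x else 0)).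
    apply: measurable_fun_ifT => //.
    by apply: measurable_fun_ler => //; exact: measurableT_comp.
  by apply/funext => x; rewrite /cutoff1; case: ifP; rewrite ?mulr1 ?mulr0.
- move=> x; rewrite /cutoff1; case: (`|x| <= A); first by rewrite mulr1.
  by rewrite mulr0 normr0 (le_trans _ (gC 0)).
- by move=> x; rewrite ltNge /cutoff1 => /negbTE ->; rewrite mulr0.
Qed.

Lemma bounded_on2_cutoff2 A C Z : measurable_fun setT Z -> (forall p, `|Z p| <= C) ->
  bounded_on2 A C (cutoff2 A Z).
Proof.
move=> mg gC; split.
- rewrite (_ : cutoff2 A Z = (fun p => if (`|p.1| <= A) && (`|p.2| <= A) then Z p else 0)).
    apply: measurable_fun_ifT => //; apply: measurable_and.
      by apply: measurable_fun_ler => //; apply: measurableT_comp => //; exact: measurable_fst.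
    by apply: measurable_fun_ler => //; apply: measurableT_comp => //; exact: measurable_snd.
  by apply/funext => x; rewrite /cutoff2; case: ifP; rewrite ?mulr1 ?mulr0.
- move=> x; rewrite /cutoff2; case: (_ && _); first by rewrite mulr1.
  by rewrite mulr0 normr0 (le_trans _ (gC (0, 0))).
- by move=> p; rewrite !ltNge /cutoff2 => -[/negbTE ->|/negbTE ->]; rewrite ?andbF mulr0.
Qed.

Lemma ae_dense (P : R -> Prop) (a b : R) : a < b -> {ae mu, forall x, P x} ->
  exists2 x, a < x < b & P x.
Proof.
move=> ab aeP; apply: contrapT => nP.
have ng : mu.-negligible `]a, b[.
  apply: negligibleS aeP => x; rewrite /= in_itv/= => abx Px.
  by apply: nP; exists x.
have : mu `]a, b[%classic = 0%E by apply/negligibleP.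
by rewrite lebesgue_measure_itv/= lte_fin ab => -[] /eqP; rewrite subr_eq0 gt_eqF.
Qed.

Lemma cvg_sub2 (f g : nat -> R) (k l1 l2 : R) :
  f n @[n --> \oo] --> l1 -> g n @[n --> \oo] --> l2 ->
  (f n - k - g n) @[n --> \oo] --> l1 - k - l2.
Proof. by move=> f1 g2; apply: cvgB => //; apply: cvgB => //; exact: cvg_cst. Qed.

Lemma continuous_section (Z : R * R -> R) (t : R) : continuous Z ->
  continuous (fun x : R => Z (t, x)).
Proof.
move=> cZ x; apply: (@continuous_comp _ _ _ (fun x : R => (t, x)) Z); last exact: cZ.
have h1 : cst t @ (nbhs x) --> t by exact: cvg_cst.
have h2 : id @ (nbhs x) --> x by exact: cvg_id.
exact: (cvg_pair h1 h2).
Qed.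

Lemma norm_between (u c v : R) : u < c -> c < v -> `|c| <= `|u| + `|v|.
Proof.
move=> uc cv; rewrite ler_norml.
have := ler_norm u; have := ler_norm v; have := ler_norm (- u); have := ler_norm (- v).
by rewrite !normrN; have := normr_ge0 u; have := normr_ge0 v; lra.
Qed.

Lemma is_derive_section_x Z t z d : is_derive (t, z) (0, 1) Z d ->
  is_derive z 1 (fun y : R => Z (t, y)) d.
Proof.
move=> /is_derive_line D; apply/is_derive_line.
have -> : (fun h : R => Z (t, h *: (1 : R) + z)) = (fun h : R => Z (h *: (0, 1) + (t, z))).
  apply/funext => h; congr Z; rewrite [RHS]surjective_pairing/=.
  by congr pair; rewrite /GRing.scale/= mulr0 add0r.
exact: D.
Qed.

Lemma Rintegral_bound_itv A B C (g : R -> R) (s t : R) : bounded_on1 A B g -> s <= t -> 0 <= C ->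
  (forall r, `|g r| <= C * (s <= r <= t)%R%:R) -> `|I g| <= C * (t - s).
Proof.
move=> H st C0 gC; have ig := bounded_integrable1 H.
apply: le_trans (le_normr_Rintegral _ ig) _ => //.
have fin : (mu `[s, t]%classic < +oo)%E.
  by rewrite lebesgue_measure_itv; case: ifP => _; rewrite ?ltry.
have iI : mu.-integrable setT (EFin \o \1_(`[s, t]%classic : set R)).
  have := @bounded_integrable _ _ _ mu `[s, t]%classic 1 \1_(`[s, t]%classic : set R); apply => //.
  - by move=> x; rewrite ger0_norm// indicE; case: (_ \in _).
  - by move=> x xA; rewrite indicE memNset.
have -> : C * (t - s) = I (fun r => C * \1_(`[s, t]%classic : set R) r).
  have E : fine (mu `[s, t]%classic) = t - s.
    rewrite lebesgue_measure_itv/= lte_fin.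
    by move: st; rewrite le_eqVlt => /predU1P[->|->]//; rewrite ltxx subrr.
  by rewrite RintegralZl// -E /Rintegral integral_indic// setIT.
apply: le_Rintegral => //.
- exact: (integrable_norm ig).
- exact: (integrableZl measurableT C iI).
- by move=> r _; rewrite indicE mem_setE in_itv/=; exact: gC.
Qed.

Variables (U N : R * R -> R) (u0 : R -> R) (M L : R).
Hypothesis mU : measurable_fun setT U.
Hypothesis mN : measurable_fun setT N.
Hypothesis mu0 : measurable_fun setT u0.
Hypothesis bU : forall p, `|U p| <= M.
Hypothesis bN : forall p, `|N p| <= L.
Hypothesis bu0 : forall x, `|u0 x| <= M.
Hypothesis U_neg : forall p, p.1 <= 0 -> U p = 0.
Hypothesis N_neg : forall p, p.1 <= 0 -> N p = 0.
Hypothesis weakU : forall phi, test_function phi ->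
  II (fun p => U p * dt phi p + N p * dx phi p) + I (fun x => u0 x * phi (0, x)) = 0.

Let M0 : 0 <= M. Proof. exact: le_trans (normr_ge0 _) (bu0 0). Qed.
Let L0 : 0 <= L. Proof. exact: le_trans (normr_ge0 _) (bN (0, 0)). Qed.

Definition flux_integral (t y : R) : R := I (fun s => N (s, y) * (s < t)%R%:R).

(* Mollification in x of a primitive of u0, normalised at 0, minus the flux through x up
   to time t. *)
Definition potential_n (n : nat) (p : R * R) : R :=
  I (fun y => u0 y * (step_n n (p.2 - y) - (y < 0)%R%:R)) -
  I (fun y => flux_integral p.1 y * bump_n n (p.2 - y)).

(* Turns one-dimensional convolutions of u0 into two-dimensional ones. *)
Definition initial_lift (A : R) (p : R * R) : R := cutoff1 A u0 p.2 * bump_n 0 (- p.1).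

(** Cut-off version of [potential_n], mollified in t as well. It is smooth in both variables and may
    therefore enter a test function. *)
Definition potential_mn (A : R) (m n : nat) (p : R * R) : R :=
  conv2 (initial_lift A) (fun=> 1) (step_n n) p - I (fun y => cutoff1 A u0 y * (y < 0)%R%:R) -
  conv2 (cutoff2 A N) (step_n m) (bump_n n) p.

Let bN2 A : bounded_on2 A L (cutoff2 A N). Proof. exact: bounded_on2_cutoff2. Qed.
Let bU2 A : bounded_on2 A M (cutoff2 A U). Proof. exact: bounded_on2_cutoff2. Qed.
Let bu1 A : bounded_on1 A M (cutoff1 A u0). Proof. exact: bounded_on1_cutoff1. Qed.

Let smooth1 : smooth (fun=> 1 : R). Proof. by move=> n; exact: smooth_upto_cst. Qed.

Lemma bounded_initial_lift A : 1 <= A -> exists C, bounded_on2 A C (initial_lift A).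
Proof.
move=> A1; have [[B bB] _ _] := smoothP (@smooth_bump_n R 0).
have [m1 b1 s1] := bu1 A; exists (M * B); split.
- apply: measurable_funM; first by apply: measurableT_comp => //; exact: measurable_snd.
  apply: measurableT_comp; first by apply: smooth_measurable; exact: smooth_bump_n.
  by apply: measurableT_comp => //; exact: measurable_fst.
- by move=> p; rewrite normrM ler_pM.
- move=> p [h|h]; last by rewrite /initial_lift s1// mul0r.
  rewrite /initial_lift bump_n0 ?mulr0// invr1.
  move: h; rewrite lter_normr => /orP[h|h]; [left|right]; lra.
Qed.

Lemma conv2_initial_lift A b p : 1 <= A -> smooth b ->
  conv2 (initial_lift A) (fun=> 1) b p = conv1 (cutoff1 A u0) b p.2.
Proof.
move=> A1 sb; have [C H] := bounded_initial_lift A1.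
rewrite [p in LHS]surjective_pairing (conv2E21 _ _ H)//.
apply: eq_Rintegral => y _; congr (_ * _); rewrite /conv1 /initial_lift/=.
under eq_Rintegral do rewrite mulr1.
have [C2 H2] := bounded_on1_bump_n 0 (0 : R).
have i2 := bounded_integrable1 H2.
have E := RintegralZl (cutoff1 A u0 y) measurableT i2.
rewrite Rintegral_bump_n mulr1 in E; rewrite -[RHS]E.
by apply: eq_Rintegral => s _; rewrite sub0r.
Qed.

Lemma flux_integral_trunc A t y : t <= A -> `|y| <= A ->
  flux_integral t y = I (fun s => cutoff2 A N (s, y) * (s < t)%R%:R).
Proof.
move=> tA yA; apply: eq_Rintegral => s _; rewrite /cutoff2/= yA andbT.
have [st|st] := ltP s t; last by rewrite !mulr0.
have [s0|s0] := leP s 0; first by rewrite N_neg// !mul0r.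
by have -> : `|s| <= A; [rewrite ler_norml; lra|rewrite /= !mulr1].
Qed.

Lemma bounded_cutoff2_lt A t : bounded_on2 A (L * 1) (fun p => cutoff2 A N p * (p.1 < t)%R%:R).
Proof.
apply: bounded_on2_mul => //.
  by apply: measurable_ltn => //; exact: measurable_fst.
by move=> y; case: (_ < _); rewrite ?normr1// normr0.
Qed.

Lemma bounded_flux_trunc A t : bounded_on1 A (L * 1 * (2 * `|A|))
  (fun y => I (fun s => cutoff2 A N (s, y) * (s < t)%R%:R)).
Proof. by have := bounded_on1_Rintegral2 (bounded_cutoff2_lt A t). Qed.

Lemma flux_mollified A n t x : t <= A -> `|x| + 1 <= A ->
  I (fun y => flux_integral t y * bump_n n (x - y)) =
  conv1 (fun y => I (fun s => cutoff2 A N (s, y) * (s < t)%R%:R)) (bump_n n) x.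
Proof.
move=> tA xA.
have x1 := ler_norm x; have x2 := ler_norm (- x); rewrite normrN in x2.
apply: eq_Rintegral => y _; have n1 := @inv_n_le1 R n.
have [yx|yx] := leP (x - y) 0; first by rewrite bump_n0 ?mulr0//; left.
have [yx'|yx'] := leP 1 (x - y).
  by rewrite bump_n0 ?mulr0//; right; exact: le_trans yx'.
by congr (_ * _); apply: flux_integral_trunc => //; rewrite ler_norml; lra.
Qed.

Lemma initial_mollified A n x : `|x| + 1 <= A ->
  I (fun y => u0 y * (step_n n (x - y) - (y < 0)%R%:R)) =
  conv1 (cutoff1 A u0) (step_n n) x - I (fun y => cutoff1 A u0 y * (y < 0)%R%:R).
Proof.
move=> xA; apply/esym.
have x1 := ler_norm x; have x2 := ler_norm (- x); rewrite normrN in x2.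
have [C1 H1] := bounded_on1_conv x (bu1 A) (smooth_step_n n).
have H2 : bounded_on1 A (M * 1) (fun y => cutoff1 A u0 y * (y < 0)%R%:R).
  apply: bounded_on1_mul => //; first exact: measurable_ltn.
  by move=> y; case: (_ < _); rewrite ?normr1// normr0.
rewrite /conv1 -RintegralB//; [|exact: bounded_integrable1 H1|exact: bounded_integrable1 H2].
apply: eq_Rintegral => y _ /=; rewrite -mulrBr /cutoff1.
have [yA|yA] := leP `|y| A; first by rewrite mulr1.
rewrite mulr0 mul0r.
rewrite (_ : _ - _ = 0) ?mulr0//; have n1 := @inv_n_le1 R n.
move: yA; rewrite lter_normr => /orP[h|h].
  have -> : (y < 0) = false by apply/negbTE; rewrite -leNgt; lra.
  by rewrite step_n0 ?subr0//; lra.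
have -> : y < 0 by lra.
by rewrite step_n1 ?subrr//; move: n1; move: (_^-1) => u n1; lra.
Qed.

Lemma potential_mn_cvg A n t x : t <= A -> `|x| + 1 <= A ->
  potential_mn A m n (t, x) @[m --> \oo] --> potential_n n (t, x).
Proof.
move=> tA xA; have A1 : 1 <= A by apply: le_trans xA; rewrite lerDr.
have x1 := ler_norm x; have x2 := ler_norm (- x); rewrite normrN in x2.
apply: cvgB.
  suff <- : conv2 (initial_lift A) (fun=> 1) (step_n n) (t, x) -
    I (fun y => cutoff1 A u0 y * (y < 0)%R%:R) =
    I (fun y => u0 y * (step_n n (x - y) - (y < 0)%R%:R)) by exact: cvg_cst.
  by rewrite conv2_initial_lift ?(initial_mollified _ xA)//; exact: smooth_step_n.
rewrite /potential_n/=.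
under eq_cvg do rewrite (conv2E21 t x (bN2 A) (smooth_step_n _) (smooth_bump_n n)).
have [[B bB] _ _] := smoothP (@smooth_bump_n R n).
rewrite (flux_mollified _ tA xA).
pose K := L * (2 * `|A|) * B.
apply: (@dominated1 _ A K (fun m y => conv1 (fun s => cutoff2 A N (s, y)) (step_n m) t * bump_n n (x - y))).
- move=> m.
  have H' : bounded_on2 A (L * 1) (fun p => cutoff2 A N p * step_n m (t - p.1)).
    apply: bounded_on2_mul => //.
      apply: measurableT_comp; first by apply: smooth_measurable; exact: smooth_step_n.
      by apply: measurable_funB => //; exact: measurable_fst.
    by move=> p; rewrite ger0_norm ?step_n_ge0 ?step_n_le1.
  have H3 : bounded_on1 A (L * (2 * `|A|))
      (fun y => conv1 (fun s => cutoff2 A N (s, y)) (step_n m) t).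
    by have := bounded_on1_Rintegral2 H'; rewrite mulr1.
  apply: bounded_on1_mul; first exact: H3.
    by apply: measurable_reflect; exact: smooth_bump_n.
  by move=> y; exact: bB.
- apply: measurable_funM; last by apply: measurable_reflect; exact: smooth_bump_n.
  have H' : bounded_on2 A (L * 1) (fun p => cutoff2 A N p * (p.1 < t)%R%:R).
    apply: bounded_on2_mul => //.
      by apply: measurable_ltn => //; exact: measurable_fst.
    by move=> y; case: (_ < _); rewrite ?normr1// normr0.
  by have [] := bounded_on1_Rintegral2 H'.
- apply: aeW => y; apply: cvgMl.
  exact: conv1_step_n_cvg (bounded_on2_section2 y (bN2 A)).
Qed.

Lemma is_derive_reflect (g g' : R -> R) (t s : R) : (forall z : R, is_derive z 1 g (g' z)) ->
  is_derive s 1 (fun r : R => g (t - r)) (- g' (t - s)).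
Proof.
move=> dg; have d1 : is_derive s (1 : R) (fun y : R => t - y) (- 1).
  have D := @is_deriveB _ _ _ _ _ _ _ _ _ (is_derive_cst t s (1 : R)) (is_derive_id s (1 : R)).
  by apply: (is_derive_eq D); rewrite sub0r.
have D := @is_derive1_comp _ g (fun y => t - y) s _ _ (dg _) d1.
by apply: (is_derive_eq D); rewrite mulrN1.
Qed.

Lemma smooth_reflect g t : smooth g -> smooth (fun s => g (t - s)).
Proof.
move=> sg k; have := smooth_upto_affine (-1) t (sg k).
by congr smooth_upto; apply/funext => z; congr g; rewrite mulN1r addrC.
Qed.

Lemma derive1_eq0_outside g (a b z : R) : (forall y, y < a \/ b < y -> g y = 0) ->
  z < a \/ b < z -> derive1 g z = 0.
Proof.
move=> g0 zab; have : is_derive z 1 g 0.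
  apply: (@near_eq_is_derive _ _ _ (cst 0)).
  case: zab => h; near=> y; rewrite g0//; [left|right]; near: y.
    exact: lt_nbhsl.
  exact: lt_nbhsr.
by move=> D; rewrite derive1E (@derive_val _ _ _ _ _ _ _ D).
Unshelve. all: by end_near. Qed.

Lemma is_derive_tensor (a b a' b' : R -> R) p :
  (forall z : R, is_derive z 1 a (a' z)) -> (forall z : R, is_derive z 1 b (b' z)) ->
  is_derive p (1, 0) (fun q => a q.1 * b q.2) (a' p.1 * b p.2) /\
  is_derive p (0, 1) (fun q => a q.1 * b q.2) (a p.1 * b' p.2).
Proof.
move=> da db.
have a1 := is_derive_comp1 (da p.1) (is_derive_fst p (1, 0)).
have a2 := is_derive_comp1 (da p.1) (is_derive_fst p (0, 1)).
have b1 := is_derive_comp1 (db p.2) (is_derive_snd p (1, 0)).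
have b2 := is_derive_comp1 (db p.2) (is_derive_snd p (0, 1)).
have D1 := is_deriveM a1 b1; have D2 := is_deriveM a2 b2; split.
  by apply: (is_derive_eq D1); rewrite /GRing.scale/=; ring.
by apply: (is_derive_eq D2); rewrite /GRing.scale/=; ring.
Qed.

Lemma Cn_plane_tensor k (a b : R -> R) : smooth a -> smooth b ->
  Cn_plane k (fun q : R * R => a q.1 * b q.2).
Proof.
move=> sa sb; apply: Cn_planeM; apply: Cn_plane_comp => //; first exact: Cn_plane_fst.
exact: Cn_plane_snd.
Qed.

Lemma test_function_tensor (a b : R -> R) (a1 a2 b1 b2 : R) : smooth a -> smooth b ->
  (forall z, z < a1 \/ a2 < z -> a z = 0) -> (forall z, z < b1 \/ b2 < z -> b z = 0) ->
  test_function (fun q => a q.1 * b q.2).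
Proof.
move=> sa sb a0 b0; split; first by move=> k; exact: Cn_plane_tensor.
apply: (@compact_supp_box _ _ a1 a2 b1 b2) => p; rewrite mulf_eq0 => /norP[/eqP ap /eqP bp].
rewrite !leNgt; split; apply/andP; split; apply/negP => h.
- by apply: ap; apply: a0; left.
- by apply: ap; apply: a0; right.
- by apply: bp; apply: b0; left.
- by apply: bp; apply: b0; right.
Qed.

(* The weak formulation tested against [step_m (t - s) * bump_n (x - y)]; the factor
   [step_n 0 (s + 2)] equals 1 for s >= -1 and makes the test function compactly
   supported. *)
Lemma weak_mollified A m n t x : t <= A -> `|x| + 1 <= A ->
  conv2 (cutoff2 A U) (bump_n m) (bump_n n) (t, x) +
  conv2 (cutoff2 A N) (step_n m) (derive1 (bump_n n)) (t, x) =
  step_n m t * conv1 (cutoff1 A u0) (bump_n n) x.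
Proof.
move=> tA xA; have A1 : 1 <= A by apply: le_trans xA; rewrite lerDr.
have x1 := ler_norm x; have x2 := ler_norm (- x); rewrite normrN in x2.
pose a s := step_n 0 (s + 2) * step_n m (t - s).
pose b y := bump_n n (x - y).
have sa : smooth a.
  move=> k; apply: smooth_uptoM; last exact: smooth_reflect (@smooth_step_n _ m) k.
  have := smooth_upto_affine 1 2 (@smooth_step_n R 0 k).
  by congr smooth_upto; apply/funext => z; rewrite mul1r.
have sb : smooth b by apply: smooth_reflect; exact: smooth_bump_n.
have [_ sb1 db1] := smoothP (@smooth_bump_n R n).
pose a' s := bump_n 0 (s + 2) * step_n m (t - s) - step_n 0 (s + 2) * bump_n m (t - s).
have da (z : R) : is_derive z 1 a (a' z).
  have d1 : is_derive z (1 : R) (fun y : R => y + 2) 1.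
    have D := @is_deriveD _ _ _ _ _ _ _ _ _ (is_derive_id z (1 : R)) (is_derive_cst (2 : R) z (1 : R)).
    by apply: (is_derive_eq D); rewrite addr0.
  have d2 := @is_derive1_comp _ (step_n 0) (fun y => y + 2) z _ _ (is_derive_step_n 0 _) d1.
  have d3 := @is_derive_reflect _ _ t z (@is_derive_step_n _ m).
  apply: (is_derive_eq (is_deriveM d2 d3)).
  rewrite /GRing.scale/= /a'.
  by move: (bump_n 0 _) (step_n m _) (step_n 0 _) (bump_n m _) => *; ring.
have db (z : R) : is_derive z 1 b (- derive1 (bump_n n) (x - z)) by exact: is_derive_reflect.
have b0 z : z < x - 1 \/ x < z -> b z = 0.
  move=> h; apply: bump_n0; have := @inv_n_le1 R n; move: (_^-1) => u u1.
  by case: h => h; [right|left]; lra.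
have tst : test_function (fun q => a q.1 * b q.2).
  apply: (@test_function_tensor a b (- 2) t (x - 1) x) => // z [h|h]; rewrite /a.
    by rewrite step_n0 ?mul0r//; lra.
  by rewrite [step_n m _]step_n0 ?mulr0//; lra.
have aE s : 0 <= s -> a s = step_n m (t - s).
  by move=> s0; rewrite /a step_n1 ?mul1r// invr1; lra.
have a'E s : 0 <= s -> a' s = - bump_n m (t - s).
  move=> s0; rewrite /a' bump_n0 ?mul0r; last by right; rewrite invr1; lra.
  by rewrite step_n1 ?invr1; [rewrite mul1r sub0r|lra].
have := weakU tst.
have -> : I (fun z => u0 z * (a 0 * b z)) = step_n m t * conv1 (cutoff1 A u0) (bump_n n) x.
  have [C1 H1] := bounded_on1_conv x (bu1 A) (smooth_bump_n n).
  rewrite /conv1 -RintegralZl//; last exact: bounded_integrable1 H1.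
  apply: eq_Rintegral => y _; rewrite aE// subr0 mulrCA; congr (_ * _).
  rewrite /cutoff1; have [yA|yA] := leP `|y| A; first by rewrite mulr1.
  rewrite b0 ?mulr0 ?mul0r//.
  by move: yA; rewrite lter_normr => /orP[h|h]; [right|left]; lra.
have [C1 H1] := bounded_on2_conv (t, x) (bU2 A) (smooth_bump_n m) (smooth_bump_n n).
have [C2 H2] := bounded_on2_conv (t, x) (bN2 A) (smooth_step_n m) sb1.
have i1 := bounded_integrable2 H1; have i2 := bounded_integrable2 H2.
suff -> : II (fun p => U p * dt (fun q => a q.1 * b q.2) p + N p * dx (fun q => a q.1 * b q.2) p) =
    - (conv2 (cutoff2 A U) (bump_n m) (bump_n n) (t, x) +
       conv2 (cutoff2 A N) (step_n m) (derive1 (bump_n n)) (t, x)).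
  by move=> /eqP; rewrite addrC subr_eq0 => /eqP.
rewrite /conv2 -RintegralD// -mulN1r -RintegralZl//; last first.
  exact: (integrableD measurableT i1 i2).
apply: eq_Rintegral => /=.
move=> p _; have [D1 D2] := is_derive_tensor p da db.
rewrite (dtE D1) (dxE D2) mulN1r opprD.
(* U and N vanish up to time 0, which hides the region where the factor [step_n 0 (s + 2)] differs
   from 1. *)
have [p0|p0] := leP p.1 0; first by rewrite /cutoff2 U_neg// N_neg// !mul0r !oppr0 !addr0.
rewrite aE ?a'E ?ltW// mulNr mulrN !mulrN /cutoff2.
have [pA|pA] := boolP ((`|p.1| <= A) && (`|p.2| <= A)); first by rewrite !mulr1.
rewrite mulr0 !mul0r; move: pA; rewrite negb_and -!ltNge !lter_normr => /orP[/orP|/orP] [h|h].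
- by rewrite bump_n0 ?step_n0 ?mul0r ?mulr0//; [lra|left; lra].
- lra.
- rewrite b0; last by right; lra.
  rewrite (@derive1_eq0_outside _ 0 1) ?mulr0//; last by left; lra.
  move=> y hy; apply: bump_n0; have := @inv_n_le1 R n; move: (_^-1) => u u1.
  by case: hy => hy; [left|right]; lra.
- rewrite b0; last by left; lra.
  rewrite (@derive1_eq0_outside _ 0 1) ?mulr0//; last by right; lra.
  move=> y hy; apply: bump_n0; have := @inv_n_le1 R n; move: (_^-1) => u u1.
  by case: hy => hy; [left|right]; lra.
Qed.

Lemma is_derive_potential_mn_t A m n p : 1 <= A ->
  is_derive p (1, 0) (potential_mn A m n) (- conv2 (cutoff2 A N) (bump_n m) (bump_n n) p).
Proof.
move=> A1; have [C H] := bounded_initial_lift A1.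
have d1 := is_derive_conv2_t p H smooth1 (smooth_step_n n).
have d2 := is_derive_conv2_t p (bN2 A) (smooth_step_n m) (smooth_bump_n n).
have d3 := is_deriveB (is_deriveB d1
  (is_derive_cst (I (fun y => cutoff1 A u0 y * (y < 0)%R%:R)) p (1, 0))) d2.
apply: (is_derive_eq d3); rewrite derive_step_n subr0.
rewrite [X in X - _](_ : _ = 0) ?sub0r// /conv2.
rewrite (@eq_Rintegral _ _ _ _ _ (cst 0)) ?Rintegral_cst ?mul0r// => q _.
by rewrite derive1E (@derive_val _ _ _ _ _ _ _ (is_derive_cst (1 : R) _ _)) mul0r mulr0.
Qed.

Lemma is_derive_potential_mn_x A m n p : 1 <= A ->
  is_derive p (0, 1) (potential_mn A m n) (conv1 (cutoff1 A u0) (bump_n n) p.2 -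
    conv2 (cutoff2 A N) (step_n m) (derive1 (bump_n n)) p).
Proof.
move=> A1; have [C H] := bounded_initial_lift A1.
have d1 := is_derive_conv2_x p H smooth1 (smooth_step_n n).
have d2 := is_derive_conv2_x p (bN2 A) (smooth_step_n m) (smooth_bump_n n).
have d3 := is_deriveB (is_deriveB d1
  (is_derive_cst (I (fun y => cutoff1 A u0 y * (y < 0)%R%:R)) p (0, 1))) d2.
apply: (is_derive_eq d3); rewrite derive_step_n subr0 conv2_initial_lift//.
exact: smooth_bump_n.
Qed.

(** The weak equation enters here. Differentiation in x gives the initial datum minus a flux term;
    once [step_n m t] = 1 the equation identifies this difference with the mollified U. *)
Lemma potential_mn_dx A m n t x : m.+1%:R^-1 <= t -> t <= A -> `|x| + 1 <= A ->
  is_derive (t, x) (0, 1) (potential_mn A m n)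
    (conv2 (cutoff2 A U) (bump_n m) (bump_n n) (t, x)).
Proof.
move=> mt tA xA; have A1 : 1 <= A by apply: le_trans xA; rewrite lerDr.
have := weak_mollified m n tA xA; rewrite step_n1// mul1r => /eqP.
rewrite -subr_eq0 => /eqP E.
have D := @is_derive_potential_mn_x A m n (t, x) A1.
have <- : conv1 (cutoff1 A u0) (bump_n n) x -
  conv2 (cutoff2 A N) (step_n m) (derive1 (bump_n n)) (t, x) =
  conv2 (cutoff2 A U) (bump_n m) (bump_n n) (t, x) by lra.
exact: D.
Qed.

Lemma bounded_on1_conv1_section A C Z b x : bounded_on2 A C Z -> smooth b ->
  exists B, bounded_on1 A B (fun s => conv1 (fun y => Z (s, y)) b x).
Proof.
move=> H sb; have [[B bB] _ _] := smoothP sb.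
have H' : bounded_on2 A (C * B) (fun q => Z q * b (x - q.2)).
  apply: bounded_on2_mul => //.
  apply: measurableT_comp; first exact: smooth_measurable.
  by apply: measurable_funB => //; exact: measurable_snd.
by exists (C * B * (2 * `|A|)); exact: bounded_on1_Rintegral1 H'.
Qed.

Lemma conv2_bump_bound A C Z m n p : bounded_on2 A C Z ->
  `|conv2 Z (bump_n m) (bump_n n) p| <= C.
Proof.
move=> H; rewrite [p]surjective_pairing (conv2E12 _ _ H); [|exact: smooth_bump_n|exact: smooth_bump_n].
have [B [m1 _ m3]] := bounded_on1_conv1_section p.2 H (smooth_bump_n n).
apply: (@conv1_bump_n_bound _ A); split => // s.
exact: conv1_bump_n_bound (bounded_on2_section1 s H).
Qed.

(** For large m the x-slope of [potential_mn] is a mollification of U, hence bounded by M, and the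
    bound passes to the limit in m. *)
Lemma potential_n_lipschitz_x n t x y : 0 < t ->
  `|potential_n n (t, x) - potential_n n (t, y)| <= M * `|x - y|.
Proof.
move=> t0; suff H u v : u < v ->
    `|potential_n n (t, v) - potential_n n (t, u)| <= M * `|v - u|.
  have [xy|xy|->] := ltgtP x y; last by rewrite !subrr normr0 mulr0.
    by rewrite distrC (distrC x); exact: H.
  exact: H.
move=> uv; pose A := t + `|u| + `|v| + 1.
have u0' := normr_ge0 u; have v0 := normr_ge0 v.
have tA : t <= A by rewrite /A; lra.
have uA : `|u| + 1 <= A by rewrite /A; lra.
have vA : `|v| + 1 <= A by rewrite /A; lra.
have Dcvg : `|potential_mn A m n (t, v) - potential_mn A m n (t, u)| @[m --> \oo] -->
    `|potential_n n (t, v) - potential_n n (t, u)|.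
  by apply: cvg_norm; apply: cvgB; exact: potential_mn_cvg.
rewrite -(cvg_lim _ Dcvg)//; apply: limr_le; first by apply/cvg_ex; eexists; exact: Dcvg.
near=> m.
have mt : m.+1%:R^-1 <= t.
  by apply: ltW; near: m; exact: (near_infty_natSinv_lt (PosNum t0)).
have u1 := ler_norm (- u); have v1 := ler_norm v; rewrite normrN in u1.
pose g z := potential_mn A m n (t, z).
have A1 : 1 <= A by apply: le_trans uA; rewrite lerDr.
have dg z : is_derive z 1 g (conv1 (cutoff1 A u0) (bump_n n) z -
    conv2 (cutoff2 A N) (step_n m) (derive1 (bump_n n)) (t, z)).
  exact: is_derive_section_x (@is_derive_potential_mn_x A m n (t, z) A1).
have cg : continuous g.
  move=> z; apply: differentiable_continuous; apply/derivable1_diffP.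
  exact: (@ex_derive _ _ _ _ _ _ _ (dg z)).
have [c] := MVT uv (fun z _ => dg z) (continuous_subspaceT cg).
rewrite in_itv/= => /andP[uc cv] E.
have cA : `|c| + 1 <= A.
  by rewrite /A lerD2r (le_trans (norm_between uc cv))// -addrA lerDr ltW.
rewrite -/(g v) -/(g u) E normrM ler_wpM2r//.
have := weak_mollified m n tA cA; rewrite step_n1// mul1r => <-.
by rewrite addrK; exact: conv2_bump_bound.
Unshelve. all: by end_near. Qed.

Lemma flux_integral_lipschitz s t y : `|flux_integral s y - flux_integral t y| <= L * `|s - t|.
Proof.
wlog st : s t / s <= t.
  by move=> H; have [st|/ltW st] := leP s t; [exact: H|rewrite distrC (distrC s); exact: H].
pose A := `|s| + `|t| + `|y|.
have h1 := ler_norm s; have h2 := ler_norm t.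
have h3 := normr_ge0 s; have h4 := normr_ge0 t; have h5 := normr_ge0 y.
have sA : s <= A by rewrite /A; lra.
have tA : t <= A by rewrite /A; lra.
have yA : `|y| <= A by rewrite /A; lra.
rewrite !(@flux_integral_trunc A)//.
have Hr r : bounded_on1 A (L * 1) (fun s => cutoff2 A N (s, y) * (s < r)%R%:R).
  exact: (bounded_on2_section2 y (bounded_cutoff2_lt A r)).
have i1 := bounded_integrable1 (Hr s); have i2 := bounded_integrable1 (Hr t).
rewrite -RintegralB// [`|s - t|]distrC [`|t - s|]ger0_norm ?subr_ge0//.
have [m1 b1 s1] := Hr s; have [m2 b2 s2] := Hr t.
apply: (@Rintegral_bound_itv A (L * 1 + L * 1)) => //.
  split; first exact: measurable_funB.
    by move=> r; rewrite (le_trans (ler_normB _ _))// lerD.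
  by move=> r rA; rewrite s1// s2// subrr.
move=> r; rewrite -mulrBr normrM ler_pM//.
  by case: (bN2 A).
have [rs|rs] := ltP r s.
  by rewrite (lt_le_trans rs st) subrr normr0.
have [rt|rt] := ltP r t; last by rewrite subrr normr0.
by rewrite sub0r normrN normr1 (ltW rt).
Qed.

Lemma potential_n_lipschitz_t n s t x :
  `|potential_n n (s, x) - potential_n n (t, x)| <= L * `|s - t|.
Proof.
pose A := `|s| + `|t| + `|x| + 1.
have h1 := ler_norm s; have h2 := ler_norm t.
have h3 := normr_ge0 s; have h4 := normr_ge0 t; have h5 := normr_ge0 x.
have sA : s <= A by rewrite /A; lra.
have tA : t <= A by rewrite /A; lra.
have xA : `|x| + 1 <= A by rewrite /A; lra.
have E (a b c : R) : a - b - (a - c) = c - b by ring.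
rewrite /potential_n/= E.
rewrite (flux_mollified _ sA xA) (flux_mollified _ tA xA).
have Hs := bounded_flux_trunc A s; have Ht := bounded_flux_trunc A t.
have [C1 H1] := bounded_on1_conv x Hs (smooth_bump_n n).
have [C2 H2] := bounded_on1_conv x Ht (smooth_bump_n n).
have i1 := bounded_integrable1 H1; have i2 := bounded_integrable1 H2.
rewrite /conv1 -RintegralB//.
rewrite (_ : I _ = conv1 (fun y => I (fun r => cutoff2 A N (r, y) * (r < t)%R%:R) -
    I (fun r => cutoff2 A N (r, y) * (r < s)%R%:R)) (bump_n n) x); last first.
  by apply: eq_Rintegral => y _; rewrite -mulrBl.
have [m1 b1 s1] := Hs; have [m2 b2 s2] := Ht.
apply: (@conv1_bump_n_bound _ A); split; first exact: measurable_funB.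
  move=> y; have [yA|yA] := leP `|y| A; last first.
    by rewrite s1// s2// subrr normr0 mulr_ge0.
  by rewrite -!flux_integral_trunc// distrC; exact: flux_integral_lipschitz.
by move=> y yA; rewrite s1// s2// subrr.
Qed.

Lemma flux_integral_neg t y : t <= 0 -> flux_integral t y = 0.
Proof.
move=> t0; rewrite /flux_integral (@eq_Rintegral _ _ _ _ _ (cst 0)) ?Rintegral_cst ?mul0r//.
move=> s _ /=; have [st|st] := ltP s t; last by rewrite mulr0.
by rewrite N_neg; [rewrite mul0r|exact: ltW (lt_le_trans st t0)].
Qed.

Lemma potential_n_neg n t x : t <= 0 -> potential_n n (t, x) = potential_n n (0, x).
Proof.
move=> t0; rewrite /potential_n; apply: (congr1 (fun z => _ - z)).
by apply: eq_Rintegral => y _; rewrite !flux_integral_neg.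
Qed.

(** For t <= 0 the potential keeps its value at time 0, where the bound is inherited from small
    positive times through the Lipschitz estimate in t. *)
Lemma potential_n_lipschitz n t x y :
  `|potential_n n (t, x) - potential_n n (t, y)| <= M * `|x - y|.
Proof.
have [t0|t0] := ltP 0 t; first exact: potential_n_lipschitz_x.
rewrite !(potential_n_neg _ _ t0); apply/ler_addgt0Pr => e e0.
have d0 : 0 < e / (2 * (L + 1)) by rewrite divr_gt0// mulr_gt0// ltr_wpDl.
have Le : L * `|e / (2 * (L + 1))| <= e / 2.
  rewrite gtr0_norm// mulrA ler_pdivrMr ?mulr_gt0 ?ltr_wpDl//.
  by rewrite (_ : e / 2 * _ = e * (L + 1)); [rewrite mulrC ler_wpM2l ?ltW// ltrDl|field].
move: d0 Le; move: (e / (2 * (L + 1))) => d d0 Le.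
have := potential_n_lipschitz_x n x y d0.
have := potential_n_lipschitz_t n 0 d x.
have := potential_n_lipschitz_t n d 0 y.
rewrite sub0r normrN subr0.
move: (potential_n n (0, x)) (potential_n n (d, x)) (potential_n n (d, y))
  (potential_n n (0, y)) => u1 u2 u3 u4.
have -> : u1 - u4 = (u1 - u2) + ((u2 - u3) + (u3 - u4)) by ring.
have := ler_normD (u1 - u2) (u2 - u3 + (u3 - u4)); have := ler_normD (u2 - u3) (u3 - u4).
move: (`|_ + (_ + _)|) (`|_ + (u3 - u4)|) `|u1 - u2| `|u2 - u3| `|u3 - u4| => c0 c1 c2 c3 c4.
by move: (L * _) (M * _) Le => a b Le h1 h2 h3 h4 h5; lra.
Qed.

Lemma potential_n_cvg_ae A t : t <= A -> 
  {ae mu, forall x, `|x| + 1 <= A -> cvg (potential_n n (t, x) @[n --> \oo])}.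
Proof.
move=> tA; have Ht := bounded_flux_trunc A t.
have := conv1_bump_n_cvg Ht; apply: filterS; first exact: (ae_filter_ringOfSetsType mu).
move=> x cx xA.
rewrite (_ : (fun n => potential_n n (t, x)) = (fun n => conv1 (cutoff1 A u0) (step_n n) x -
  I (fun y => cutoff1 A u0 y * (y < 0)%R%:R) -
  conv1 (fun y => I (fun s => cutoff2 A N (s, y) * (s < t)%R%:R)) (bump_n n) x)); last first.
  by apply/funext => n; rewrite /potential_n/= (initial_mollified _ xA) (flux_mollified _ tA xA).
have c1 := @conv1_step_n_cvg _ A M (cutoff1 A u0) x (bu1 A).
have := @cvg_sub2 _ _ (I (fun y => cutoff1 A u0 y * (y < 0)%R%:R)) _ _ c1 cx.
by move=> /cvgP.
Qed.

Definition potential (p : R * R) : R := lim (potential_n n p @[n --> \oo]).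

(** Lebesgue differentiation gives convergence only for almost every x. Since the approximations are
    Lipschitz in x uniformly in n, the Cauchy property carries over to every point. *)
Lemma potential_n_cvg p : potential_n n p @[n --> \oo] --> potential p.
Proof.
case: p => t x; apply: cauchy_cvg; apply: cauchy_exP => e e0.
have e2 : 0 < e / (2 * (M + 1)) by rewrite divr_gt0// mulr_gt0// ltr_wpDl.
pose A := `|t| + `|x| + e / (2 * (M + 1)) + 1.
have tA : t <= A.
  have := ler_norm t; have := normr_ge0 x; rewrite /A => h1 h2.
  by rewrite -!addrA (le_trans h2)// lerDl !addr_ge0// ltW.
have xy : x < x + e / (2 * (M + 1)) by rewrite ltrDl.
have [y /andP[y1 y2] cy] := ae_dense xy (potential_n_cvg_ae tA).
have dxy : `|x - y| < e / (2 * (M + 1)) by rewrite distrC gtr0_norm; lra.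
have yA : `|y| + 1 <= A.
  rewrite /A lerD2r; have := ler_normD x (y - x); rewrite subrKC distrC => h.
  rewrite -addrA -[leLHS]add0r lerD// (le_trans h)// lerD2l.
  exact: ltW.
have /cvg_ex[l /= pl] := cy yA; exists l.
have e3 : 0 < e / 2 by rewrite divr_gt0.
near=> n; rewrite /ball/=.
have h1 : `|l - potential_n n (t, y)| < e / 2.
  by near: n; move/cvgrPdist_lt : pl => /(_ _ e3).
have h2 := potential_n_lipschitz n t y x.
have h3 : M * `|y - x| < e / 2.
  rewrite distrC (le_lt_trans (ler_wpM2l M0 (ltW dxy)))//.
  rewrite mulrA ltr_pdivrMr ?mulr_gt0 ?ltr_wpDl//.
  rewrite (_ : e / 2 * _ = e * (M + 1)); last by field.
  by rewrite mulrC ltr_pM2l// ltrDl.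
move: h1 h2; move: (potential_n n (t, y)) (potential_n n (t, x)) => u1 u2 h1 h2.
have := ler_normD (l - u1) (u1 - u2); rewrite addrA subrK => h4.
by lra.
Unshelve. all: by end_near. Qed.

Lemma potential_lipschitz p q :
  `|potential p - potential q| <= L * `|p.1 - q.1| + M * `|p.2 - q.2|.
Proof.
have D : `|potential_n n p - potential_n n q| @[n --> \oo] --> `|potential p - potential q|.
  by apply: cvg_norm; apply: cvgB; exact: potential_n_cvg.
rewrite -(cvg_lim _ D)//; apply: limr_le; first by apply/cvg_ex; eexists; exact: D.
near=> n; case: p q D => [t x] [s y] D /=.
rewrite -(subrKA (potential_n n (s, x))) (le_trans (ler_normD _ _))// lerD//.
  exact: potential_n_lipschitz_t.
exact: potential_n_lipschitz.
Unshelve. all: by end_near. Qed.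

Lemma potential_initial c x y : (forall z, c <= u0 z) -> x <= y ->
  c * (y - x) <= potential (0, y) - potential (0, x).
Proof.
move=> cu0 xy; pose A := `|x| + `|y| + 1.
have xA : `|x| + 1 <= A by rewrite /A lerD2r lerDl.
have yA : `|y| + 1 <= A by rewrite /A lerD2r lerDr.
pose W z := I (fun r => cutoff1 A u0 r * (r < z)%R%:R) - I (fun r => cutoff1 A u0 r * (r < 0)%R%:R).
have WE z : `|z| + 1 <= A -> potential (0, z) = W z.
  move=> zA; apply: cvg_lim => //; rewrite /potential_n/=.
  under eq_cvg do rewrite (initial_mollified _ zA).
  rewrite -[W z]subr0; apply: cvgB.
    apply: cvgB; last exact: cvg_cst.
    exact: conv1_step_n_cvg (bu1 A).
  rewrite (_ : (fun _ => _) = cst 0); first exact: cvg_cst.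
  apply/funext => n; under eq_Rintegral do rewrite flux_integral_neg// mul0r.
  by rewrite Rintegral_cst// mul0r.
have Hb z : bounded_on1 A (M * 1) (fun r => cutoff1 A u0 r * (r < z)%R%:R).
  apply: bounded_on1_mul => //; first exact: measurable_ltn.
  by move=> r; case: (r < z); rewrite ?normr1// normr0.
have i1 := bounded_integrable1 (Hb x); have i2 := bounded_integrable1 (Hb y).
rewrite !WE// /W.
have E (a b d : R) : a - b - (d - b) = a - d by ring.
rewrite E -RintegralB//.
have fin : (mu `[x, y[%classic < +oo)%E.
  by rewrite lebesgue_measure_itv; case: ifP => _; rewrite ?ltry.
have iI : mu.-integrable setT (EFin \o \1_(`[x, y[%classic : set R)).
  have := @bounded_integrable _ _ _ mu `[x, y[%classic 1 \1_(`[x, y[%classic : set R); apply => //.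
  - by move=> z; rewrite ger0_norm// indicE; case: (_ \in _).
  - by move=> z xz; rewrite indicE memNset.
have -> : c * (y - x) = I (fun r => c * \1_(`[x, y[%classic : set R) r).
  have Em : fine (mu `[x, y[%classic) = y - x.
    rewrite lebesgue_measure_itv/= lte_fin.
    by move: xy; rewrite le_eqVlt => /predU1P[->|->]//; rewrite ltxx subrr.
  by rewrite RintegralZl// -Em /Rintegral integral_indic// setIT.
apply: le_Rintegral => //.
- exact: (integrableZl measurableT c iI).
- exact: (integrableB measurableT i2 i1).
move=> r _; rewrite -mulrBr indicE mem_setE in_itv/=.
have [rx|rx] := ltP r x; first by rewrite (lt_le_trans rx xy)/= subrr !mulr0.
have [ry|ry] := ltP r y; last by rewrite subrr !mulr0.
rewrite subr0 !mulr1 /cutoff1.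
have -> : `|r| <= A; last by rewrite mulr1.
have h1 := ler_norm (- x); have h2 := ler_norm y; rewrite normrN in h1.
have h3 := normr_ge0 x; have h4 := normr_ge0 y.
by rewrite /A ler_norml; lra.
Qed.

(** What [conv2 Z (bump_n m) (bump_n n)] tends to, for almost every time, when m goes to
    infinity. *)
Definition moll_x (n : nat) (Z : R * R -> R) (p : R * R) : R :=
  conv1 (fun y => Z (p.1, y)) (bump_n n) p.2.

Lemma measurable_moll_x n Z : measurable_fun setT Z -> measurable_fun setT (moll_x n Z).
Proof.
move=> mZ; apply: (@measurable_Rintegral _ _ _ (fun q : (R * R) * R =>
  Z (q.1.1, q.2) * bump_n n (q.1.2 - q.2))).
have m1 : measurable_fun setT (fun q : (R * R) * R => q.1.1).
  by apply: measurableT_comp; [exact: measurable_fst|exact: measurable_fst].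
have m2 : measurable_fun setT (fun q : (R * R) * R => q.1.2).
  by apply: measurableT_comp; [exact: measurable_snd|exact: measurable_fst].
have m3 : measurable_fun setT (fun q : (R * R) * R => q.2) by exact: measurable_snd.
apply: measurable_funM.
  by apply: (measurableT_comp mZ); exact/measurable_fun_pairP.
apply: measurableT_comp; first by apply: smooth_measurable; exact: smooth_bump_n.
exact: measurable_funB.
Qed.

Lemma moll_x_bound A C n Z p : bounded_on2 A C Z -> `|moll_x n Z p| <= C.
Proof. by move=> H; exact: conv1_bump_n_bound (bounded_on2_section1 p.1 H). Qed.

Lemma conv2_bump_cvg_t A C n Z x : bounded_on2 A C Z ->
  {ae mu, forall t, conv2 Z (bump_n m) (bump_n n) (t, x) @[m --> \oo] --> moll_x n Z (t, x)}.
Proof.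
move=> H; have [B HB] := bounded_on1_conv1_section x H (smooth_bump_n n).
have := conv1_bump_n_cvg HB; apply: filterS; first exact: (ae_filter_ringOfSetsType mu).
move=> t; rewrite /moll_x/=.
rewrite (_ : (fun m => conv2 _ _ _ _) = (fun m =>
  conv1 (fun s => conv1 (fun y => Z (s, y)) (bump_n n) x) (bump_n m) t))//.
by apply/funext => m; apply: conv2E12 H _ _; exact: smooth_bump_n.
Qed.

Lemma moll_x_cvg A C Z t : bounded_on2 A C Z ->
  {ae mu, forall x, moll_x n Z (t, x) @[n --> \oo] --> Z (t, x)}.
Proof. by move=> H; exact: conv1_bump_n_cvg (bounded_on2_section1 t H). Qed.

Lemma Cn_plane_potential_mn k A m n : 1 <= A -> Cn_plane k (potential_mn A m n).
Proof.
move=> A1; have [C H] := bounded_initial_lift A1.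
have c1 := Cn_plane_conv2 k H smooth1 (smooth_step_n n).
have c2 := Cn_plane_conv2 k (bN2 A) (smooth_step_n m) (smooth_bump_n n).
have c3 := Cn_planeM (Cn_plane_cst k (-1)) c2.
have c4 := Cn_planeD (Cn_planeD c1 (Cn_plane_cst k (- I (fun y => cutoff1 A u0 y * (y < 0)%R%:R)))) c3.
rewrite (_ : potential_mn A m n = fun p => conv2 (initial_lift A) (fun=> 1) (step_n n) p +
    - I (fun y => cutoff1 A u0 y * (y < 0)%R%:R) +
    -1 * conv2 (cutoff2 A N) (step_n m) (bump_n n) p)//.
by apply/funext => p; rewrite mulN1r.
Qed.

Lemma lipschitz2_continuous (w : R * R -> R) (a b : R) : 0 <= a -> 0 <= b ->
  (forall p q, `|w p - w q| <= a * `|p.1 - q.1| + b * `|p.2 - q.2|) -> continuous w.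
Proof.
move=> a0 b0 H; apply: (@lipschitz_plane_continuous _ _ (a + b)) => p q.
apply: le_trans (H p q) _; rewrite mulrDr lerD// ler_wpM2r//.
  by rewrite lerDl.
by rewrite lerDr.
Qed.

Lemma continuous_potential : continuous potential.
Proof. exact: lipschitz2_continuous L0 M0 potential_lipschitz. Qed.

Lemma continuous_potential_n n : continuous (potential_n n).
Proof.
apply: (lipschitz2_continuous L0 M0) => -[t x] [s y] /=.
have := potential_n_lipschitz_t n t s x; have := potential_n_lipschitz n s x y.
move: (potential_n n (t, x)) (potential_n n (s, x)) (potential_n n (s, y)) => a b c h1 h2.
by rewrite -(subrKA b) (le_trans (ler_normD _ _))// lerD.
Qed.

Section NonlinearTest.
Variables (E Q c phi : R * R -> R) (B K tau A sg : R).
Hypothesis tau0 : 0 < tau.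
Hypothesis A1 : 1 <= A.
Hypothesis K0 : 0 <= K.
Hypothesis mE : measurable_fun setT E.
Hypothesis mQ : measurable_fun setT Q.
Hypothesis bE : forall p, `|E p| <= B.
Hypothesis bQ : forall p, `|Q p| <= B.
Hypothesis dissipative : forall psi, test_function psi -> supp psi `<=` half_plane ->
  (forall p, 0 <= psi p) -> 0 <= II (fun p => E p * dt psi p + Q p * dx psi p).
Hypothesis Cc : forall k, Cn_plane k c.
Hypothesis Cphi : forall k, Cn_plane k phi.
Hypothesis c0 : forall p, 0 <= c p.

(** Where the derivatives of [potential_mn] are the mollifications of - N and U: times from [tau] on
    leave room for the mollification in t, and the margin 1 contains the mollification in x. *)
Definition cut_box (p : R * R) : bool := (tau <= p.1 <= A) && (`|p.2| + 1 <= A).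

Hypothesis c_out : forall p, ~~ cut_box p -> [/\ c p = 0, dt c p = 0 & dx c p = 0].
Hypothesis c_in : forall p, cut_box p ->
  [/\ `|c p| <= K, `|dt c p| <= K, `|dx c p| <= K, `|dt phi p| <= K & `|dx phi p| <= K].

(* E chi_t + Q chi_x for chi = c * flat 0 (sg * (phi - w)), with n standing for - w_t and
   u for w_x; the derivative of [flat 0] is [flat 2]. *)
Definition test_integrand (w n u : R * R -> R) (p : R * R) : R :=
  if cut_box p then
    let s := sg * (phi p - w p) in
    E p * (dt c p * flat 0 s + c p * (flat 2 s * (sg * (dt phi p + n p)))) +
    Q p * (dx c p * flat 0 s + c p * (flat 2 s * (sg * (dx phi p - u p))))
  else 0.

Let Kb := B * (K * 1 + K * (2 * (`|sg| * (K + L)))) + B * (K * 1 + K * (2 * (`|sg| * (K + M)))).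

Let measurable_cont Z : continuous Z -> measurable_fun setT Z.
Proof. exact: continuous_plane_measurable. Qed.

Let flat0_le1 (s : R) : `|flat 0 s| <= 1. Proof. exact: flat_bounded. Qed.
Let flat2_le2 (s : R) : `|flat 2 s| <= 2. Proof. exact: flat_bounded. Qed.

Lemma bounded_test_integrand (w n u : R * R -> R) : measurable_fun setT w ->
  measurable_fun setT n -> measurable_fun setT u ->
  (forall p, `|n p| <= L) -> (forall p, `|u p| <= M) ->
  bounded_on2 A Kb (test_integrand w n u).
Proof.
move=> mw mn mu' bn bu.
have [_ _ _ /Cn_plane_continuous/measurable_cont mct /Cn_plane_continuous/measurable_cont mcx] :=
  Cn_plane_elim (Cc 1).
have [_ _ _ /Cn_plane_continuous/measurable_cont mpt /Cn_plane_continuous/measurable_cont mpx] :=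
  Cn_plane_elim (Cphi 1).
have mc := measurable_cont (Cn_plane_continuous (Cc 0)).
have mp := measurable_cont (Cn_plane_continuous (Cphi 0)).
have ms : measurable_fun setT (fun p => sg * (phi p - w p)).
  by apply: measurable_funM => //; exact: measurable_funB.
have mf k : measurable_fun setT (fun p => flat k (sg * (phi p - w p))).
  by apply: measurableT_comp => //; apply: smooth_measurable; exact: smooth_flat.
split.
- apply: measurable_fun_ifT => //.
    apply: measurable_and.
      apply: measurable_and; apply: measurable_fun_ler => //; exact: measurable_fst.
    apply: measurable_fun_ler => //; apply: measurable_funD => //.
    by apply: measurableT_comp => //; exact: measurable_snd.
  have part (e ct x : R * R -> R) : measurable_fun setT e -> measurable_fun setT ct -> measurable_fun setT x ->
      measurable_fun setT (fun p => e p * (ct p * flat 0 (sg * (phi p - w p)) +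
        c p * (flat 2 (sg * (phi p - w p)) * (sg * x p)))).
    move=> me mct' mx; apply: (measurable_funM me); apply: measurable_funD.
      exact: (measurable_funM mct' (mf 0%N)).
    apply: (measurable_funM mc); apply: (measurable_funM (mf 2%N)).
    exact: (measurable_funM (measurable_cst _) mx).
  apply: measurable_funD.
    exact: (part _ _ _ mE mct (measurable_funD mpt mn)).
  exact: (part _ _ _ mQ mcx (measurable_funB mpx mu')).
- move=> p; rewrite /test_integrand; case: ifPn => pb; last first.
    have B0 : 0 <= B := le_trans (normr_ge0 _) (bE p).
    by rewrite normr0 /Kb !(addr_ge0, mulr_ge0).
  have [cK ctK cxK ptK pxK] := c_in pb; set s := sg * _.
  have h0 := flat0_le1 s; have h2 := flat2_le2 s.
  have h5 : `|dt phi p + n p| <= K + L by apply: le_trans (ler_normD _ _) _; exact: lerD.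
  have h6 : `|dx phi p - u p| <= K + M by apply: le_trans (ler_normB _ _) _; exact: lerD.
  have part (e ct f0 c' f2 x S : R) : `|e| <= B -> `|ct| <= K -> `|f0| <= 1 -> `|c'| <= K ->
      `|f2| <= 2 -> `|x| <= S ->
      `|e * (ct * f0 + c' * (f2 * (sg * x)))| <= B * (K * 1 + K * (2 * (`|sg| * S))).
    move=> he hct hf0 hc hf2 hx; rewrite normrM; apply: ler_pM => //.
    apply: le_trans (ler_normD _ _) _; apply: lerD; rewrite normrM; apply: ler_pM => //.
    by rewrite normrM; apply: ler_pM => //; rewrite normrM; exact: ler_wpM2l.
  apply: le_trans (ler_normD _ _) _; apply: lerD.
    exact: (part _ _ _ _ _ _ _ (bE p) ctK h0 cK h2 h5).
  exact: (part _ _ _ _ _ _ _ (bQ p) cxK h0 cK h2 h6).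
- move=> p pA; rewrite /test_integrand ifF//; apply/negbTE; rewrite /cut_box !negb_and -!ltNge.
  case: pA => [|pA]; last by apply/orP; right; rewrite (lt_trans pA)// ltrDl.
  rewrite lter_normr => /orP[h|h]; apply/orP; left; apply/orP; [right => //|left].
  by rewrite (lt_trans _ tau0)// -oppr_gt0 (lt_trans _ h)// (lt_le_trans ltr01).
Qed.

Lemma test_integrand_cvg (w_ n_ u_ : nat -> R * R -> R) (w n u : R * R -> R) p :
  (cut_box p -> w_ k p @[k --> \oo] --> w p) ->
  n_ k p @[k --> \oo] --> n p -> u_ k p @[k --> \oo] --> u p ->
  test_integrand (w_ k) (n_ k) (u_ k) p @[k --> \oo] --> test_integrand w n u p.
Proof.
rewrite /test_integrand; case: ifPn => pb hw hn hu; last exact: cvg_cst.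
have hs : sg * (phi p - w_ k p) @[k --> \oo] --> sg * (phi p - w p).
  by apply: cvgMr; apply: cvgB; [exact: cvg_cst|exact: hw].
have hf j : flat j (sg * (phi p - w_ k p)) @[k --> \oo] --> flat j (sg * (phi p - w p)).
  by apply: continuous_cvg => //; exact: (smooth_continuous (@smooth_flat R j)).
apply: cvgD; apply: cvgMr; apply: cvgD.
- by apply: cvgMr; exact: hf.
- apply: cvgMr; apply: cvgM; first exact: hf.
  by apply: cvgMr; apply: cvgD => //; exact: cvg_cst.
- by apply: cvgMr; exact: hf.
- apply: cvgMr; apply: cvgM; first exact: hf.
  by apply: cvgMr; apply: cvgB => //; exact: cvg_cst.
Qed.

Let moll m n Z := conv2 Z (bump_n m) (bump_n n).

Let cut_box_A p : cut_box p -> [/\ tau <= p.1, p.1 <= A & `|p.2| + 1 <= A].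
Proof. by rewrite /cut_box => /andP[/andP[]]. Qed.

(** With the smooth [potential_mn] in place of the potential, the chosen function is a genuine test
    function, and the chain rule turns the entropy inequality into this integral. *)
Lemma test_mn m n : m.+1%:R^-1 <= tau ->
  0 <= II (test_integrand (potential_mn A m n) (moll m n (cutoff2 A N)) (moll m n (cutoff2 A U))).
Proof.
move=> mtau; pose w := potential_mn A m n.
pose psi p := c p * flat 0 (sg * (phi p - w p)).
have Cw k : Cn_plane k w := Cn_plane_potential_mn k m n A1.
have Cs k : Cn_plane k (fun p => sg * (phi p - w p)).
  have := Cn_planeM (Cn_plane_cst k sg) (Cn_planeD (Cphi k) (Cn_planeM (Cn_plane_cst k (-1)) (Cw k))).
  rewrite (_ : (fun p => sg * (phi p - w p)) = fun p => sg * (phi p + -1 * w p))//.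
  by apply/funext => p; rewrite mulN1r.
have Cpsi k : Cn_plane k psi.
  by apply: Cn_planeM => //; apply: Cn_plane_comp => //; exact: smooth_flat.
have psi_out p : psi p != 0 -> tau <= p.1 <= A /\ - A <= p.2 <= A.
  move=> pp; have [pb|pb] := boolP (cut_box p); last first.
    by have [c1 _ _] := c_out pb; move: pp; rewrite /psi c1 mul0r eqxx.
  have [-> -> pA] := cut_box_A pb; split => //.
  by rewrite -ler_norml (le_trans _ pA)// lerDl.
have tpsi : test_function psi by split => //; exact: compact_supp_box psi_out.
have hpsi : supp psi `<=` half_plane.
  by move=> p /(supp_sub_box psi_out)[/andP[h _] _]; exact: lt_le_trans tau0 h.
have psi0 p : 0 <= psi p by rewrite mulr_ge0// flat_ge0.
have := dissipative tpsi hpsi psi0.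
congr (0 <= _); apply: eq_Rintegral => p _.
have [_ ct cx _ _] := Cn_plane_elim (Cc 1).
have [_ pt px _ _] := Cn_plane_elim (Cphi 1).
have [_ wt wx _ _] := Cn_plane_elim (Cw 1).
have dpsi (v : R * R) (d e g : R) : is_derive p v c d -> is_derive p v phi e -> is_derive p v w g ->
    is_derive p v psi (d * flat 0 (sg * (phi p - w p)) +
      c p * (flat 2 (sg * (phi p - w p)) * (sg * (e - g)))).
  move=> dc de dg.
  have d1 : is_derive p v (fun p => sg * (phi p - w p)) (sg * (e - g)).
    have D := @is_deriveZ _ _ _ _ sg _ _ _ (is_deriveB de dg).
    by apply: (is_derive_eq D).
  have d2 : is_derive (sg * (phi p - w p)) 1 (flat 0) (flat 2 (sg * (phi p - w p))).
    have D := is_derive_flat 0 (sg * (phi p - w p)).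
    by apply: (is_derive_eq D); rewrite oppr0 mul0r add0r.
  have d3 := @is_derive_comp1 _ _ (flat 0) (fun p => sg * (phi p - w p)) p v _ _ d2 d1.
  have D := is_deriveM dc d3.
  by apply: (is_derive_eq D); rewrite /GRing.scale/= addrC mulrC.
rewrite /test_integrand; case: ifPn => pb.
  have [tp pA xA] := cut_box_A pb.
  have wt' : is_derive p (1, 0) w (- moll m n (cutoff2 A N) p).
    exact: is_derive_potential_mn_t.
  have wx' : is_derive p (0, 1) w (moll m n (cutoff2 A U) p).
    by rewrite [p]surjective_pairing; apply: potential_mn_dx => //; exact: le_trans tp.
  rewrite (dtE (dpsi _ _ _ _ (ct p) (pt p) wt')) (dxE (dpsi _ _ _ _ (cx p) (px p) wx')).
  by rewrite opprK.
have [c1 c2 c3] := c_out pb.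
rewrite (dtE (dpsi _ _ _ _ (ct p) (pt p) (wt p))) (dxE (dpsi _ _ _ _ (cx p) (px p) (wx p))).
have F (e q a b d : R) : e * (0 * a + 0 * b) + q * (0 * a + 0 * d) = 0 by ring.
by rewrite c1 c2 c3; exact: F.
Qed.

(** The potential is only Lipschitz, so the inequality is reached in two limits: m removes the
    mollification in t at each fixed x, then n the one in x at each fixed t. The gradient enters
    linearly, and almost everywhere convergence with the common bound [Kb] suffices. *)
Lemma nonlinear_test : 0 <= II (test_integrand potential N U).
Proof.
have mNA : measurable_fun setT (cutoff2 A N) by case: (bN2 A).
have mUA : measurable_fun setT (cutoff2 A U) by case: (bU2 A).
have mconv m n C Z : bounded_on2 A C Z -> measurable_fun setT (moll m n Z).
  by move=> H; apply: measurable_cont; apply: continuous_conv2 H _ _; exact: smooth_bump_n.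
have bmn m n : bounded_on2 A Kb (test_integrand (potential_mn A m n)
    (moll m n (cutoff2 A N)) (moll m n (cutoff2 A U))).
  apply: bounded_test_integrand.
  - exact: measurable_cont (Cn_plane_continuous (Cn_plane_potential_mn 0 m n A1)).
  - exact: mconv (bN2 A).
  - exact: mconv (bU2 A).
  - by move=> p; exact: conv2_bump_bound (bN2 A).
  - by move=> p; exact: conv2_bump_bound (bU2 A).
have bn n : bounded_on2 A Kb (test_integrand (potential_n n)
    (moll_x n (cutoff2 A N)) (moll_x n (cutoff2 A U))).
  apply: bounded_test_integrand.
  - exact: measurable_cont (@continuous_potential_n n).
  - exact: measurable_moll_x.
  - exact: measurable_moll_x.
  - by move=> p; exact: moll_x_bound (bN2 A).
  - by move=> p; exact: moll_x_bound (bU2 A).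
have bl : bounded_on2 A Kb (test_integrand potential (cutoff2 A N) (cutoff2 A U)).
  apply: bounded_test_integrand => //.
  - exact: measurable_cont continuous_potential.
  - by case: (bN2 A).
  - by case: (bU2 A).
have step2 n : 0 <= II (test_integrand (potential_n n) (moll_x n (cutoff2 A N)) (moll_x n (cutoff2 A U))).
  have D : II (test_integrand (potential_mn A m n) (moll m n (cutoff2 A N)) (moll m n (cutoff2 A U)))
    @[m --> \oo] --> II (test_integrand (potential_n n) (moll_x n (cutoff2 A N)) (moll_x n (cutoff2 A U))).
    apply: (dominated2_t (fun m => bmn m n) (bn n)) => x.
    apply: (@filterS2 _ _ (ae_filter_ringOfSetsType mu) _ _ _ _
      (conv2_bump_cvg_t n x (bN2 A)) (conv2_bump_cvg_t n x (bU2 A))) => t hN hU.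
    apply: test_integrand_cvg => // pb.
    by have [_ tA xA] := cut_box_A pb; exact: potential_mn_cvg.
  rewrite -(cvg_lim _ D)//; apply: limr_ge; first exact: cvgP D.
  near=> m; apply: test_mn; apply: ltW; near: m.
  exact: (near_infty_natSinv_lt (PosNum tau0)).
have D : II (test_integrand (potential_n n) (moll_x n (cutoff2 A N)) (moll_x n (cutoff2 A U)))
    @[n --> \oo] --> II (test_integrand potential (cutoff2 A N) (cutoff2 A U)).
  apply: (dominated2_x bn bl) => t.
  apply: (@filterS2 _ _ (ae_filter_ringOfSetsType mu) _ _ _ _
    (moll_x_cvg t (bN2 A)) (moll_x_cvg t (bU2 A))) => x hN hU.
  by apply: test_integrand_cvg => // _; exact: potential_n_cvg.
have -> : II (test_integrand potential N U) = II (test_integrand potential (cutoff2 A N) (cutoff2 A U)).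
  apply: eq_Rintegral => p _; rewrite /test_integrand; case: ifPn => // pb.
  have [tp pA xA] := cut_box_A pb.
  have -> : cutoff2 A N p = N p.
    rewrite /cutoff2 gtr0_norm ?(lt_le_trans tau0)// pA (le_trans _ xA) ?mulr1//.
    by rewrite lerDl.
  have -> : cutoff2 A U p = U p.
    rewrite /cutoff2 gtr0_norm ?(lt_le_trans tau0)// pA (le_trans _ xA) ?mulr1//.
    by rewrite lerDl.
  by [].
by rewrite -(cvg_lim _ D)//; apply: limr_ge; [exact: cvgP D|exact: nearW].
Unshelve. all: by end_near. Qed.

End NonlinearTest.


Definition rect_ind (t1 t2 x1 x2 : R) (p : R * R) : R :=
  (t1 <= p.1 <= t2)%R%:R * (x1 <= p.2 <= x2)%R%:R.

Lemma measurable_itv_ind (a b : R) : measurable_fun setT (fun y : R => (a <= y <= b)%R%:R : R).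
Proof.
rewrite (_ : (fun _ => _) = \1_(`[a, b]%classic)); first exact: measurable_indic.
by apply/funext => y; rewrite indicE mem_setE in_itv.
Qed.

Lemma measurable_rect_ind t1 t2 x1 x2 : measurable_fun setT (rect_ind t1 t2 x1 x2).
Proof.
apply: measurable_funM.
  by apply: (measurableT_comp (measurable_itv_ind t1 t2)); exact: measurable_fst.
by apply: (measurableT_comp (measurable_itv_ind x1 x2)); exact: measurable_snd.
Qed.

Lemma rect_ind_le1 t1 t2 x1 x2 p : `|rect_ind t1 t2 x1 x2 p| <= 1.
Proof.
by rewrite /rect_ind normrM mulr_ile1//; case: (_ && _); rewrite ?normr1// normr0.
Qed.

Lemma Rintegral_itv_ind (f : R -> R) (a b : R) :
  I (fun y => f y * (a <= y <= b)%R%:R) = Rintegral mu `[a, b] f.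
Proof.
rewrite [RHS]Rintegral_mkcond; apply: eq_Rintegral => y _.
rewrite patchE mem_setE in_itv/=.
by case: (a <= y <= b); rewrite ?mulr1// mulr0.
Qed.

Lemma potential_mn_rect A m n t x1 x2 : m.+1%:R^-1 <= t -> t <= A ->
  x1 < x2 -> `|x1| + `|x2| + 1 <= A ->
  I (fun x => conv2 (cutoff2 A U) (bump_n m) (bump_n n) (t, x) * (x1 <= x <= x2)%R%:R) =
  potential_mn A m n (t, x2) - potential_mn A m n (t, x1).
Proof.
move=> mt tA x12 xA; have A1 : 1 <= A by apply: le_trans xA; rewrite lerDr addr_ge0.
have [C H] := bounded_initial_lift A1.
have sb : smooth (derive1 (@bump_n R n)) by have [] := smoothP (@smooth_bump_n R n).
pose f x := conv2 (initial_lift A) (fun=> 1) (bump_n n) (t, x) -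
  conv2 (cutoff2 A N) (step_n m) (derive1 (bump_n n)) (t, x).
have df x : is_derive x 1 (fun x : R => potential_mn A m n (t, x)) (f x).
  apply: is_derive_section_x; rewrite /f conv2_initial_lift//; last exact: smooth_bump_n.
  exact: is_derive_potential_mn_x.
have cf : continuous f.
  move=> x; apply: cvgB; apply: (@continuous_section _ t).
    by apply: continuous_conv2 H _ _ => //; exact: smooth_bump_n.
  by apply: continuous_conv2 (bN2 A) _ _ => //; exact: smooth_step_n.
rewrite -(Rintegral_derive x12 df cf) -Rintegral_itv_ind.
apply: eq_Rintegral => x _; have [/andP[h1 h2]|_] := boolP (x1 <= x <= x2); last by rewrite !mulr0.
rewrite !mulr1 /f conv2_initial_lift//; last exact: smooth_bump_n.
have xA' : `|x| + 1 <= A.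
  apply: le_trans xA; rewrite lerD2r.
  move: h1 h2; rewrite le_eqVlt => /predU1P[->|h1]; first by rewrite lerDl.
  rewrite le_eqVlt => /predU1P[->|h2]; first by rewrite lerDr.
  exact: norm_between h1 h2.
have := weak_mollified m n tA xA'; rewrite step_n1// mul1r => <-.
by rewrite addrK.
Qed.

(** The relation w_x = U integrated over rectangles. It avoids any pointwise derivative of w and is
    the form from which U is recovered. *)
Lemma rect_identity t1 t2 x1 x2 : 0 < t1 -> t1 < t2 -> x1 < x2 ->
  II (fun p => U p * rect_ind t1 t2 x1 x2 p) =
  I (fun t => (potential (t, x2) - potential (t, x1)) * (t1 <= t <= t2)%R%:R).
Proof.
move=> t10 t12 x12; pose A := t2 + (`|x1| + `|x2| + 1).
have t2A : t2 <= A by rewrite lerDl !addr_ge0.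
have xA : `|x1| + `|x2| + 1 <= A by rewrite lerDr ltW// (lt_trans t10).
have x1A : `|x1| + 1 <= A by apply: le_trans xA; rewrite lerD2r lerDl.
have x2A : `|x2| + 1 <= A by apply: le_trans xA; rewrite lerD2r lerDr.
pose r := rect_ind t1 t2 x1 x2.
pose Umn m n := conv2 (cutoff2 A U) (bump_n m) (bump_n n).
have r0 p : A < `|p.1| \/ A < `|p.2| -> r p = 0.
  rewrite /r /rect_ind => -[h|h].
    case: (boolP (t1 <= p.1 <= t2)) => [/andP[h1 h2]|]; last by rewrite mul0r.
    move: h; rewrite ger0_norm ?(le_trans (ltW t10))// => h.
    by have := lt_le_trans h (le_trans h2 t2A); rewrite ltxx.
  case: (boolP (x1 <= p.2 <= x2)) => [/andP[h1 h2]|]; last by rewrite mulr0.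
  have : `|p.2| <= A.
    apply: le_trans xA; rewrite -[leLHS]addr0 lerD//.
    move: h1 h2; rewrite le_eqVlt => /predU1P[->|h1]; first by rewrite lerDl.
    rewrite le_eqVlt => /predU1P[->|h2]; first by rewrite lerDr.
    exact: norm_between h1 h2.
  by rewrite leNgt h.
have br (Z : R * R -> R) : measurable_fun setT Z -> (forall p, `|Z p| <= M) ->
    bounded_on2 A (M * 1) (fun p => Z p * r p).
  move=> mZ bZ; split; first by apply: measurable_funM => //; exact: measurable_rect_ind.
    by move=> p; rewrite normrM ler_pM//; exact: rect_ind_le1.
  by move=> p /r0 ->; rewrite mulr0.
have mUmn m n : measurable_fun setT (Umn m n).
  by apply: continuous_plane_measurable; apply: continuous_conv2 (bU2 A) _ _; exact: smooth_bump_n.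
have mUA : measurable_fun setT (cutoff2 A U) by case: (bU2 A).
have bmn m n := br _ (mUmn m n) (fun p => conv2_bump_bound m n p (bU2 A)).
have bn n := br _ (measurable_moll_x n mUA) (fun p => moll_x_bound n p (bU2 A)).
have bl := br _ mUA (let: And3 _ h _ := bU2 A in h).
have mt (w : R * R -> R) : continuous w -> measurable_fun setT
    (fun t => (w (t, x2) - w (t, x1)) * (t1 <= t <= t2)%R%:R).
  move=> cw; apply: measurable_funM; last exact: measurable_itv_ind.
  have mw := continuous_plane_measurable cw.
  by apply: measurable_funB; apply: (measurableT_comp mw); exact: measurable_pair2.
have step1 n : II (fun p => moll_x n (cutoff2 A U) p * r p) =
   I (fun t => (potential_n n (t, x2) - potential_n n (t, x1)) * (t1 <= t <= t2)%R%:R).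
  have D : II (fun p => Umn m n p * r p) @[m --> \oo] --> II (fun p => moll_x n (cutoff2 A U) p * r p).
    apply: (dominated2_t (fun m => bmn m n) (bn n)) => x.
    have := conv2_bump_cvg_t n x (bU2 A); apply: filterS; first exact: (ae_filter_ringOfSetsType mu).
    by move=> t h; apply: cvgMl.
  (* A second limit of the same sequence, obtained section by section from the increments of
     [potential_mn]; uniqueness of limits gives the identity. *)
  have D2 : II (fun p => Umn m n p * r p) @[m --> \oo] -->
     I (fun t => (potential_n n (t, x2) - potential_n n (t, x1)) * (t1 <= t <= t2)%R%:R).
    rewrite (_ : (fun m => II _) = (fun m => I (fun t => I (fun x => Umn m n (t, x) * r (t, x))))); last first.
      by apply/funext => m; exact: fubini12 (bmn m n).
    apply: (dominated1 (fun m => bounded_on1_Rintegral1 (bmn m n))).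
      exact: mt (@continuous_potential_n n).
    apply: aeW => t; have [/andP[h1 h2]|h] := boolP (t1 <= t <= t2); last first.
      rewrite mulr0 (_ : (fun m => I _) = fun=> 0); first exact: cvg_cst.
      apply/funext => m; rewrite (@eq_Rintegral _ _ _ _ _ (cst 0)) ?Rintegral_cst ?mul0r// => x _.
      by rewrite /r /rect_ind/= (negbTE h) mul0r mulr0.
    rewrite mulr1.
    have t0 : 0 < t := lt_le_trans t10 h1.
    have tA : t <= A := le_trans h2 t2A.
    have c : potential_mn A m n (t, x2) - potential_mn A m n (t, x1) @[m --> \oo] -->
        potential_n n (t, x2) - potential_n n (t, x1).
      by apply: cvgB; exact: potential_mn_cvg.
    apply: cvg_trans c; apply: near_eq_cvg; near=> m.
    rewrite -potential_mn_rect//; last first.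
      by apply: ltW; near: m; exact: (near_infty_natSinv_lt (PosNum t0)).
    by apply: eq_Rintegral => x _; rewrite /r /rect_ind/= h1 h2 mul1r.
  exact: (cvg_unique _ D D2).
have D : II (fun p => moll_x n (cutoff2 A U) p * r p) @[n --> \oo] --> II (fun p => cutoff2 A U p * r p).
  apply: (dominated2_x bn bl) => t.
  have := moll_x_cvg t (bU2 A); apply: filterS; first exact: (ae_filter_ringOfSetsType mu).
  by move=> x h; apply: cvgMl.
have D2 : II (fun p => moll_x n (cutoff2 A U) p * r p) @[n --> \oo] -->
    I (fun t => (potential (t, x2) - potential (t, x1)) * (t1 <= t <= t2)%R%:R).
  rewrite (_ : (fun n => II _) = (fun n => I (fun t => (potential_n n (t, x2) - potential_n n (t, x1)) *
     (t1 <= t <= t2)%R%:R))); last by apply/funext => n; exact: step1.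
  apply: (@dominated1 _ A (M * `|x2 - x1| * 1)).
  - move=> n; split; first exact: mt (@continuous_potential_n n).
      move=> t; rewrite normrM ler_pM//; first exact: potential_n_lipschitz.
      by case: (_ && _); rewrite ?normr1// normr0.
    move=> t tA; case: (boolP (t1 <= t <= t2)) => [/andP[h1 h2]|]; last by rewrite mulr0.
    move: tA; rewrite ger0_norm ?(le_trans (ltW t10))// => h.
    by have := lt_le_trans h (le_trans h2 t2A); rewrite ltxx.
  - exact: mt continuous_potential.
  - apply: aeW => t; apply: cvgMl; apply: cvgB; exact: potential_n_cvg.
rewrite -(cvg_unique _ D D2)//.
apply: eq_Rintegral => p _; have [pA|] := boolP ((`|p.1| <= A) && (`|p.2| <= A)).
  by rewrite /cutoff2 pA mulr1.
by rewrite negb_and -!ltNge => /orP/r0 E; rewrite -/r E !mulr0.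
Unshelve. all: by end_near. Qed.

End Potential.

(** * Contact of the potential with a paraboloid *)

Section Touching.
Context {R : realType}.

Local Notation mu := (@lebesgue_measure R).
Local Notation mm := (@lebesgue_measure R \x @lebesgue_measure R)%E.
Local Notation I g := (Rintegral (@lebesgue_measure R) setT g).
Local Notation II Z := (Rintegral mm setT Z).

(** Equal to 1 within distance r of z0 and to 0 beyond distance 2 r. The arguments are written as
    affine functions of z so that [smooth_upto_affine] applies. *)
Definition plateau (z0 r z : R) : R :=
  step (r^-1 * z + (2 - z0 / r)) * step (- r^-1 * z + (2 + z0 / r)).

Lemma smooth_plateau z0 r : smooth (plateau z0 r).
Proof. by move=> k; apply: smooth_uptoM; apply: smooth_upto_affine; exact: smooth_step. Qed.

Lemma plateau_ge0 z0 r z : 0 <= plateau z0 r z.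
Proof. by rewrite mulr_ge0// step_ge0. Qed.

Lemma plateauE z0 r z : 0 < r ->
  plateau z0 r z = step (2 + (z - z0) / r) * step (2 - (z - z0) / r).
Proof.
move=> r0; rewrite /plateau; congr (step _ * step _).
  by field; rewrite gt_eqF.
by field; rewrite gt_eqF.
Qed.

Lemma plateau1 z0 r z : 0 < r -> `|z - z0| <= r -> plateau z0 r z = 1.
Proof.
move=> r0 zr; rewrite plateauE//.
have : `|(z - z0) / r| <= 1 by rewrite normrM normfV (gtr0_norm r0) ler_pdivrMr// mul1r.
rewrite ler_norml; move: (_ / r) => u /andP[h1 h2].
by rewrite !step1 ?mulr1//; lra.
Qed.

Lemma plateau0 z0 r z : 0 < r -> z < z0 - 2 * r \/ z0 + 2 * r < z -> plateau z0 r z = 0.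
Proof.
move=> r0 [h|h]; rewrite plateauE//.
  have : (z - z0) / r <= - 2 by rewrite ler_pdivrMr//; lra.
  by move: (_ / r) => u hu; rewrite step0 ?mul0r//; lra.
have : 2 <= (z - z0) / r by rewrite ler_pdivlMr//; lra.
by move: (_ / r) => u hu; rewrite [step (2 - _)]step0 ?mulr0//; lra.
Qed.

Lemma derive_plateau_in z0 r z : 0 < r -> `|z - z0| < r -> derive1 (plateau z0 r) z = 0.
Proof.
move=> r0 zr; have D : is_derive z 1 (plateau z0 r) 0.
  have rz : 0 < r - `|z - z0| by rewrite subr_gt0.
  apply: (@is_derive_quadratic _ _ _ _ _ _ 0 (r - `|z - z0|)) => // h hr.
  have E : h *: (1 : R) + z = h + z by rewrite /GRing.scale/= mulr1.
  have hz : `|h + z - z0| < r.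
    by rewrite -addrA; apply: le_lt_trans (ler_normD _ _) _; rewrite -ltrBrDr.
  by rewrite E (plateau1 r0 (ltW hz)) (plateau1 r0 (ltW zr)) mulr0 subr0 subrr normr0 mul0r.
by rewrite derive1E (@derive_val _ _ _ _ _ _ _ D).
Qed.

Lemma derive_plateau_out z0 r z : 0 < r -> z < z0 - 2 * r \/ z0 + 2 * r < z ->
  derive1 (plateau z0 r) z = 0.
Proof.
move=> r0; apply: derive1_eq0_outside => y; exact: plateau0.
Qed.

Definition quadratic (k a b e t0 x0 : R) (p : R * R) : R :=
  k + b * (p.1 - t0) + a * (p.2 - x0) + e * ((p.1 - t0) ^+ 2 + (p.2 - x0) ^+ 2).

Lemma Cn_plane_quadratic n k a b e t0 x0 : Cn_plane n (quadratic k a b e t0 x0).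
Proof.
have c1 : Cn_plane n (fun p : R * R => p.1 - t0).
  by apply: Cn_planeD; [exact: Cn_plane_fst|exact: Cn_plane_cst].
have c2 : Cn_plane n (fun p : R * R => p.2 - x0).
  by apply: Cn_planeD; [exact: Cn_plane_snd|exact: Cn_plane_cst].
apply: Cn_planeD; last first.
  by apply: Cn_planeM; [exact: Cn_plane_cst|apply: Cn_planeD; exact: Cn_planeM].
apply: Cn_planeD; last by apply: Cn_planeM => //; exact: Cn_plane_cst.
apply: Cn_planeD; first exact: Cn_plane_cst.
by apply: Cn_planeM => //; exact: Cn_plane_cst.
Qed.

Lemma dt_quadratic k a b e t0 x0 p : dt (quadratic k a b e t0 x0) p = b + 2 * e * (p.1 - t0).
Proof.
apply: dtE; apply: (@is_derive_quadratic _ _ _ _ _ _ `|e| 1) => // h _.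
rewrite (_ : _ - _ = e * h ^+ 2); first by rewrite normrM (ger0_norm (sqr_ge0 _)).
by rewrite /quadratic /= /GRing.scale/= mulr1 mulr0 add0r; ring.
Qed.

Lemma dx_quadratic k a b e t0 x0 p : dx (quadratic k a b e t0 x0) p = a + 2 * e * (p.2 - x0).
Proof.
apply: dxE; apply: (@is_derive_quadratic _ _ _ _ _ _ `|e| 1) => // h _.
rewrite (_ : _ - _ = e * h ^+ 2); first by rewrite normrM (ger0_norm (sqr_ge0 _)).
by rewrite /quadratic /= /GRing.scale/= mulr1 mulr0 add0r; ring.
Qed.

Lemma fine_mu_itv (a b : R) : a < b -> fine (mu `[a, b]%classic) = b - a.
Proof. by move=> ab; rewrite lebesgue_measure_itv/= lte_fin ab. Qed.

Lemma Rintegral_itv_cst (a b : R) : a < b -> I (fun y => (a <= y <= b)%R%:R) = b - a.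
Proof.
move=> ab; transitivity (I (fun y => 1 * (a <= y <= b)%R%:R)).
  by apply: eq_Rintegral => y _; rewrite mul1r.
by rewrite Rintegral_itv_ind Rintegral_cst// mul1r fine_mu_itv.
Qed.

Lemma bounded_itv_ind (a b : R) :
  bounded_on1 (`|a| + `|b|) 1 (fun y => (a <= y <= b)%R%:R).
Proof.
split; first exact: measurable_itv_ind.
  by move=> y; case: (_ && _); rewrite ?normr1// normr0.
move=> y; case: (boolP (a <= y <= b)) => // /andP[h1 h2]; rewrite ltNge => /negP[].
have := ler_norm (- a); have := ler_norm b; have := normr_ge0 a; have := normr_ge0 b.
by rewrite normrN ler_norml; lra.
Qed.

Lemma bounded_rect_ind (t1 t2 x1 x2 : R) : exists A, bounded_on2 A 1 (rect_ind t1 t2 x1 x2).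
Proof.
exists (`|t1| + `|t2| + (`|x1| + `|x2|)); split.
- exact: measurable_rect_ind.
- by move=> p; exact: rect_ind_le1.
- move=> p [h|h]; rewrite /rect_ind.
    have [_ _ ->] := bounded_itv_ind t1 t2; first by rewrite mul0r.
    by apply: le_lt_trans h; rewrite lerDl addr_ge0.
  have [_ _ ind0] := bounded_itv_ind x1 x2; rewrite (ind0 p.2) ?mulr0//.
  by apply: le_lt_trans h; rewrite lerDr addr_ge0.
Qed.

Lemma Rintegral_rect_ind (t1 t2 x1 x2 : R) : t1 < t2 -> x1 < x2 ->
  II (rect_ind t1 t2 x1 x2) = (t2 - t1) * (x2 - x1).
Proof.
move=> t12 x12; have [A H] := bounded_rect_ind t1 t2 x1 x2.
rewrite (fubini12 H).
transitivity (I (fun t => (x2 - x1) * (t1 <= t <= t2)%R%:R)).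
  apply: eq_Rintegral => t _; rewrite /rect_ind/=; case: (t1 <= t <= t2); last first.
    rewrite mulr0 (@eq_Rintegral _ _ _ _ _ (cst 0)) ?Rintegral_cst ?mul0r// => x _.
    by rewrite mul0r.
  rewrite mulr1 -(Rintegral_itv_cst x12); apply: eq_Rintegral => x _; exact: mul1r.
by rewrite Rintegral_itv_ind Rintegral_cst// fine_mu_itv// mulrC.
Qed.

Lemma le_sum5 (a b c d e : R) : 0 <= a -> 0 <= b -> 0 <= c -> 0 <= d -> 0 <= e ->
  [/\ a <= a + b + c + d + e, b <= a + b + c + d + e, c <= a + b + c + d + e,
      d <= a + b + c + d + e & e <= a + b + c + d + e].
Proof. by move=> *; split; lra. Qed.

Lemma margin (x y z c : R) : x <= - c -> 16 * z <= c -> - (2 * z) <= y ->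
  x - 4 * y <= - (c / 2).
Proof. by move=> *; lra. Qed.

Lemma half_le_of_dist (a v : R) : `|a - v| <= v / 2 -> v / 2 <= a.
Proof. by rewrite ler_norml => /andP[h _]; lra. Qed.

Lemma ltr_ball (x d : R) : 0 < d -> x - d < x + d.
Proof. by move=> d0; lra. Qed.

Lemma cut_box_near (t0 x0 rho d : R) p : 0 <= t0 -> d <= rho -> d <= 1 ->
  `|p.1 - t0| <= d -> `|p.2 - x0| <= d -> cut_box (t0 - 2 * rho) (t0 + `|x0| + 2 * rho + 1) p.
Proof.
move=> t00 dr d1; rewrite ler_distl => /andP[h1 h2] h3.
have h4 := ler_normD x0 (p.2 - x0); rewrite subrKC in h4.
have h5 := normr_ge0 x0; have h6 := le_trans (normr_ge0 _) h3.
by rewrite /cut_box; apply/andP; split; [apply/andP; split; lra|lra].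
Qed.

Lemma cut_box_out (t0 x0 rho : R) p : 0 <= rho ->
  ~~ cut_box (t0 - 2 * rho) (t0 + `|x0| + 2 * rho + 1) p -> 0 <= t0 ->
  (p.1 < t0 - 2 * rho \/ t0 + 2 * rho < p.1) \/ (p.2 < x0 - 2 * rho \/ x0 + 2 * rho < p.2).
Proof.
move=> r0; have x00 := normr_ge0 x0.
rewrite /cut_box !negb_and -!ltNge => /orP[/orP[h|h]|h] t00.
- by left; left.
- by left; right; lra.
- right; have := ler_norm x0; have := ler_norm (- x0); rewrite normrN => h1 h2.
  have : `|x0| + 2 * rho < `|p.2| by lra.
  by rewrite lter_normr => /orP[h'|h']; [right|left]; lra.
Qed.

Lemma cut_box_dist (t0 x0 rho : R) p : 0 < rho -> 2 * rho <= t0 ->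
  cut_box (t0 - 2 * rho) (t0 + `|x0| + 2 * rho + 1) p ->
  `|p.1 - t0| <= t0 + `|x0| + 2 * rho + 1 /\ `|p.2 - x0| <= 2 * (t0 + `|x0| + 2 * rho + 1).
Proof.
rewrite /cut_box => r0 rt /andP[/andP[h1 h2] h3]; have x00 := normr_ge0 x0; split.
  by rewrite ler_norml; lra.
by apply: le_trans (ler_normB _ _) _; lra.
Qed.

Lemma square_sum_lt (x y r : R) : 0 < r -> x ^+ 2 + y ^+ 2 < r ^+ 2 -> `|x| < r /\ `|y| < r.
Proof.
move=> r0 h; have q1 := sqr_ge0 x; have q2 := sqr_ge0 y.
by split; rewrite -(@ltr_pXn2r _ 2)// ?nnegrE ?(ltW r0)// real_normK ?num_real//; lra.
Qed.

Variables (U N : R * R -> R) (u0 : R -> R) (M L : R).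
Hypothesis mU : measurable_fun setT U.
Hypothesis mN : measurable_fun setT N.
Hypothesis mu0 : measurable_fun setT u0.
Hypothesis bU : forall p, `|U p| <= M.
Hypothesis bN : forall p, `|N p| <= L.
Hypothesis bu0 : forall x, `|u0 x| <= M.
Hypothesis U_neg : forall p, p.1 <= 0 -> U p = 0.
Hypothesis N_neg : forall p, p.1 <= 0 -> N p = 0.
Hypothesis weakU : forall phi, test_function phi ->
  II (fun p => U p * dt phi p + N p * dx phi p) + I (fun x => u0 x * phi (0, x)) = 0.

Let w := potential N u0.

Variables (E Q : R * R -> R) (B C sg c0 tstar : R).
Hypothesis mE : measurable_fun setT E.
Hypothesis mQ : measurable_fun setT Q.
Hypothesis bE : forall p, `|E p| <= B.
Hypothesis bQ : forall p, `|Q p| <= B.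
Hypothesis dissipative : forall psi, test_function psi -> supp psi `<=` half_plane ->
  (forall p, 0 <= psi p) -> 0 <= II (fun p => E p * dt psi p + Q p * dx psi p).
Hypothesis sg2 : sg * sg = 1.
Hypothesis C0 : 0 < C.
Hypothesis c00 : 0 < c0.

(* The test function is [flat 0] of the amount by which the touching paraboloid, lowered
   by gamma, exceeds the potential; where it is positive, the integrand of the entropy
   inequality is at most [- c0 / 2] times [flat 2]. *)
Lemma no_touching (t0 x0 a b gamma rho : R) : tstar <= t0 -> 0 < gamma ->
  0 < rho -> 2 * gamma < C * rho ^+ 2 -> 4 * rho <= tstar -> 16 * B * C * rho <= c0 ->
  (forall p, 0 < p.1 -> sg * ((b + N p) * E p + (a - U p) * Q p) <= - c0) ->
  (forall t x, 0 <= t -> - C * ((t - t0) ^+ 2 + (x - x0) ^+ 2) - gamma <=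
     sg * (w (t, x) - w (t0, x0) - b * (t - t0) - a * (x - x0))) -> False.
Proof.
move=> tt0 g0 r0 gr rt rB field touch.
(* The curvature 2 C exceeds the C of the contact condition. Where s is positive, C times the
   squared distance to the contact point is below 2 gamma, which confines that set to distance rho;
   at the contact point s equals gamma. *)
pose phi := quadratic (w (t0, x0) + sg * gamma) a b (- sg * (2 * C)) t0 x0.
pose s p := sg * (phi p - w p).
pose al := plateau t0 rho; pose be := plateau x0 rho.
pose c p := al p.1 * be p.2.
pose tau := t0 - 2 * rho; pose A := t0 + `|x0| + 2 * rho + 1.
have t00 : 0 < t0 by lra.
have rt2 : 2 * rho <= t0 by lra.
have tau0 : 0 < tau by rewrite /tau; lra.
have x00 := normr_ge0 x0.
have A1 : 1 <= A by rewrite /A; lra.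
have sE p : s p = sg * (w (t0, x0) + b * (p.1 - t0) + a * (p.2 - x0) - w p) + gamma
    - 2 * C * ((p.1 - t0) ^+ 2 + (p.2 - x0) ^+ 2).
  rewrite /s /phi /quadratic.
  transitivity (sg * (w (t0, x0) + b * (p.1 - t0) + a * (p.2 - x0) - w p) + (sg * sg) * gamma
    - (sg * sg) * (2 * C * ((p.1 - t0) ^+ 2 + (p.2 - x0) ^+ 2))).
    by move: (w p) (w (t0, x0)) => u v; ring.
  by rewrite sg2 !mul1r.
have s_pos p : 0 <= p.1 -> 0 < s p -> `|p.1 - t0| < rho /\ `|p.2 - x0| < rho.
  move=> p0; rewrite sE; have := touch p.1 p.2 p0; rewrite -surjective_pairing.
  move: (w p) (w (t0, x0)) => u v h1 h2.
  have h3 : C * ((p.1 - t0) ^+ 2 + (p.2 - x0) ^+ 2) < C * rho ^+ 2 by lra.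
  by move: h3; rewrite ltr_pM2l//; exact: square_sum_lt.
have Cphi k : Cn_plane k phi by exact: Cn_plane_quadratic.
have sal : smooth al by exact: smooth_plateau.
have sbe : smooth be by exact: smooth_plateau.
have [[Ka aK] sal' dal] := smoothP sal; have [[Kb bK] sbe' dbe] := smoothP sbe.
have [[Ka' aK'] _ _] := smoothP sal'; have [[Kb' bK'] _ _] := smoothP sbe'.
have Cc k : Cn_plane k c by exact: Cn_plane_tensor.
have dtc p : dt c p = derive1 al p.1 * be p.2 by apply: dtE; have [] := is_derive_tensor p dal dbe.
have dxc p : dx c p = al p.1 * derive1 be p.2 by apply: dxE; have [] := is_derive_tensor p dal dbe.
have cge0 p : 0 <= c p by rewrite mulr_ge0// plateau_ge0.
have c_out p : ~~ cut_box tau A p -> [/\ c p = 0, dt c p = 0 & dx c p = 0].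
  move=> /(cut_box_out (ltW r0))/(_ (ltW t00))[h|h]; rewrite dtc dxc /c.
    by rewrite /al (plateau0 r0 h) (derive_plateau_out r0 h) !mul0r.
  by rewrite /be (plateau0 r0 h) (derive_plateau_out r0 h) !mulr0.
pose K := Ka * Kb + Ka' * Kb + Ka * Kb' + (`|b| + 4 * C * A) + (`|a| + 4 * C * (2 * A)).
have [a0 b0] : 0 <= Ka /\ 0 <= Kb.
  by split; [exact: le_trans (normr_ge0 _) (aK 0)|exact: le_trans (normr_ge0 _) (bK 0)].
have [a0' b0'] : 0 <= Ka' /\ 0 <= Kb'.
  by split; [exact: le_trans (normr_ge0 _) (aK' 0)|exact: le_trans (normr_ge0 _) (bK' 0)].
have [k1 k2 k3] : [/\ 0 <= Ka * Kb, 0 <= Ka' * Kb & 0 <= Ka * Kb'] by rewrite !mulr_ge0.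
have C40 : 0 <= 4 * C by rewrite mulr_ge0// ltW.
have A0 : 0 <= A := le_trans ler01 A1.
have k4 : 0 <= `|b| + 4 * C * A by rewrite addr_ge0// mulr_ge0.
have k5 : 0 <= `|a| + 4 * C * (2 * A) by rewrite addr_ge0// mulr_ge0// mulr_ge0.
have [l1 l2 l3 l4 l5] := le_sum5 k1 k2 k3 k4 k5; rewrite -/K in l1 l2 l3 l4 l5.
have K0 : 0 <= K := le_trans k1 l1.
have sg1 : `|sg| = 1.
  by apply/eqP; rewrite -(@eqrXn2 _ 2)// expr1n real_normK ?num_real// expr2 sg2.
have grad (d e : R) r : 0 <= e -> `|r| <= e -> `|d + 2 * (- sg * (2 * C)) * r| <= `|d| + 4 * C * e.
  move=> e0 re; apply: le_trans (ler_normD _ _) _; rewrite lerD2l.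
  rewrite (_ : 2 * (- sg * (2 * C)) * r = - (sg * (4 * C * r))); last by ring.
  by rewrite normrN normrM sg1 mul1r normrM (ger0_norm C40) ler_wpM2l.
have c_in p : cut_box tau A p ->
  [/\ `|c p| <= K, `|dt c p| <= K, `|dx c p| <= K, `|dt phi p| <= K & `|dx phi p| <= K].
  move=> /(cut_box_dist r0 rt2)[p1 p2]; split.
  - by apply: le_trans l1; rewrite normrM ler_pM.
  - by rewrite dtc; apply: le_trans l2; rewrite normrM ler_pM.
  - by rewrite dxc; apply: le_trans l3; rewrite normrM ler_pM.
  - by rewrite /phi dt_quadratic; apply: le_trans (grad b A _ _ _) l4.
  - by rewrite /phi dx_quadratic; apply: le_trans (grad a (2 * A) _ _ _) l5; rewrite // mulr_ge0.
have test := nonlinear_test mU mN mu0 bU bN bu0 U_neg N_neg weakU sg tau0 A1 K0 mE mQ bE bQ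
  dissipative Cc Cphi cge0 c_out c_in.
pose G := test_integrand E Q c phi tau A sg w N U.
have B0 : 0 <= B := le_trans (normr_ge0 _) (bE 0).
have cw : continuous w := continuous_potential mU mN mu0 bU bN bu0 U_neg N_neg weakU.
have bG := bounded_test_integrand bN bu0 sg tau0 A1 K0 mE mQ bE bQ Cc Cphi c_in
  (continuous_plane_measurable cw) mN mU bN bU.
(* Where s > 0 both plateaus are constantly 1, so only the terms in [flat 2] survive. They consist
   of the assumed field, at most - c0, and of the variation of the gradient of the paraboloid, at
   most 8 B C rho <= c0 / 2. *)
have Gle p : G p <= - (c0 / 2) * flat 2 (s p) * (cut_box tau A p)%:R.
  rewrite /G /test_integrand; case: ifPn => pb; last by rewrite mulr0.
  rewrite mulr1 -/(s p); have [s0|s0] := leP (s p) 0.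
    have F1 (e q z1 z2 z3 z4 z5 z6 : R) :
      e * (z1 * 0 + z2 * (0 * z3)) + q * (z4 * 0 + z5 * (0 * z6)) = 0 by ring.
    by rewrite (flat_eq0 0 s0) (flat_eq0 2 s0) F1 mulr0.
  have p0 : 0 < p.1 by move: pb => /andP[/andP[h _] _]; exact: lt_le_trans h.
  have [h1 h2] := s_pos p (ltW p0) s0.
  have -> : dt c p = 0 by rewrite dtc /al (derive_plateau_in r0 h1) mul0r.
  have -> : dx c p = 0 by rewrite dxc /be (derive_plateau_in r0 h2) mulr0.
  have -> : c p = 1 by rewrite /c /al /be !plateau1 ?mulr1 ?ltW.
  rewrite !mul0r !add0r !mul1r /phi dt_quadratic dx_quadratic.
  have f2 := ltW (flat_gt0 2 s0).
  have F := field p p0.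
  have hE : - (B * rho) <= E p * (p.1 - t0).
    have : `|E p * (p.1 - t0)| <= B * rho by rewrite normrM ler_pM// ltW.
    by rewrite ler_norml => /andP[].
  have hQ : - (B * rho) <= Q p * (p.2 - x0).
    have : `|Q p * (p.2 - x0)| <= B * rho by rewrite normrM ler_pM// ltW.
    by rewrite ler_norml => /andP[].
  move: (flat 2 (s p)) f2 F hE hQ => f f2; move: (E p) (Q p) (N p) (U p) => e q n u F hE hQ.
  rewrite (_ : _ + _ = f * (sg * ((b + n) * e + (a - u) * q) -
     (sg * sg) * (4 * C * (e * (p.1 - t0) + q * (p.2 - x0))))); last by ring.
  rewrite sg2 mul1r [leRHS]mulrC; apply: ler_wpM2l => //.
  have : C * (- (B * rho) + - (B * rho)) <= C * (e * (p.1 - t0) + q * (p.2 - x0)).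
    by apply: ler_wpM2l; [exact: ltW|exact: lerD].
  move: F rB; move: (sg * _) (e * (p.1 - t0) + _) => X Y F rB'.
  rewrite (_ : C * _ = - (2 * (B * C * rho))); last by ring.
  rewrite -mulrA; move: rB'; rewrite -!mulrA.
  by move: F => /margin; apply.
have v0 := flat_gt0 2 g0; set v := flat 2 gamma in v0.
have [Kf Kf0 fK] := smooth_lipschitz (@smooth_flat R 2).
have M0 : 0 <= M := le_trans (normr_ge0 _) (bu0 0).
have L0 : 0 <= L := le_trans (normr_ge0 _) (bN (0, 0)).
pose K3 := L + `|b| + (M + `|a|) + 4 * C.
have K30 : 0 <= K3 by rewrite /K3 !addr_ge0.
have KK : 0 < 2 * (Kf * K3 + 1) by rewrite mulr_gt0// ltr_wpDl// mulr_ge0.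
(* [K3] is a Lipschitz constant of s near the contact point. On the square of half side d,
   [flat 2 (s p)] stays above half its value v at gamma, which makes the integral strictly
   negative. *)
pose d := Num.min 1 (Num.min rho (v / (2 * (Kf * K3 + 1)))).
have d0 : 0 < d by rewrite !lt_min ltr01 r0 divr_gt0.
have d1 : d <= 1 by rewrite ge_min lexx.
have dr : d <= rho by rewrite !ge_min lexx orbT.
have dv : Kf * (K3 * d) <= v / 2.
  have dd : d <= v / (2 * (Kf * K3 + 1)) by rewrite !ge_min lexx !orbT.
  rewrite mulrA; apply: le_trans (ler_wpM2l (mulr_ge0 Kf0 K30) dd) _.
  rewrite mulrA ler_pdivrMr// (_ : v / 2 * _ = v * (Kf * K3 + 1)); last by field.
  by rewrite mulrC ler_wpM2l ?ltW// ltrDl.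
pose rect := rect_ind (t0 - d) (t0 + d) (x0 - d) (x0 + d).
have Gle' p : G p <= - (c0 / 2) * (v / 2) * rect p.
  apply: le_trans (Gle p) _; rewrite !mulNr lerN2 -2!(mulrA (c0 / 2)).
  apply: ler_wpM2l; first by rewrite divr_ge0// ltW.
  rewrite /rect /rect_ind; have [|_] := boolP (t0 - d <= p.1 <= t0 + d); last first.
    by rewrite mul0r !mulr0 mulr_ge0// flat_ge0.
  have [|_] := boolP (x0 - d <= p.2 <= x0 + d); last by rewrite !mulr0 mulr_ge0// flat_ge0.
  move=> /andP[x1 x2] /andP[t1 t2].
  have ht : `|p.1 - t0| <= d by rewrite ler_distl t1 t2.
  have hx : `|p.2 - x0| <= d by rewrite ler_distl x1 x2.
  have hb : cut_box tau A p := cut_box_near (ltW t00) dr d1 ht hx.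
  rewrite hb !mulr1.
  have dist : `|s p - gamma| <= K3 * d.
    rewrite sE (_ : _ - gamma = sg * (w (t0, x0) - w p + (b * (p.1 - t0) + a * (p.2 - x0))) -
      2 * C * ((p.1 - t0) ^+ 2 + (p.2 - x0) ^+ 2)); last first.
      by move: (w p) (w (t0, x0)) => u1 u2; ring.
    have lw : `|w (t0, x0) - w p| <= L * d + M * d.
      apply: le_trans (potential_lipschitz mU mN mu0 bU bN bu0 U_neg N_neg weakU _ _) _.
      by rewrite /= distrC (distrC x0); apply: lerD; exact: ler_wpM2l.
    have lb : `|b * (p.1 - t0)| <= `|b| * d by rewrite normrM ler_wpM2l.
    have la : `|a * (p.2 - x0)| <= `|a| * d by rewrite normrM ler_wpM2l.
    have dd : d ^+ 2 <= d by rewrite expr2 ler_piMr// ltW.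
    have lt : (p.1 - t0) ^+ 2 <= d.
      by apply: le_trans dd; rewrite -[leLHS]real_normK ?num_real// lerXn2r// nnegrE ltW.
    have lx : (p.2 - x0) ^+ 2 <= d.
      by apply: le_trans dd; rewrite -[leLHS]real_normK ?num_real// lerXn2r// nnegrE ltW.
    apply: le_trans (ler_normB _ _) _; rewrite normrM sg1 mul1r.
    apply: le_trans (lerD (ler_normD _ _) (lexx _)) _.
    apply: le_trans (lerD (lerD lw (ler_normD _ _)) (lexx _)) _.
    rewrite [X in _ + X <= _]ger0_norm; last by rewrite !mulr_ge0 ?addr_ge0 ?sqr_ge0// ltW.
    have lC : C * ((p.1 - t0) ^+ 2 + (p.2 - x0) ^+ 2) <= C * (d + d).
      by apply: ler_wpM2l; [exact: ltW|exact: lerD].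
    have F1 (l m r1 r2 g e : R) : l * e + m * e + (r1 * e + r2 * e) + 2 * (g * (e + e)) =
      (l + r1 + (m + r2) + 4 * g) * e by ring.
    rewrite -[leRHS]F1 -[X in _ + X <= _]mulrA; apply: lerD; last by rewrite ler_pM2l.
    by rewrite lerD2l; exact: lerD.
  have := fK (s p) gamma; rewrite -/v => /le_trans /(_ (ler_wpM2l Kf0 dist)).
  by move=> /le_trans /(_ dv); exact: half_le_of_dist.
have [A' HA'] := bounded_rect_ind (t0 - d) (t0 + d) (x0 - d) (x0 + d).
have iR := bounded_integrable2 HA'.
have := le_Rintegral measurableT (bounded_integrable2 bG)
  (integrableZl measurableT (- (c0 / 2) * (v / 2)) iR) (fun p _ => Gle' p).
rewrite RintegralZl// Rintegral_rect_ind ?ltr_ball//.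
move=> /(le_trans test); apply/negP; rewrite -ltNge mulNr mulNr oppr_lt0.
by rewrite !mulr_gt0// ?subr_gt0 ?ltr_ball// invr_gt0.
Qed.

End Touching.

(** * Almost everywhere signs from integrals over intervals and rectangles *)

Section AlmostEverywhere.
Context {R : realType}.

Local Notation mu := (@lebesgue_measure R).
Local Notation mm := (@lebesgue_measure R \x @lebesgue_measure R)%E.
Local Notation I g := (Rintegral (@lebesgue_measure R) setT g).
Local Notation II Z := (Rintegral mm setT Z).

Lemma ae_mono d (T : measurableType d) (nu : {measure set T -> \bar R}) (P Q : T -> Prop) :
  (forall x, P x -> Q x) -> {ae nu, forall x, P x} -> {ae nu, forall x, Q x}.
Proof.
by move=> PQ [N [mN N0 PN]]; exists N; split => // x nQ; apply: PN => /PQ.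
Qed.

(** At a Lebesgue point g is the limit of its averages over shrinking intervals. Rational end points
    keep the number of conditions countable, which the two-dimensional version relies on. *)
Lemma ae_ge0_of_itv_in A C g (c d : R) : bounded_on1 A C g ->
  (forall a b : rat, c < ratr a -> ratr a < ratr b :> R -> ratr b < d ->
     0 <= I (fun y => g y * (ratr a <= y <= ratr b)%R%:R)) ->
  {ae mu, forall x, c < x -> x < d -> 0 <= g x}.
Proof.
move=> H pos; have := lebesgue_differentiation (bounded_locally_integrable H).
apply: ae_mono.
move=> x gx cx xd.
have n0 n : 0 < n.+1%:R^-1 :> R by rewrite invr_gt0.
(* End points at distance between 1 / (2 (n + 1)) and 1 / (n + 1) from x: the interval has length at
   least 1 / (n + 1), so the normalised indicator is bounded by n + 1. *)
have exa n : exists a : rat, x - n.+1%:R^-1 < ratr a < x - n.+1%:R^-1 / 2.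
  have h : x - n.+1%:R^-1 < x - n.+1%:R^-1 / 2.
    by have := n0 n; move: (_^-1) => u u0; rewrite ltrD2l ltrN2 ltr_pdivrMr// ltr_pMr// ltr1n.
  by have [a] := rat_in_itvoo h; rewrite in_itv/= => ha; exists a.
have exb n : exists b : rat, x + n.+1%:R^-1 / 2 < ratr b < x + n.+1%:R^-1.
  have h : x + n.+1%:R^-1 / 2 < x + n.+1%:R^-1.
    by have := n0 n; move: (_^-1) => u u0; rewrite ltrD2l ltr_pdivrMr// ltr_pMr// ltr1n.
  by have [a] := rat_in_itvoo h; rewrite in_itv/= => ha; exists a.
have [a aP] := choice exa; have [b bP] := choice exb.
pose l n : R := ratr (b n) - ratr (a n).
have lP n : n.+1%:R^-1 < l n.
  have := aP n; have := bP n; rewrite /l; move: (ratr (a n)) (ratr (b n)) (n.+1%:R^-1) => u v w.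
  by lra.
have l0 n : 0 < l n := lt_trans (n0 n) (lP n).
pose J n (y : R) := (ratr (a n) <= y <= ratr (b n))%R%:R : R.
pose k n (y : R) := (l n)^-1 * J n y : R.
have mJ n : measurable_fun setT (J n) by exact: measurable_itv_ind.
have c' : I (fun y => g y * k n y) @[n --> \oo] --> g x.
  apply: (@approximate_identity _ _ _ _ _ 1 k H gx).
  - by move=> n; apply: measurable_funM.
  - move=> n y; rewrite /k mulr1 normrM ger0_norm ?invr_ge0 ?(ltW (l0 n))//.
    have J1 : `|J n y| <= 1 by rewrite /J; case: (_ && _); rewrite ?normr1// normr0.
    apply: (@le_trans _ _ (l n)^-1); first by rewrite ler_piMr ?invr_ge0 ?(ltW (l0 n)).
    by rewrite -[leRHS]invrK lef_pV2 ?posrE// ltW.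
  - move=> n y yr; rewrite /k /J; case: (boolP (_ && _)); last by rewrite mulr0.
    move=> /andP[h1 h2]; exfalso; apply: yr; rewrite /ball/=.
    have := n0 n; have := aP n; have := bP n; move: h1 h2.
    by move: (ratr _) (ratr _) (_^-1) => u v w h1 h2 h3 h4 h5; rewrite ltr_norml; lra.
  - move=> n; rewrite /k RintegralZl//; last exact: (bounded_integrable1 (bounded_itv_ind _ _)).
    by rewrite Rintegral_itv_cst ?mulVf ?gt_eqF// -subr_gt0; exact: l0.
rewrite -(cvg_lim _ c')//; apply: limr_ge; first exact: cvgP c'.
near=> n.
have nx : n.+1%:R^-1 < x - c.
  by near: n; rewrite -subr_gt0 in cx; exact: (near_infty_natSinv_lt (PosNum cx)).
have nd : n.+1%:R^-1 < d - x.
  by near: n; rewrite -subr_gt0 in xd; exact: (near_infty_natSinv_lt (PosNum xd)).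
have H1 : bounded_on1 A (C * 1) (fun y => g y * J n y).
  by apply: bounded_on1_mul => // y; rewrite /J; case: (_ && _); rewrite ?normr1// normr0.
rewrite (_ : I _ = (l n)^-1 * I (fun y => g y * J n y)).
  rewrite mulr_ge0 ?invr_ge0 ?(ltW (l0 n))//.
  have := n0 n; have := aP n; have := bP n; move: nx nd; move: (n.+1%:R^-1) => w h1 h2 h3 h4 h5.
  by apply: pos; move: h3 h4; move: (ratr (a n) : R) (ratr (b n) : R) => u v; lra.
rewrite -RintegralZl//; last exact: bounded_integrable1 H1.
by apply: eq_Rintegral => y _; rewrite /k mulrCA.
Unshelve. all: by end_near. Qed.

Lemma ae_ge0_of_itv C (g : R -> R) (c : R) : measurable_fun setT g -> (forall x, `|g x| <= C) ->
  (forall a b : rat, c < ratr a -> ratr a < ratr b :> R ->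
     0 <= I (fun y => g y * (ratr a <= y <= ratr b)%R%:R)) ->
  {ae mu, forall x, c < x -> 0 <= g x}.
Proof.
move=> mg gC pos.
have h n : {ae mu, forall x, Num.max c (- n%:R) < x -> x < n%:R -> 0 <= cutoff1 n%:R g x}.
  apply: ae_ge0_of_itv_in; first exact: bounded_on1_cutoff1.
  move=> a b; rewrite gt_max => /andP[ca na] ab bn.
  have := pos a b ca ab; congr (0 <= _).
  apply: eq_Rintegral => y _; rewrite /cutoff1.
  case: (boolP (_ <= y <= _)); last by rewrite !mulr0.
  move=> /andP[h1 h2]; rewrite !mulr1 (_ : `|y| <= n%:R) ?mulr1//.
  by rewrite ler_norml (le_trans (ltW na) h1) (le_trans h2 (ltW bn)).
have := ae_foralln h; apply: ae_mono.
move=> x hx cx; pose n := (Num.trunc `|x|).+1.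
have xn : `|x| < n%:R by exact: truncnS_gt.
have := xn; rewrite ltr_norml => /andP[n1 n2].
have := hx n; rewrite gt_max cx n1 => /(_ isT n2).
by rewrite /cutoff1 (ltW xn) mulr1.
Qed.

(** The one-dimensional criterion is used twice. For each rational interval in x it gives a sign to
    the integral over that interval for almost every t; after discarding countably many null sets of
    times it gives a sign to Z (t, x) for almost every x. The set where Z < 0 then has null
    sections. *)
Lemma ae_ge0_of_rect C (Z : R * R -> R) : measurable_fun setT Z -> (forall p, `|Z p| <= C) ->
  (forall t1 t2 x1 x2, 0 < t1 -> t1 < t2 -> x1 < x2 ->
     0 <= II (fun p => Z p * rect_ind t1 t2 x1 x2 p)) ->
  {ae mm, forall p, 0 < p.1 -> 0 <= Z p}.
Proof.
move=> mZ ZC pos.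
have sec t : measurable_fun setT (fun x => Z (t, x)).
  by apply: (measurableT_comp mZ); exact: measurable_pair1.
have h1 (r : rat * rat) : {ae mu, forall t, 0 < t -> ratr r.1 < ratr r.2 :> R ->
    0 <= I (fun x => Z (t, x) * (ratr r.1 <= x <= ratr r.2)%R%:R)}.
  have [r12|r12] := ltP (ratr r.1 : R) (ratr r.2); last first.
    by apply: aeW => t _; discriminate.
  pose s t := I (fun x => Z (t, x) * (ratr r.1 <= x <= ratr r.2)%R%:R).
  pose B : R := `|ratr r.1| + `|ratr r.2|.
  have [_ _ ind0] := bounded_itv_ind (ratr r.1 : R) (ratr r.2).
  have bs t : bounded_on1 B C (fun x => Z (t, x) * (ratr r.1 <= x <= ratr r.2)%R%:R).
    split.
    - by apply: measurable_funM => //; exact: measurable_itv_ind.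
    - move=> x; case: (_ <= x <= _); rewrite ?mulr1// mulr0 normr0.
      exact: le_trans (normr_ge0 _) (ZC (0,0)).
    - by move=> x hx; rewrite ind0// mulr0.
  have ms : measurable_fun setT s.
    apply: (@measurable_Rintegral _ _ _
      (fun p : R * R => Z p * (ratr r.1 <= p.2 <= ratr r.2)%R%:R)).
    apply: measurable_funM => //.
    by apply: (measurableT_comp (measurable_itv_ind _ _)); exact: measurable_snd.
  have := @ae_ge0_of_itv (C * (2 * `|B|)) s 0 ms (fun t => Rintegral_bound (bs t)).
  move=> K; suff h0 : forall a b : rat, 0 < ratr a :> R -> ratr a < ratr b :> R ->
      0 <= I (fun t => s t * (ratr a <= t <= ratr b)%R%:R).
    have := K h0; apply: ae_mono.
    by move=> t ht t0 _; exact: ht.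
  move=> a b a0 ab; have := pos (ratr a) (ratr b) (ratr r.1) (ratr r.2) a0 ab r12.
  have [A' HA'] := bounded_rect_ind (ratr a : R) (ratr b) (ratr r.1) (ratr r.2).
  have HZ : bounded_on2 A' (1 * C) (fun p => rect_ind (ratr a) (ratr b) (ratr r.1) (ratr r.2) p * Z p).
    exact: bounded_on2_mul.
  have -> : II (fun p => Z p * rect_ind (ratr a) (ratr b) (ratr r.1) (ratr r.2) p) =
      II (fun p => rect_ind (ratr a) (ratr b) (ratr r.1) (ratr r.2) p * Z p).
    by apply: eq_Rintegral => p _; rewrite mulrC.
  rewrite (fubini12 HZ); congr (0 <= _); apply: eq_Rintegral => t _.
  rewrite -RintegralZr//; last exact: (bounded_integrable1 (bs t)).
  by apply: eq_Rintegral => x _; rewrite /rect_ind /=; ring.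
have h2 : {ae mu, forall t, 0 < t -> {ae mu, forall x, 0 <= Z (t, x)}}.
  (* Pairs of rationals are enumerated by [unpickle], since countable intersections are indexed by
     natural numbers. *)
  have := @ae_foralln _ _ _ mu (fun n t => forall r : rat * rat, unpickle n = Some r ->
    0 < t -> ratr r.1 < ratr r.2 :> R ->
    0 <= I (fun x => Z (t, x) * (ratr r.1 <= x <= ratr r.2)%R%:R)).
  move=> K; suff h0 : forall n : nat, {ae mu, forall t, forall r : rat * rat,
      unpickle n = Some r -> 0 < t -> ratr r.1 < ratr r.2 :> R ->
      0 <= I (fun x => Z (t, x) * (ratr r.1 <= x <= ratr r.2)%R%:R)}.
    have := K h0; apply: ae_mono.
    move=> t ht t0.
    have hn n : {ae mu, forall x, - n%:R < x -> 0 <= Z (t, x)}.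
      apply: (@ae_ge0_of_itv C) => // a b _ ab.
      by apply: (ht (pickle (a, b)) (a, b)) => //; exact: pickleK.
    have := ae_foralln hn; apply: ae_mono.
    move=> x hx; apply: (hx (Num.trunc `|x|).+1).
    by have := truncnS_gt `|x|; rewrite ltr_norml => /andP[].
  move=> n; case E: (unpickle n) => [r|]; last exact: aeW.
  by have := h1 r; apply: ae_mono => t ht _ [<-].
pose D := [set p : R * R | (0 < p.1) && (Z p < 0)].
have mD : measurable D.
  have m1 : measurable_fun setT (fun p : R * R => (0 < p.1)).
    by apply: measurable_fun_ltr; [exact: measurable_cst|exact: measurable_fst].
  have m2 : measurable_fun setT (fun p : R * R => (Z p < 0)).
    by apply: measurable_fun_ltr => //; exact: measurable_cst.
  have mA := measurable_and m1 m2.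
  have := mA measurableT [set true].
  by rewrite setTI; apply.
exists D; split => //; last first.
  by move=> p /= /not_implyP[p0 /negP]; rewrite -ltNge /D/= p0.
have -> : mm D = (\int[mu]_(t in setT) mu (xsection D t))%E by [].
rewrite (ae_eq_integral (cst 0%E)) ?integral_cst ?mul0e//.
  exact: measurable_fun_xsection.
apply: ae_mono h2 => t ht _ /=; have [t0|t0] := ltP 0 t.
  apply/negligibleP; first exact: measurable_xsection.
  apply: negligibleS (ht t0) => x; rewrite /xsection /= inE /D/= => /andP[_ h] h'.
  by move: h; rewrite ltNge h'.
rewrite (_ : xsection D t = set0) ?measure0//; apply/seteqP; split => // x.
by rewrite /xsection /= inE /D/= ltNge t0.
Qed.

End AlmostEverywhere.

(** * Entropy inequalities and the addition of constants *)

Section Dissipation.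
Context {R : realType}.

Local Notation mu := (@lebesgue_measure R).
Local Notation mm := (@lebesgue_measure R \x @lebesgue_measure R)%E.
Local Notation I g := (Rintegral (@lebesgue_measure R) setT g).
Local Notation II Z := (Rintegral mm setT Z).

Lemma derive_out_supp (phi : R * R -> R) p v : ~ supp phi p -> 'D_v phi p = 0.
Proof.
move=> np; have op : open (~` supp phi) by apply: closed_openC; exact: closed_closure.
have h : \forall y \near p, phi y = cst 0 y.
  have : nbhs p (~` supp phi) by exact: open_nbhs_nbhs.
  apply: filterS => y ny /=; apply: contrapT => /eqP h.
  by apply: ny; exact: subset_closure.
by rewrite (near_eq_derive v h) derive_cst.
Qed.

Lemma bounded_of_compact_supp (K : set (R * R)) g : compact K -> continuous g ->
  (forall p, ~ K p -> g p = 0) -> exists A C, bounded_on2 A C g.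
Proof.
move=> cK cg gK; have [A [_ HA]] := compact_bounded cK.
have cI : compact (g @` K) by apply: continuous_compact => //; exact: continuous_subspaceT.
have [C [_ HC]] := compact_bounded cI.
exists (`|A| + 1), (`|C| + 1); split; first exact: continuous_plane_measurable.
- move=> p; have [Kp|Kp] := pselect (K p); last by rewrite gK// normr0 addr_ge0.
  by apply: HC; [rewrite (le_lt_trans (ler_norm _))// ltrDl|exists p].
- move=> p hp; apply: gK => Kp.
  have /= : `|p| <= `|A| + 1 by apply: HA => //; rewrite (le_lt_trans (ler_norm _))// ltrDl.
  rewrite prod_normE/= ge_max => /andP[h1 h2].
  by case: hp; rewrite ltNge ?h1 ?h2.
Qed.

Lemma test_function_bounded (phi : R * R -> R) : test_function phi ->
  exists A C, [/\ bounded_on2 A C phi, bounded_on2 A C (dt phi) & bounded_on2 A C (dx phi)].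
Proof.
move=> [Cphi cK].
have [_ [_ _ Ct Cx]] := Cphi 1%N.
have phi0 p : ~ supp phi p -> phi p = 0.
  by move=> np; apply: contrapT => /eqP h; apply: np; exact: subset_closure.
have [A0 [C0 H0]] := bounded_of_compact_supp cK (Cn_plane_continuous (Cphi 0%N)) phi0.
have [A1 [C1 H1]] := bounded_of_compact_supp cK (proj1 Ct)
  (fun p np => derive_out_supp _ np).
have [A2 [C2 H2]] := bounded_of_compact_supp cK (proj1 Cx)
  (fun p np => derive_out_supp _ np).
have mono A C A' C' g : A <= A' -> C <= C' -> bounded_on2 A C g -> bounded_on2 A' C' g.
  move=> AA CC [mg gC gA]; split => //; first by move=> p; exact: le_trans (gC p) CC.
  by move=> p [h|h]; apply: gA; [left|right]; exact: le_lt_trans h.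
exists (Num.max A0 (Num.max A1 A2)), (Num.max C0 (Num.max C1 C2)).
by split; [apply: mono H0|apply: mono H1|apply: mono H2]; rewrite !le_max lexx ?orbT.
Qed.

Lemma is_derive_section_t (Z : R * R -> R) (t z d : R) : is_derive (t, z) (1, 0) Z d ->
  is_derive t 1 (fun s : R => Z (s, z)) d.
Proof.
move=> /is_derive_line D; apply/is_derive_line.
have -> : (fun h : R => Z (h *: (1 : R) + t, z)) = (fun h : R => Z (h *: (1, 0) + (t, z))).
  apply/funext => h; congr Z; rewrite [RHS]surjective_pairing/=.
  by congr pair; rewrite /GRing.scale/= mulr0 add0r.
exact: D.
Qed.

Lemma Rintegral_dt (phi : R * R -> R) : test_function phi -> II (dt phi) = 0.
Proof.
move=> tp; have [A [C [[mp pC pA] Ht _]]] := test_function_bounded tp.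
have [_ [dphi _ Ct _]] := tp.1 1%N.
have [_ _ tA] := Ht.
rewrite (fubini21 Ht); transitivity (I (cst 0)); last by rewrite Rintegral_cst// mul0r.
apply: eq_Rintegral => x _.
have A0 := normr_ge0 A; have AA := ler_norm A.
have cc : continuous (fun t => dt phi (t, x)).
  move=> t; apply: (@continuous_comp _ _ _ (fun t : R => (t, x)) (dt phi)).
    have h1 : id @ (nbhs t) --> t by exact: cvg_id.
    have h2 : cst x @ (nbhs t) --> x by exact: cvg_cst.
    exact: (cvg_pair h1 h2).
  exact: (proj1 Ct).
have B0 : - (`|A| + 1) < `|A| + 1 by lra.
rewrite (Rintegral_derive_supp B0 (F := fun t => phi (t, x)) _ cc).
- by rewrite !pA ?subrr//; left; rewrite /= ?normrN ger0_norm; lra.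
- by move=> t; apply: is_derive_section_t; exact: DeriveDef.
- move=> t ht; apply: tA; left => /=; rewrite lter_normr.
  by apply/orP; case: ht => h; [right|left]; lra.
Qed.

Lemma Rintegral_dx (phi : R * R -> R) : test_function phi -> II (dx phi) = 0.
Proof.
move=> tp; have [A [C [[mp pC pA] _ Hx]]] := test_function_bounded tp.
have [_ [_ dphi _ Cx]] := tp.1 1%N.
have [_ _ xA] := Hx.
rewrite (fubini12 Hx); transitivity (I (cst 0)); last by rewrite Rintegral_cst// mul0r.
apply: eq_Rintegral => t _.
have A0 := normr_ge0 A; have AA := ler_norm A.
have B0 : - (`|A| + 1) < `|A| + 1 by lra.
rewrite (Rintegral_derive_supp B0 (F := fun x => phi (t, x)) _
  (continuous_section (proj1 Cx))).
- by rewrite !pA ?subrr//; right; rewrite /= ?normrN ger0_norm; lra.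
- by move=> x; apply: is_derive_section_x; exact: DeriveDef.
- move=> x hx; apply: xA; right => /=; rewrite lter_normr.
  by apply/orP; case: hx => h; [right|left]; lra.
Qed.

Definition dissipative (E Q : R * R -> R) : Prop :=
  forall psi, test_function psi -> supp psi `<=` half_plane -> (forall p, 0 <= psi p) ->
    0 <= II (fun p => E p * dt psi p + Q p * dx psi p).

Lemma Rintegral2_lincomb a b (f g : R * R -> R) : mm.-integrable setT (EFin \o f) ->
  mm.-integrable setT (EFin \o g) ->
  II (fun p => a * f p + b * g p) = a * II f + b * II g.
Proof.
move=> fi gi; rewrite -!RintegralZl//.
by apply: RintegralD => //; [exact: integrableZl fi|exact: integrableZl gi].
Qed.

(** The derivatives of a test function have integral 0, so constants may be added to E and Q
    independently. These two constants are the freedom used in building certificates. *)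
Lemma dissipative_affine (B a c1 c2 : R) (X Y : R * R -> R) : 0 <= a ->
  measurable_fun setT X -> measurable_fun setT Y ->
  (forall p, `|X p| <= B) -> (forall p, `|Y p| <= B) -> dissipative X Y ->
  dissipative (fun p => a * X p + c1) (fun p => a * Y p + c2).
Proof.
move=> a0 mX mY bX bY d psi tp sp p0.
have [A [C [_ Ht Hx]]] := test_function_bounded tp.
have iX := bounded_integrable2 (bounded_on2_mul Ht mX bX).
have iY := bounded_integrable2 (bounded_on2_mul Hx mY bY).
have it := bounded_integrable2 Ht; have ix := bounded_integrable2 Hx.
have iXY : mm.-integrable setT (EFin \o (fun p => dt psi p * X p + dx psi p * Y p)).
  exact: (integrableD measurableT iX iY).
have itx : mm.-integrable setT (EFin \o (fun p => c1 * dt psi p + c2 * dx psi p)).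
  exact: (integrableD measurableT (integrableZl measurableT c1 it) (integrableZl measurableT c2 ix)).
have -> : II (fun p => (a * X p + c1) * dt psi p + (a * Y p + c2) * dx psi p) =
    a * II (fun p => X p * dt psi p + Y p * dx psi p) + (c1 * II (dt psi) + c2 * II (dx psi)).
  rewrite -(Rintegral2_lincomb _ _ it ix) -[X in _ = _ + X]mul1r.
  transitivity (a * II (fun p => dt psi p * X p + dx psi p * Y p) +
      1 * II (fun p => c1 * dt psi p + c2 * dx psi p)).
    rewrite -Rintegral2_lincomb//; apply: eq_Rintegral => p _; ring.
  congr (a * _ + _); apply: eq_Rintegral => p _; ring.
rewrite Rintegral_dt// Rintegral_dx// !mulr0 !addr0 mulr_ge0//; exact: d.
Qed.

Lemma dissipative_cst c1 c2 : dissipative (cst c1) (cst c2).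
Proof.
move=> psi tp sp p0.
have [A [C [_ Ht Hx]]] := test_function_bounded tp.
have -> : II (fun p => cst c1 p * dt psi p + cst c2 p * dx psi p) =
    c1 * II (dt psi) + c2 * II (dx psi).
  by rewrite -Rintegral2_lincomb//; [exact: bounded_integrable2 Ht|exact: bounded_integrable2 Hx].
by rewrite Rintegral_dt// Rintegral_dx// !mulr0 addr0.
Qed.

End Dissipation.

(** * Comparison of potentials *)

Section Comparison.
Context {R : realType}.

Definition touches (sg : R) (w : R * R -> R) (C gamma t0 x0 b a : R) : Prop :=
  forall t x, 0 <= t -> - C * ((t - t0) ^+ 2 + (x - x0) ^+ 2) - gamma <=
    sg * (w (t, x) - w (t0, x0) - b * (t - t0) - a * (x - x0)).

(* w is a strict viscosity supersolution (sg = 1) or subsolution (sg = -1) of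
   w_t + f(w_x) = 0 at the slopes in P, quantitatively and for approximate contact. *)
Definition excluded (sg : R) (w : R * R -> R) (f : R -> R) (P : set R) : Prop :=
  forall sigma tau C, 0 < sigma -> 0 < tau -> 0 < C ->
  exists2 gamma, 0 < gamma & forall t0 x0 p e, P p -> sigma <= e -> tau <= t0 ->
    ~ touches sg w C gamma t0 x0 (- f p - sg * e) p.

Lemma touches_le sg w C gamma gamma' t0 x0 b a : gamma <= gamma' ->
  touches sg w C gamma t0 x0 b a -> touches sg w C gamma' t0 x0 b a.
Proof.
by move=> gg h t x t0'; apply: le_trans (h t x t0'); rewrite lerD2l lerN2.
Qed.

Definition lipschitz_time (L : R) (w : R * R -> R) : Prop :=
  forall t s x, 0 <= t -> 0 <= s -> `|w (t, x) - w (s, x)| <= L * `|t - s|.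

Lemma young_ge (L K a : R) : 0 < K -> - (L ^+ 2 / (4 * K)) <= K * a ^+ 2 - L * a.
Proof.
move=> K0; rewrite -subr_ge0.
rewrite (_ : _ - _ = K * (a - L / (2 * K)) ^+ 2); first by rewrite mulr_ge0 ?sqr_ge0 ?(ltW K0).
by field; rewrite gt_eqF.
Qed.

Section doubling.
Variables (w1 w2 : R * R -> R) (f H : R -> R) (P : set R) (L : R).
Hypothesis L0 : 0 < L.
Hypothesis lip1 : lipschitz_time L w1.
Hypothesis lip2 : lipschitz_time L w2.
Hypothesis ex1 : excluded 1 w1 f P.
Hypothesis ex2 : excluded (-1) w2 f P.
Hypothesis slopes : forall theta, 0 < theta -> exists2 C, 0 <= C &
  forall t s x y, 0 <= t -> 0 <= s ->
    w1 (t, y) - w2 (s, x) + H (y - x) + L ^+ 2 / theta * (t - s) ^+ 2 <= - (theta / 2) ->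
  exists2 p, P p & forall h, H (y - x + h) <= H (y - x) - p * h + C * h ^+ 2.
Hypothesis initial : forall x y, 0 <= w1 (0, y) - w2 (0, x) + H (y - x).

(** From ordered data at time 0 and Lipschitz continuity in time: a clearly negative value forces
    the times away from 0. *)
Lemma doubled_ge t s x y : 0 <= t -> 0 <= s ->
  - (L * t) - L * s <= w1 (t, y) - w2 (s, x) + H (y - x).
Proof.
move=> t0 s0; have := lip1 y t0 (lexx 0); have := lip2 x s0 (lexx 0).
rewrite !subr0 (ger0_norm t0) (ger0_norm s0) !ler_norml; have := initial x y; lra.
Qed.

(* Both time and space variables are doubled. An approximate minimum of Phi suffices, since
   [excluded] allows for the error gamma; this avoids any compactness in x. *)
Lemma comparison t x y : 0 <= t -> 0 <= w1 (t, y) - w2 (t, x) + H (y - x).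
Proof.
move=> that0; rewrite leNgt; apply/negP => neg.
set v := (w1 _ - _ + _) in neg; pose theta := - v / 2.
have th0 : 0 < theta by rewrite /theta; lra.
have tt0 : 0 < t + 1 by lra.
(* At the assumed negative point both penalties together cost at most theta, half of the violation.
   The term in sigma provides strictness; the quadratic term in delta bounds the functional from
   below for large times. *)
pose sigma := theta / (2 * (t + 1)); pose delta := theta / (2 * (t + 1) ^+ 2).
have sg0 : 0 < sigma by rewrite divr_gt0// mulr_gt0.
have dl0 : 0 < delta by rewrite divr_gt0// mulr_gt0// exprn_gt0.
have small : sigma * t + delta * t ^+ 2 <= theta.
  rewrite (_ : sigma * t + _ = theta * (t * (t + 1) + t ^+ 2) / (2 * (t + 1) ^+ 2)); last first.
    by rewrite /sigma /delta; field; rewrite gt_eqF.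
  by rewrite ler_pdivrMr ?mulr_gt0 ?exprn_gt0// ler_pM2l//; nra.
(* Chosen so that L |t - s| exceeds K (t - s) ^ 2 by at most theta / 4. *)
pose K := L ^+ 2 / theta; have K0 : 0 < K by rewrite divr_gt0// exprn_gt0.
have LK : L ^+ 2 / (4 * K) = theta / 4 by rewrite /K; field; rewrite !gt_eqF.
have [CH CH0 slope] := slopes th0.
pose C := delta + K + CH; have C0 : 0 < C by rewrite /C; lra.
(* A value below - theta / 2 requires L t0 + L s0 >= theta / 2 + K (t0 - s0) ^ 2 by [doubled_ge];
   the choice of K then leaves 2 L t0 >= theta / 4, and likewise for s0. *)
pose tau := theta / (8 * L); have tau0 : 0 < tau by rewrite divr_gt0// mulr_gt0.
have sg20 : 0 < sigma / 2 by rewrite divr_gt0.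
have [g1 g10 E1] := ex1 sg20 tau0 C0; have [g2 g20 E2] := ex2 sg20 tau0 C0.
pose gamma := Num.min (theta / 2) (Num.min g1 g2).
have gm0 : 0 < gamma by rewrite !lt_min divr_gt0//= g10 g20.
have gth : gamma <= theta / 2 by rewrite ge_min lexx.
have gg1 : gamma <= g1 by rewrite !ge_min lexx orbT.
have gg2 : gamma <= g2 by rewrite !ge_min lexx !orbT.
pose Phi (t s y x : R) := w1 (t, y) - w2 (s, x) + H (y - x) + sigma * t + delta * t ^+ 2 +
  K * (t - s) ^+ 2.
pose V : set R := [set z | exists t s y x, [/\ 0 <= t, 0 <= s & z = Phi t s y x]].
have Vlow t1 s1 y1 x1 : 0 <= t1 -> 0 <= s1 -> - (L ^+ 2 / delta) - theta / 4 <= Phi t1 s1 y1 x1.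
  move=> t10 s10; have := doubled_ge x1 y1 t10 s10; rewrite /Phi.
  have := young_ge (2 * L) t1 dl0; have := young_ge L (s1 - t1) K0; rewrite LK.
  have -> : (2 * L) ^+ 2 / (4 * delta) = L ^+ 2 / delta by field; rewrite gt_eqF.
  have := mulr_ge0 (ltW sg0) t10.
  rewrite (_ : (s1 - t1) ^+ 2 = (t1 - s1) ^+ 2); last by ring.
  move: (w1 _ - _ + _) (L ^+ 2 / delta) (K * _) (delta * _) (sigma * _) => a b c d e.
  lra.
have hV : has_inf V.
  split; first by exists (Phi t t y x), t, t, y, x.
  by exists (- (L ^+ 2 / delta) - theta / 4) => z [t1 [s1 [y1 [x1 [h1 h2 ->]]]]]; exact: Vlow.
have [_ [t0 [s0 [y0 [x0 [t00 s00 ->]]]]] near] := inf_adherent gm0 hV.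
have minl t1 s1 y1 x1 : 0 <= t1 -> 0 <= s1 -> Phi t0 s0 y0 x0 <= Phi t1 s1 y1 x1 + gamma.
  move=> h1 h2; apply: le_trans (ltW near) _; rewrite lerD2r.
  by apply: ge_inf; [exact: hV.2|exists t1, s1, y1, x1].
have Phi0 : Phi t0 s0 y0 x0 <= - (theta / 2).
  apply: le_trans (minl t t y x that0 that0) _; rewrite /Phi -/v subrr expr0n/= mulr0 addr0.
  rewrite -addrA -(addrA v); have -> : v = - (2 * theta) by rewrite /theta; field.
  lra.
have Phi1 : w1 (t0, y0) - w2 (s0, x0) + H (y0 - x0) + K * (t0 - s0) ^+ 2 <= - (theta / 2).
  apply: le_trans Phi0; rewrite /Phi; have := mulr_ge0 (ltW sg0) t00.
  have := mulr_ge0 (ltW dl0) (sqr_ge0 t0); lra.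
have tL : 8 * L * tau = theta by rewrite /tau; field; rewrite gt_eqF.
have [ts1 ts2] : tau <= t0 /\ tau <= s0.
  have := doubled_ge x0 y0 t00 s00; move: Phi1.
  have := young_ge L (s0 - t0) K0; have := young_ge L (t0 - s0) K0; rewrite LK.
  rewrite (_ : (s0 - t0) ^+ 2 = (t0 - s0) ^+ 2); last by ring.
  move: (w1 _ - _ + _) (K * _) => a b h1 h2 h3 h4.
  have L8 : 0 < 8 * L by rewrite mulr_gt0.
  by split; rewrite -(ler_pM2l L8) tL; lra.
have [p Pp Hp] := slope t0 s0 x0 y0 t00 s00 Phi1.
(* Time slopes of the paraboloids touching w1 from below and w2 from above. The space slope is the
   same p for both, because H depends on y - x only. *)
pose b2 := - (2 * K * (t0 - s0)); pose b1 := b2 - sigma - 2 * delta * t0.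
have touch1 : touches 1 w1 C gamma t0 y0 b1 p.
  move=> t1 y1 t10; rewrite mul1r.
  have := minl t1 s0 y1 x0 t10 s00; rewrite /Phi.
  have := Hp (y1 - y0); rewrite (_ : y0 - x0 + (y1 - y0) = y1 - x0); last by ring.
  move: (w1 (t1, y1)) (w1 (t0, y0)) (w2 (s0, x0)) (H (y0 - x0)) (H (y1 - x0)) => a b c d e h1 h2.
  rewrite /C /b1 /b2.
  have q1 := mulr_ge0 CH0 (sqr_ge0 (t1 - t0)).
  have q2 := mulr_ge0 (ltW dl0) (sqr_ge0 (y1 - y0)); have q3 := mulr_ge0 (ltW K0) (sqr_ge0 (y1 - y0)).
  lra.
have touch2 : touches (-1) w2 C gamma s0 x0 b2 p.
  move=> s1 x1 s10.
  have := minl t0 s1 y0 x1 t00 s10; rewrite /Phi.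
  have := Hp (x0 - x1); rewrite (_ : y0 - x0 + (x0 - x1) = y0 - x1); last by ring.
  move: (w2 (s1, x1)) (w1 (t0, y0)) (w2 (s0, x0)) (H (y0 - x0)) (H (y0 - x1)) => a b c d e h1 h2.
  rewrite /C /b2.
  have q1 := mulr_ge0 CH0 (sqr_ge0 (s1 - s0)).
  have q2 := mulr_ge0 (ltW dl0) (sqr_ge0 (s1 - s0)); have q3 := mulr_ge0 (ltW K0) (sqr_ge0 (x1 - x0)).
  have q4 := mulr_ge0 (ltW dl0) (sqr_ge0 (x1 - x0)).
  lra.
(* Since b1 <= b2 - sigma, either b1 is below - f p by at least sigma / 2 or b2 is above it by at
   least sigma / 2; each case is excluded. *)
have [e1|e1] := leP (sigma / 2) (- f p - b1).
  apply: (E1 t0 y0 p _ Pp e1 ts1); apply: touches_le gg1 _.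
  by rewrite (_ : - f p - 1 * (- f p - b1) = b1); last by ring.
have e2 : sigma / 2 <= b2 + f p.
  by have := mulr_ge0 (ltW dl0) t00; move: e1; rewrite /b1; lra.
apply: (E2 s0 x0 p _ Pp e2 ts2); apply: touches_le gg2 _.
by rewrite (_ : - f p - -1 * (b2 + f p) = b2); last by ring.
Qed.

End doubling.
End Comparison.

(** * Penalisations with one-sided slopes *)

Section Slopes_of_potentials.
Context {R : realType}.

(** For X = (z + h) ^ 2 + e ^ 2 and s the root at z, sqrt X <= (s ^ 2 + X) / (2 s) by the
    arithmetic-geometric inequality. The right-hand side is the stated quadratic up to 1 / (2 s) <=
    1 / (2 e). *)
Lemma sqrt_quadratic (e z h : R) : 0 < e ->
  Num.sqrt ((z + h) ^+ 2 + e ^+ 2) <= Num.sqrt (z ^+ 2 + e ^+ 2) +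
    z / Num.sqrt (z ^+ 2 + e ^+ 2) * h + (2 * e)^-1 * h ^+ 2.
Proof.
move=> e0; set s := Num.sqrt (z ^+ 2 + e ^+ 2).
have s2 : s ^+ 2 = z ^+ 2 + e ^+ 2 by rewrite sqr_sqrtr// addr_ge0 ?sqr_ge0.
have es : e <= s.
  by rewrite -(@ler_pXn2r _ 2)// ?nnegrE ?sqrtr_ge0 ?(ltW e0)// s2 lerDr sqr_ge0.
have s0 : 0 < s := lt_le_trans e0 es.
pose y := s + z / s * h + (2 * s)^-1 * h ^+ 2.
have yE : 2 * s * y = s ^+ 2 + (z + h) ^+ 2 + e ^+ 2.
  rewrite (_ : 2 * s * y = s ^+ 2 + s ^+ 2 + 2 * z * h + h ^+ 2).
    by rewrite {2}s2; ring.
  by rewrite /y; field; rewrite gt_eqF.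
have y0 : 0 <= y.
  by rewrite -(pmulr_rge0 _ (mulr_gt0 (ltr0Sn R 1) s0)) yE !addr_ge0 ?sqr_ge0.
apply: (@le_trans _ _ y).
  rewrite -(ger0_norm y0) -sqrtr_sqr ler_sqrt ?sqr_ge0// -subr_ge0.
  rewrite (_ : y ^+ 2 - _ = (y - s) ^+ 2 + (2 * s * y - (s ^+ 2 + (z + h) ^+ 2 + e ^+ 2))).
    by rewrite yE subrr addr0 sqr_ge0.
  by ring.
rewrite /y lerD2l ler_wpM2r ?sqr_ge0// lef_pV2 ?posrE ?mulr_gt0// ler_pM2l//.
Qed.


(* H has slope - k on the positive axis and is so steep on the negative one that, w being
   Lipschitz, contact occurs at a definite distance from the kink. *)
Lemma slope_ge_of_excluded (w : R * R -> R) (f : R -> R) (L M b k : R) : 0 < L -> 0 < M ->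
  0 < b -> k <= 0 -> lipschitz_time L w ->
  (forall t x y, `|w (t, x) - w (t, y)| <= M * `|x - y|) ->
  (forall x y, x <= y -> b * (y - x) <= w (0, y) - w (0, x)) ->
  excluded 1 w f [set k] -> excluded (-1) w f [set k] ->
  forall t x y, 0 <= t -> x <= y -> k * (y - x) <= w (t, y) - w (t, x).
Proof.
move=> L0 M0 b0 k0 lt lx init ex1 ex2 t x y t0 xy.
pose D := M + `|k|; have D0 : 0 < D by rewrite ltr_wpDr.
(* The constant D makes H z >= M |z| for z <= 0, which compensates any decrease of w in x. *)
pose H (z : R) := - k * z + 2 * D * Num.max 0 (- z).
have kE : `|k| = - k by rewrite ler0_norm.
have HN z : z <= 0 -> M * - z <= H z.
  move=> z0; rewrite /H (max_idPr _) ?oppr_ge0// /D kE.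
  by have := mulr_le0 k0 z0; have := mulr_ge0_le0 (ltW M0) z0; lra.
have HP z : 0 <= z -> H z = - k * z.
  by move=> z0; rewrite /H (max_idPl _) ?mulr0 ?addr0// oppr_le0.
have bdx r x1 y1 : - (M * `|y1 - x1|) <= w (r, y1) - w (r, x1).
  by have := lx r y1 x1; rewrite ler_norml => /andP[].
suff : 0 <= w (t, y) - w (t, x) + H (y - x) by rewrite HP ?subr_ge0//; lra.
apply: (comparison L0 lt lt ex1 ex2) => //.
- move=> theta th0; pose zs := theta / (4 * D).
  have zs0 : 0 < zs by rewrite divr_gt0// mulr_gt0.
  have zsE : 4 * D * zs = theta by rewrite /zs; field; rewrite gt_eqF.
  have C0 : 0 <= 2 * D / zs by rewrite divr_ge0 ?(ltW zs0)// mulr_ge0// ltW.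
  (* Crossing the kink from z >= zs requires |e| > zs, and then the linear excess 2 D |e| is at most
     (2 D / zs) e ^ 2. *)
  exists (2 * D / zs) => // t1 s1 x1 y1 t10 s10; set z := y1 - x1 => near; exists k => // e.
  have K0 : 0 < L ^+ 2 / theta by rewrite divr_gt0// exprn_gt0.
  have yg := young_ge L `|t1 - s1| K0; rewrite real_normK ?num_real// in yg.
  have LK : L ^+ 2 / (4 * (L ^+ 2 / theta)) = theta / 4 by field; rewrite !gt_eqF.
  rewrite LK in yg.
  have h1 : - (L * `|t1 - s1|) <= w (t1, x1) - w (s1, x1).
    by have := lt t1 s1 x1 t10 s10; rewrite ler_norml => /andP[].
  have h2 := bdx t1 x1 y1; rewrite -/z in h2.
  (* The terms in t cost at most theta / 4, so a value below - theta / 2 needs a drop of w in x of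
     at least theta / 4, which the slope bound M <= D allows only for z >= theta / (4 D). *)
  have zz : zs <= z.
    rewrite -(@ler_pM2l _ (4 * D)) ?mulr_gt0// zsE.
    have [z0|z0] := leP z 0.
      have := HN _ z0; rewrite (ler0_norm z0) in h2.
      move: near h1 h2 yg th0; move: (_ * (t1 - s1) ^+ 2) (L * `|_|) => A B; lra.
    rewrite (gtr0_norm z0) in h2; move: near; rewrite (HP _ (ltW z0)) /D kE.
    have := mulr_le0_ge0 k0 (ltW z0).
    by move: h1 h2 yg th0; move: (_ * (t1 - s1) ^+ 2) (L * `|_|) => A B; lra.
  have z0 : 0 <= z := le_trans (ltW zs0) zz.
  rewrite (HP z z0); have [ze|ze] := leP 0 (z + e).
    by rewrite HP// mulrDr mulNr mulNr lerDl mulr_ge0// sqr_ge0.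
  rewrite /H (max_idPr _); last by lra.
  have e0 : zs <= - e by lra.
  have h3 : 2 * D * - (z + e) <= 2 * D * - e by rewrite ler_pM2l ?mulr_gt0//; lra.
  have h4 : 2 * D * - e <= 2 * D / zs * e ^+ 2.
    rewrite -(mulrA (2 * D)) ler_pM2l ?mulr_gt0// mulrC ler_pdivlMr// -sqrrN expr2.
    by rewrite ler_wpM2l//; lra.
  by move: h3 h4; move: (_ / zs * _) => r; lra.
- move=> x1 y1; have [xy1|yx1] := leP x1 y1.
    have z0 : 0 <= y1 - x1 by rewrite subr_ge0.
    have := init _ _ xy1; rewrite HP//; have := mulr_ge0 (ltW b0) z0.
    by have := mulr_le0_ge0 k0 z0; lra.
  have z0 : y1 - x1 <= 0 by lra.
  by have := HN _ z0; have := bdx 0 x1 y1; rewrite (ler0_norm z0); lra.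
Qed.

(* H regularises - b z + M max(0, - z), so that its slopes are opposite to those of P. *)
Lemma le_of_excluded (w1 w2 : R * R -> R) (f : R -> R) (L M b : R) : 0 < L -> 0 < M ->
  0 < b -> lipschitz_time L w1 -> lipschitz_time L w2 ->
  (forall t x y, `|w1 (t, x) - w1 (t, y)| <= M * `|x - y|) ->
  (forall x y, x <= y -> b * (y - x) <= w1 (0, y) - w1 (0, x)) ->
  (forall x, w1 (0, x) = w2 (0, x)) ->
  excluded 1 w1 f [set p | b <= p <= b + M] -> excluded (-1) w2 f [set p | b <= p <= b + M] ->
  forall t x, 0 <= t -> w2 (t, x) <= w1 (t, x).
Proof.
move=> L0 M0 b0 lt1 lt2 lx init w0 ex1 ex2 t x t0.
(* [H 0] = M / 2 * eps is the price of smoothing the kink; eps is then made small compared with the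
   violation. *)
suff main eps : 0 < eps -> 0 <= w1 (t, x) - w2 (t, x) + M / 2 * eps.
  rewrite -subr_ge0 leNgt; apply/negP => neg.
  set v := _ - _ in neg main; have e0 : 0 < - v / M by rewrite divr_gt0// oppr_gt0.
  have := main _ e0; rewrite (_ : M / 2 * (- v / M) = - v / 2); last by field; rewrite gt_eqF.
  by lra.
move=> e0; pose s (z : R) := Num.sqrt (z ^+ 2 + eps ^+ 2).
pose H z := - b * z + M / 2 * (s z - z).
have sz z : `|z| <= s z by rewrite -sqrtr_sqr ler_sqrt ?lerDl ?sqr_ge0// addr_ge0 ?sqr_ge0.
have s_gt0 z : 0 < s z by rewrite sqrtr_gt0 ltr_wpDl ?sqr_ge0// exprn_gt0.
have H0 : H 0 = M / 2 * eps.
  by rewrite /H /s expr0n/= add0r sqrtr_sqr gtr0_norm// mulr0 add0r subr0.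
have Hx : H (x - x) = M / 2 * eps by rewrite subrr.
rewrite -Hx; apply: (comparison L0 lt1 lt2 ex1 ex2) => //.
- move=> theta th0; have C0 : 0 <= M / 2 * (2 * eps)^-1.
    by rewrite mulr_ge0 ?invr_ge0 ?divr_ge0 ?mulr_ge0 ?(ltW M0) ?(ltW e0).
  exists (M / 2 * (2 * eps)^-1) => // t1 s1 x1 y1 _ _ _; set z := y1 - x1.
  have M20 : 0 < M / 2 by rewrite divr_gt0.
  have zs : `|z / s z| <= 1.
    by rewrite normrM normfV (gtr0_norm (s_gt0 z)) ler_pdivrMr// mul1r.
  (* Minus the derivative of H at z; it lies between b and b + M because |z / s z| <= 1. *)
  exists (b + M / 2 * (1 - z / s z)) => /=.
    move: zs; rewrite ler_norml => /andP[h1 h2].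
    have := ler_wpM2l (ltW M20) h2; have := ler_wpM2l (ltW M20) h1.
    by rewrite mulrBr; move: (z / s z) => r; lra.
  move=> e; have := sqrt_quadratic z e e0; rewrite -/(s z) -/(s (z + e)) => h.
  have := ler_wpM2l (ltW M20) h; rewrite /H.
  move: (s (z + e)) (s z) (z / s z) ((2 * eps)^-1) => a1 a2 a3 a4; lra.
- move=> x1 y1; rewrite -w0; have s1 := sz (y1 - x1).
  have M20 : 0 < M / 2 by rewrite divr_gt0.
  have h := ler_wpM2l (ltW M20) s1.
  have [xy1|yx1] := leP x1 y1.
    have z0 : 0 <= y1 - x1 by rewrite subr_ge0.
    have := init _ _ xy1; move: h; rewrite (ger0_norm z0) /H.
    by move: (s _) => a1; lra.
  have z0 : y1 - x1 <= 0 by lra.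
  have hx : - (M * `|y1 - x1|) <= w1 (0, y1) - w1 (0, x1).
    by have := lx 0 y1 x1; rewrite ler_norml => /andP[].
  have := mulr_ge0_le0 (ltW b0) z0; move: h hx; rewrite (ler0_norm z0) /H.
  by move: (s _) => a1; lra.
Qed.

End Slopes_of_potentials.

(** * From entropy certificates to excluded slopes *)

Section Certificates.
Context {R : realType}.

Local Notation mm := (@lebesgue_measure R \x @lebesgue_measure R)%E.
Local Notation I g := (Rintegral (@lebesgue_measure R) setT g).
Local Notation II Z := (Rintegral mm setT Z).

Variables (U N : R * R -> R) (u0 : R -> R) (M L : R).
Hypothesis mU : measurable_fun setT U.
Hypothesis mN : measurable_fun setT N.
Hypothesis mu0 : measurable_fun setT u0.
Hypothesis bU : forall p, `|U p| <= M.
Hypothesis bN : forall p, `|N p| <= L.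
Hypothesis bu0 : forall x, `|u0 x| <= M.
Hypothesis U_neg : forall p, p.1 <= 0 -> U p = 0.
Hypothesis N_neg : forall p, p.1 <= 0 -> N p = 0.
Hypothesis weakU : forall phi, test_function phi ->
  II (fun p => U p * dt phi p + N p * dx phi p) + I (fun x => u0 x * phi (0, x)) = 0.

Let w := potential N u0.

Lemma lipschitz_time_potential : lipschitz_time L w.
Proof.
move=> t s x _ _.
have h := potential_lipschitz mU mN mu0 bU bN bu0 U_neg N_neg weakU (t, x) (s, x).
by apply: le_trans h _; rewrite subrr normr0 mulr0 addr0.
Qed.

(** B and c0 may depend on sigma but not on p or e: they determine rho, and hence the tolerated
    contact error C rho ^ 2 / 4, before the contact is known. *)
Lemma excluded_of_certificate (sg : R) (f : R -> R) (P : set R) : sg * sg = 1 ->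
  (forall sigma, 0 < sigma -> exists B c0 : R, 0 < c0 /\ forall p e, P p -> sigma <= e ->
     exists E Q : R * R -> R, [/\ measurable_fun setT E, measurable_fun setT Q,
       forall z, `|E z| <= B, forall z, `|Q z| <= B & dissipative E Q] /\
       forall z, 0 < z.1 ->
         sg * ((- f p - sg * e + N z) * E z + (p - U z) * Q z) <= - c0) ->
  excluded sg w f P.
Proof.
move=> sg2 cert sigma tau C sg0 tau0 C0; have [B [c0 [c00 H]]] := cert _ sg0.
pose D := 16 * `|B| * C + 1.
have D0 : 0 < D by rewrite ltr_wpDl// !mulr_ge0// ltW.
pose rho := Num.min (tau / 4) (c0 / D).
have r0 : 0 < rho by rewrite lt_min !divr_gt0.
have rt : 4 * rho <= tau.
  have : rho <= tau / 4 by rewrite ge_min lexx.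
  lra.
have rB : 16 * `|B| * C * rho <= c0.
  have h : rho * D <= c0 by rewrite -ler_pdivlMr// ge_min lexx orbT.
  have : 0 <= 16 * `|B| * C by rewrite !mulr_ge0// ltW.
  by move: h; rewrite /D mulrDr mulr1 mulrC; lra.
exists (C * rho ^+ 2 / 4); first by rewrite !mulr_gt0// exprn_gt0.
move=> t0 x0 p e Pp se tt T; have [E [Q [[mE mQ bE bQ dis] field]]] := H p e Pp se.
have bE' z : `|E z| <= `|B| := le_trans (bE z) (ler_norm B).
have bQ' z : `|Q z| <= `|B| := le_trans (bQ z) (ler_norm B).
have Cr : 0 < C * rho ^+ 2 by rewrite mulr_gt0// exprn_gt0.
have g0 : 0 < C * rho ^+ 2 / 4 by rewrite divr_gt0.
have gr : 2 * (C * rho ^+ 2 / 4) < C * rho ^+ 2 by move: Cr; move: (C * _) => u; lra.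
exact: (no_touching mU mN mu0 bU bN bu0 U_neg N_neg weakU mE mQ bE' bQ' dis sg2 C0 c00 tt
  g0 r0 gr rt rB field T).
Qed.

End Certificates.

(** * Chords and tangents of the flux *)

Section Flux.
Context {R : realType}.

Lemma is_derive_continuous (a b : R -> R) : (forall x : R, is_derive x 1 a (b x)) -> continuous a.
Proof.
move=> da x; apply: differentiable_continuous; apply/derivable1_diffP.
exact: (@ex_derive _ _ _ _ _ _ _ (da x)).
Qed.

Lemma mvt (f g : R -> R) a b : (forall x : R, is_derive x 1 f (g x)) -> a < b ->
  exists2 c, a < c < b & f b - f a = g c * (b - a).
Proof.
move=> df ab; have cf : {within `[a, b], continuous f}.
  apply: derivable_within_continuous => x _; exact: (@ex_derive _ _ _ _ _ _ _ (df x)).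
by have [c] := MVT ab (fun x _ => df x) cf; rewrite in_itv/= => cab ->; exists c.
Qed.

Lemma above_tangent (f g h : R -> R) a b : (forall x : R, is_derive x 1 f (g x)) ->
  (forall x : R, is_derive x 1 g (h x)) ->
  (forall c, a < c < b \/ b < c < a -> 0 <= h c) -> f a + g a * (b - a) <= f b.
Proof.
move=> df dg h0; have [ab|ba|->] := ltgtP a b; last by rewrite subrr mulr0 addr0.
- have [c /andP[ac cb] fc] := mvt df ab; have [d /andP[ad dc] gd] := mvt dg ac.
  rewrite -lerBrDl fc ler_wpM2r ?subr_ge0 ?(ltW ab)// -subr_ge0 gd mulr_ge0 ?subr_ge0 ?(ltW ac)//.
  by apply: h0; left; rewrite ad (lt_trans dc cb).
- have [c /andP[bc ca] fc] := mvt df ba; have [d /andP[cd da] gd] := mvt dg ca.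
  have : 0 <= h d * (a - c) * (a - b).
    rewrite !mulr_ge0 ?subr_ge0 ?(ltW ba) ?(ltW ca)//.
    by apply: h0; right; rewrite da (lt_trans bc cd).
  by rewrite -gd mulrBl -fc; lra.
Qed.

Section concave_convex.
Variables f g h : R -> R.
Hypothesis df : forall x : R, is_derive x 1 f (g x).
Hypothesis dg : forall x : R, is_derive x 1 g (h x).
Hypothesis inflection : forall x, x != 0 -> 0 < x * h x.

Lemma flux_convex a b : 0 <= a -> 0 <= b -> f a + g a * (b - a) <= f b.
Proof.
move=> a0 b0; apply: above_tangent df dg _ => c hc.
have c0 : 0 < c by case: hc => /andP[h1 h2]; lra.
by have := inflection (lt0r_neq0 c0); rewrite pmulr_rgt0// => /ltW.
Qed.

Lemma flux_concave a b : a <= 0 -> b <= 0 -> f b <= f a + g a * (b - a).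
Proof.
move=> a0 b0; rewrite -lerN2 opprD -mulNr.
apply: (@above_tangent (fun x => - f x) (fun x => - g x) (fun x => - h x)).
move=> c hc; have c0 : c < 0 by case: hc => /andP[h1 h2]; lra.
by have := inflection (ltr0_neq0 c0); rewrite nmulr_rgt0// -oppr_gt0 => /ltW.
Qed.

Lemma derive_flux_increasing a b : 0 <= a -> a < b -> g a < g b.
Proof.
move=> a0 ab; have [c /andP[ac cb] gc] := mvt dg ab.
have c0 : 0 < c by lra.
rewrite -subr_gt0 gc mulr_gt0 ?subr_gt0//.
by have := inflection (lt0r_neq0 c0); rewrite pmulr_rgt0.
Qed.

Lemma derive_flux_decreasing a b : a <= b -> b <= 0 -> g b <= g a.
Proof.
rewrite le_eqVlt => /predU1P[->//|ab] b0; have [c /andP[ac cb] gc] := mvt dg ab.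
have c0 : c < 0 by lra.
rewrite -subr_le0 gc nmulr_rle0 ?subr_ge0 ?(ltW ab)//.
by have := inflection (ltr0_neq0 c0); rewrite nmulr_rgt0.
Qed.

(** On [0, +oo) the derivative increases strictly, so a tangent at a point of this half-line meets
    the graph over it nowhere else. *)
Lemma tangent_point_lt0 b v : 0 < b -> v != b -> g v = (f b - f v) / (b - v) -> v < 0.
Proof.
move=> b0 vb gv; rewrite ltNge; apply/negP => v0.
have bv : b - v != 0 by rewrite subr_eq0 eq_sym.
have E : f b - f v = g v * (b - v) by rewrite gv mulfVK.
have [vb'|bv'|eb] := ltgtP v b; last by rewrite eb eqxx in vb.
- have [c /andP[vc cb] fc] := mvt df vb'.
  have := derive_flux_increasing v0 vc; rewrite -(ltr_pM2r (x := b - v)) ?subr_gt0//.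
  by rewrite -fc E ltxx.
- have [c /andP[bc cv] fc] := mvt df bv'.
  have c0 : 0 <= c by lra.
  have := derive_flux_increasing c0 cv; rewrite -(ltr_pM2r (x := v - b)) ?subr_gt0//.
  by rewrite -fc -(opprB b v) mulrN -E opprB ltxx.
Qed.

Lemma convex_chord (u w p : R) : 0 <= u -> u <= w -> w <= p ->
  (p - u) * f w <= (p - w) * f u + (w - u) * f p.
Proof.
move=> u0 uw wp; have w0 := le_trans u0 uw; have p0 := le_trans w0 wp.
have h1 := flux_convex w0 u0; have h2 := flux_convex w0 p0.
have k1 : (p - w) * (f w + g w * (u - w)) <= (p - w) * f u by rewrite ler_wpM2l// subr_ge0.
have k2 : (w - u) * (f w + g w * (p - w)) <= (w - u) * f p by rewrite ler_wpM2l// subr_ge0.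
apply: le_trans (lerD k1 k2); rewrite le_eqVlt; apply/orP; left; apply/eqP; ring.
Qed.

Variables b k : R.
Hypothesis b0 : 0 < b.
Hypothesis k0 : k <= 0.
Hypothesis tangent : k < 0 -> f b - f k = g k * (b - k).

(* The tangent at k meets the graph again at b, hence stays below it beyond b; for
   k <= u < 0 the tangent at u lies below the one at k on the right of u. *)
Lemma below_tangent (u p : R) : k <= u -> u < 0 -> b <= p -> f u + g u * (p - u) <= f p.
Proof.
move=> ku u0 bp; have k0' := le_lt_trans ku u0; have E := tangent k0'.
have gk : g k <= g b.
  have h1 := flux_concave k0 (lexx 0); have h2 := flux_convex (ltW b0) (lexx 0).
  have : g k * b <= g b * b by move: h1 h2 E; lra.
  by rewrite ler_pM2r.
have p0 : 0 <= p := le_trans (ltW b0) bp.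
have h3 := flux_convex (ltW b0) p0.
have h4 : g k * (p - b) <= g b * (p - b) by rewrite ler_wpM2r// subr_ge0.
have h5 := flux_concave k0 (ltW u0).
have h6 : g u * (p - u) <= g k * (p - u).
  by rewrite ler_wpM2r ?derive_flux_decreasing ?(ltW u0)//; lra.
by move: h3 h4 h5 h6 E; lra.
Qed.

(** For u >= 0 this is convexity. For u < 0, on [u, 0] concavity puts f below its tangent at u,
    which lies below the chord because it passes below (p, f p). On [0, p] convexity interpolates
    between 0, where the inequality has just been obtained, and p. *)
Lemma below_chord (u w p : R) : k <= u -> b <= p -> u <= w -> w <= p ->
  (p - u) * f w <= (p - w) * f u + (w - u) * f p.
Proof.
move=> ku bp uw wp; have [u0|u0] := leP 0 u; first exact: convex_chord.
have T := below_tangent ku u0 bp.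
have low (z : R) : u <= z -> z <= 0 -> (p - u) * f z <= (p - z) * f u + (z - u) * f p.
  move=> uz z0; have h1 := flux_concave (ltW u0) z0; have pu : 0 <= p - u by lra.
  have k1 : (p - u) * f z <= (p - u) * (f u + g u * (z - u)) by rewrite ler_wpM2l.
  have k2 : (z - u) * (f u + g u * (p - u)) <= (z - u) * f p by rewrite ler_wpM2l ?subr_ge0.
  apply: le_trans k1 _; move: k2; move: (f u) (g u) (f p) => x y t k2.
  rewrite -subr_ge0 [X in 0 <= X](_ : _ = (z - u) * t - (z - u) * (x + y * (p - u))) ?subr_ge0//.
  by ring.
have [w0|w0] := leP w 0; first exact: low.
have p0 : 0 < p by lra.
have h1 := convex_chord (lexx 0) (ltW w0) wp; rewrite !subr0 in h1.
have h2 := low 0 (ltW u0) (lexx 0); rewrite subr0 sub0r in h2.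
have k1 : (p - u) * (p * f w) <= (p - u) * ((p - w) * f 0 + w * f p).
  by rewrite ler_wpM2l//; lra.
have k2 : (p - w) * ((p - u) * f 0) <= (p - w) * (p * f u + - u * f p).
  by rewrite ler_wpM2l//; lra.
rewrite -(ler_pM2l p0); move: k1 k2; move: (f w) (f 0) (f u) (f p) => x y z t k1 k2.
have E : p * ((p - w) * z + (w - u) * t) - p * ((p - u) * x) =
  ((p - w) * (p * z + - u * t) - (p - w) * ((p - u) * y)) +
  ((p - u) * ((p - w) * y + w * t) - (p - u) * (p * x)) by ring.
by rewrite -subr_ge0 E addr_ge0// subr_ge0.
Qed.

(** For u < 0, the value f 0 is above the tangent at p by convexity and below the chord from u to p;
    extending the line from p through (0, f 0) back to u shows that f u is above the tangent too. *)
Lemma tangent_at_right (u p : R) : k <= u -> b <= p -> f p + g p * (u - p) <= f u.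
Proof.
move=> ku bp; have p0 : 0 < p := lt_le_trans b0 bp.
have [u0|u0] := leP 0 u; first exact: flux_convex (ltW p0) u0.
have h1 := below_chord ku bp (ltW u0) (ltW p0); rewrite subr0 sub0r in h1.
have h2 := flux_convex (ltW p0) (lexx 0); rewrite sub0r in h2.
have k1 : (p - u) * (f p + g p * - p) <= (p - u) * f 0 by rewrite ler_wpM2l//; lra.
have pu : 0 < p - u by lra.
rewrite -(ler_pM2l p0); move: h1 k1; move: (f 0) (f u) (f p) (g p) => x y z t h1 k1.
have E : p * y - p * (z + t * (u - p)) = (p * y + - u * z - (p - u) * x) +
  ((p - u) * x - (p - u) * (z + t * - p)) by ring.
by rewrite -subr_ge0 E addr_ge0// subr_ge0.
Qed.

Section entropy.
Variables (eta e1 e2 q : R -> R).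
Hypothesis deta : forall x : R, is_derive x 1 eta (e1 x).
Hypothesis de1 : forall x : R, is_derive x 1 e1 (e2 x).
Hypothesis e2_gt0 : forall x, 0 < e2 x.
Hypothesis dq : forall x : R, is_derive x 1 q (e1 x * g x).

(* As a function of its second end point, the left-hand side is, up to a term vanishing at
   both ends, a primitive of e2 times the defect of f below its chord. *)
Lemma entropy_defect_ge0 (u p : R) : k <= u -> b <= p ->
  0 <= (u - p) * (q u - q p) - (f u - f p) * (eta u - eta p).
Proof.
move=> ku bp; pose d := u - p; pose s := f u - f p.
pose B w := d * (f w - f p) - s * (w - p).
pose A w := d * q w - s * eta w - e1 w * B w.
have dB (w : R) : is_derive w 1 B (d * g w - s).
  have D := is_deriveB (is_deriveZ d (is_deriveB (df w) (is_derive_cst (f p) w 1)))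
    (is_deriveZ s (is_deriveB (is_derive_id w 1) (is_derive_cst p w 1))).
  by apply: (is_derive_eq D); rewrite !subr0 /GRing.scale/= mulr1.
have dA (w : R) : is_derive w 1 A (- e2 w * B w).
  have D := is_deriveB (is_deriveB (is_deriveZ d (dq w)) (is_deriveZ s (deta w)))
    (is_deriveM (de1 w) (dB w)).
  by apply: (is_derive_eq D); rewrite /GRing.scale/=; ring.
have -> : d * (q u - q p) - s * (eta u - eta p) = A u - A p.
  by rewrite /A /B /d /s; ring.
have [up|pu|->] := ltgtP u p; last by rewrite subrr.
- have [c /andP[uc cp] Ac] := mvt dA up.
  rewrite -opprB Ac mulNr mulNr opprK mulr_ge0 ?subr_ge0 ?(ltW up)// mulr_ge0 ?(ltW (e2_gt0 _))//.
  have := below_chord ku bp (ltW uc) (ltW cp); rewrite /B /d /s; lra.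
- have [c /andP[pc cu] Ac] := mvt dA pu.
  rewrite Ac mulr_ge0 ?subr_ge0 ?(ltW pu)// mulNr -mulrN mulr_ge0 ?(ltW (e2_gt0 _))//.
  have p0 : 0 <= p := le_trans (ltW b0) bp.
  have := convex_chord p0 (ltW pc) (ltW cu); rewrite /B /d /s; lra.
Qed.

End entropy.
End concave_convex.

End Flux.

(** * Uniform constants on bounded ranges and the entropy estimate *)

Section Slopes.
Context {R : realType}.

Local Notation mm := (@lebesgue_measure R \x @lebesgue_measure R)%E.
Local Notation I g := (Rintegral (@lebesgue_measure R) setT g).
Local Notation II Z := (Rintegral mm setT Z).

Lemma bounded_on_seg (g : R -> R) Z : continuous g ->
  exists2 B, 0 < B & forall x, `|x| <= Z -> `|g x| <= B.
Proof.
move=> cg; have cI : compact (g @` `[- Z, Z]%classic).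
  by apply: continuous_compact; [exact: continuous_subspaceT|exact: segment_compact].
have [B [_ HB]] := compact_bounded cI; exists (`|B| + 1); first by rewrite ltr_wpDl.
move=> x xZ; apply: HB; first by rewrite (le_lt_trans (ler_norm _))// ltrDl.
by exists x => //=; rewrite in_itv/= -ler_norml.
Qed.

Lemma positive_on_seg (g : R -> R) Z : 0 <= Z -> continuous g -> (forall x, 0 < g x) ->
  exists2 m, 0 < m & forall x, `|x| <= Z -> m <= g x.
Proof.
move=> Z0 cg g0; have ZZ : - Z <= Z by lra.
have [c _ Hc] := EVT_min ZZ (continuous_subspaceT cg).
by exists (g c) => // x xZ; apply: Hc; rewrite in_itv/= -ler_norml.
Qed.

Lemma lipschitz_on_seg (f g : R -> R) Z B u p : (forall x : R, is_derive x 1 f (g x)) ->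
  (forall x, `|x| <= Z -> `|g x| <= B) -> `|u| <= Z -> `|p| <= Z ->
  `|f u - f p| <= B * `|u - p|.
Proof.
move=> df gB uZ pZ; wlog up : u p uZ pZ / u <= p.
  move=> H; have [up|/ltW pu] := leP u p; first exact: H.
  by rewrite distrC (distrC u); exact: H.
move: up; rewrite le_eqVlt => /predU1P[->|up]; first by rewrite !subrr normr0 mulr0.
have [c /andP[uc cp] E] := mvt df up.
rewrite distrC E (distrC u) normrM ler_wpM2r//; apply: gB.
by move: uZ pZ; rewrite !ler_norml; lra.
Qed.

(** Subtracting m / 2 x ^ 2 from eta leaves a function that is convex on the segment between u and
    p. *)
Lemma strong_convexity (eta e1 e2 : R -> R) Z m u p :
  (forall x : R, is_derive x 1 eta (e1 x)) -> (forall x : R, is_derive x 1 e1 (e2 x)) ->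
  (forall x, `|x| <= Z -> m <= e2 x) -> `|u| <= Z -> `|p| <= Z ->
  m / 2 * (u - p) ^+ 2 <= eta u - eta p - e1 p * (u - p).
Proof.
move=> deta de1 e2m uZ pZ.
pose F x := eta x - m / 2 * (x * x); pose G x := e1 x - m * x.
have dF (x : R) : is_derive x 1 F (G x).
  have D := is_deriveB (deta x)
    (is_deriveZ (m / 2) (is_deriveM (is_derive_id x 1) (is_derive_id x 1))).
  by apply: (is_derive_eq D); rewrite /G /GRing.scale/=; field.
have dG (x : R) : is_derive x 1 G (e2 x - m).
  have D := is_deriveB (de1 x) (is_deriveZ m (is_derive_id x 1)).
  by apply: (is_derive_eq D); rewrite /GRing.scale/= mulr1.
have := above_tangent (a := p) (b := u) dF dG; rewrite /F /G => H.
suff /H : forall c, p < c < u \/ u < c < p -> 0 <= e2 c - m by lra.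
move=> c hc; rewrite subr_ge0 e2m// ler_norml; move: uZ pZ; rewrite !ler_norml.
by case: hc => /andP[]; lra.
Qed.

(** Here i = 1 / e, and d, df, de, dq are differences between u and p. The left-hand side equals - i
    (d dq - df de) - (de - e1 d) + c df - c e. The first term is nonpositive by the chord
    inequality; strong convexity absorbs c l |d| up to c e / 2 as soon as c l ^ 2 <= m e. *)
Lemma entropy_field_le (e i c m l d df de dq e1 : R) : e * i = 1 -> 0 < e -> 0 < m ->
  0 <= c -> 0 <= d * dq - df * de -> m / 2 * d ^+ 2 <= de - e1 * d -> `|df| <= l * `|d| ->
  c * l ^+ 2 <= m * e -> (df - e) * (i * de + c) - d * (i * dq - e1) <= - (c * e / 2).
Proof.
move=> ei e0 m0 c0 F cvx lip cl.
have i0 : 0 < i by rewrite -(pmulr_rgt0 _ e0) ei.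
have E : (df - e) * (i * de + c) - d * (i * dq - e1) =
    - (i * (d * dq - df * de)) - (e * i) * (de - e1 * d) + c * df - c * e +
    (e * i - 1) * (- e1 * d) by ring.
rewrite E ei subrr mul0r addr0 mul1r.
have h1 := mulr_ge0 (ltW i0) F.
have h2 : c * df <= c * (l * `|d|) by rewrite ler_wpM2l// (le_trans (ler_norm _)).
have h3 : c * (l * `|d|) <= m / 2 * d ^+ 2 + c * e / 2.
  rewrite -(ler_pM2l m0) -(real_normK (num_real d)).
  have h4 := sqr_ge0 (m * `|d| - c * l); have h5 := ler_wpM2l c0 cl.
  have E1 : m * (m / 2 * `|d| ^+ 2 + c * e / 2) - m * (c * (l * `|d|)) =
    ((m * `|d| - c * l) ^+ 2 + (c * (m * e) - c * (c * l ^+ 2))) / 2 by field.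
  by rewrite -subr_ge0 E1 divr_ge0// addr_ge0// subr_ge0.
move: h1 h2 h3 cvx; move: (i * _) (c * df) (c * (l * _)) (m / 2 * _) (c * e) => x y z t s.
lra.
Qed.

End Slopes.

(** * Certificates from tangents, from the Kruzkov pair and from the convex entropy *)

Section Exclusions.
Context {R : realType}.

Lemma measurable_sgr d (T : measurableType d) (F : T -> R) :
  measurable_fun setT F -> measurable_fun setT (fun x => Num.sg (F x)).
Proof.
move=> mF; rewrite (_ : (fun x => _) = (fun x : T => (0 < F x)%R%:R - (F x < 0)%R%:R)).
  by apply: measurable_funB; apply: measurable_ltn => //; exact: measurable_cst.
by apply/funext => x; case: sgrP => _; rewrite ?subrr ?subr0 ?sub0r.
Qed.

Local Notation mm := (@lebesgue_measure R \x @lebesgue_measure R)%E.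
Local Notation I g := (Rintegral (@lebesgue_measure R) setT g).
Local Notation II Z := (Rintegral mm setT Z).

Variables (U N : R * R -> R) (u0 : R -> R) (M L : R).
Hypothesis mU : measurable_fun setT U.
Hypothesis mN : measurable_fun setT N.
Hypothesis mu0 : measurable_fun setT u0.
Hypothesis bU : forall p, `|U p| <= M.
Hypothesis bN : forall p, `|N p| <= L.
Hypothesis bu0 : forall x, `|u0 x| <= M.
Hypothesis U_neg : forall p, p.1 <= 0 -> U p = 0.
Hypothesis N_neg : forall p, p.1 <= 0 -> N p = 0.
Hypothesis weakU : forall phi, test_function phi ->
  II (fun p => U p * dt phi p + N p * dx phi p) + I (fun x => u0 x * phi (0, x)) = 0.

Let w := potential N u0.

Variables (f g : R -> R) (Z : R).
Hypothesis df : forall x : R, is_derive x 1 f (g x).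
Hypothesis cg : continuous g.
Hypothesis NE : forall p, (0 : R) < p.1 -> N p = f (U p).
Hypothesis MZ : M <= Z.

Let M0 : 0 <= M. Proof. exact: le_trans (normr_ge0 _) (bu0 0). Qed.
Let Z0 : 0 <= Z. Proof. exact: le_trans M0 MZ. Qed.
Let UZ p : `|U p| <= Z. Proof. exact: le_trans (bU p) MZ. Qed.

Let measurable_compU (a : R -> R) : continuous a -> measurable_fun setT (fun p => a (U p)).
Proof.
by move=> ca; apply: (measurableT_comp _ mU); exact: continuous_measurable_fun.
Qed.

(** With E = 1 and Q = g p the expression is - e minus the height of f above its tangent at p. *)
Lemma excluded_above (P : set R) : (forall p, P p -> `|p| <= Z) ->
  (forall p z, P p -> 0 < z.1 -> f p + g p * (U z - p) <= f (U z)) -> excluded (-1) w f P.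
Proof.
move=> PZ tangent; apply: (excluded_of_certificate mU mN mu0 bU bN bu0 U_neg N_neg weakU).
  by rewrite mulrNN mul1r.
move=> sigma sg0; have [B B0 HB] := bounded_on_seg Z cg.
exists (1 + B), sigma; split => // p e Pp se; exists (cst 1), (cst (g p)); split.
  split; [exact: measurable_cst|exact: measurable_cst| | |exact: dissipative_cst].
  - by move=> z; rewrite normr1 lerDl ltW.
  - by move=> z; apply: le_trans (HB _ (PZ _ Pp)) _; rewrite lerDr.
move=> z z0; rewrite NE//; have := tangent p z Pp z0; rewrite /=.
by move: (f (U z)) (U z) => x y; lra.
Qed.

(** The pair is divided by e and 1 / l is added to E, with l a Lipschitz constant of f. After
    cancellation there remains (f U - f k) / l - sg |U - k| - sg e / l; multiplied by sg, the first
    term is at most |U - k|, whichever the sign. *)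
Lemma excluded_kruzkov sg k : sg = 1 \/ sg = -1 -> `|k| <= Z ->
  dissipative (fun p => `|U p - k|) (fun p => Num.sg (U p - k) * (f (U p) - f k)) ->
  excluded sg w f [set k].
Proof.
move=> sgE kZ dis; apply: (excluded_of_certificate mU mN mu0 bU bN bu0 U_neg N_neg weakU).
  by case: sgE => ->; rewrite ?mulrNN mul1r.
move=> sigma sg0; have [l l0 Hl] := bounded_on_seg Z cg.
have lip p := lipschitz_on_seg df Hl (UZ p) kZ.
pose D : R := (1 + l) * (2 * Z).
have bX p : `|(`|U p - k|)| <= D.
  rewrite normr_id; apply: le_trans (ler_normB _ _) _; rewrite /D.
  by have := UZ p; have := mulr_ge0 (ltW l0) Z0; move: kZ; lra.
have bY p : `|Num.sg (U p - k) * (f (U p) - f k)| <= D.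
  rewrite normrM; apply: (@le_trans _ _ (`|f (U p) - f k|)).
    by rewrite ler_piMl// normr_sg; case: (_ != _).
  apply: le_trans (lip p) _; rewrite /D mulrDl mul1r.
  have h : `|U p - k| <= 2 * Z.
    by apply: le_trans (ler_normB _ _) _; have := UZ p; move: kZ; lra.
  by have := ler_wpM2l (ltW l0) h; have := Z0; lra.
have mX : measurable_fun setT (fun p => `|U p - k|).
  by apply: measurableT_comp => //; exact: measurable_funB.
have mY : measurable_fun setT (fun p => Num.sg (U p - k) * (f (U p) - f k)).
  apply: measurable_funM; last first.
    by apply: measurable_funB => //; apply: measurable_compU; exact: is_derive_continuous df.
  by apply: measurable_sgr; exact: measurable_funB.
exists (D / sigma + l^-1), (l^-1 * sigma); split; first by rewrite mulr_gt0 ?invr_gt0.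
move=> p e /= -> se; have e0 := lt_le_trans sg0 se.
exists (fun z => e^-1 * `|U z - k| + l^-1),
  (fun z => e^-1 * (Num.sg (U z - k) * (f (U z) - f k)) + 0).
have bound X c : `|X| <= D -> 0 <= c -> c <= l^-1 -> `|e^-1 * X + c| <= D / sigma + l^-1.
  move=> XD c0 cl; apply: le_trans (ler_normD _ _) _; rewrite (ger0_norm c0) lerD//.
  have ie : 0 <= e^-1 by rewrite invr_ge0 ltW.
  rewrite normrM (ger0_norm ie) mulrC ler_pM//.
  by rewrite lef_pV2 ?posrE.
split.
  split.
  - by apply: measurable_funD => //; exact: measurable_funM.
  - by apply: measurable_funD => //; exact: measurable_funM.
  - by move=> z; apply: bound; rewrite ?invr_ge0 ?(ltW l0).
  - by move=> z; apply: bound; rewrite ?invr_ge0 ?(ltW l0).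
  - have ie : 0 <= e^-1 by rewrite invr_ge0 ltW.
    exact: (dissipative_affine _ _ ie mX mY bX bY dis).
move=> z z0; rewrite NE// addr0.
have h1 : `|f (U z) - f k| <= l * `|U z - k| := lip z.
have ei : e * e^-1 = 1 by rewrite mulfV// gt_eqF.
have li : l * l^-1 = 1 by rewrite mulfV// gt_eqF.
have i0 : 0 < l^-1 by rewrite invr_gt0.
have dE : (U z - k) * Num.sg (U z - k) = `|U z - k| by rewrite mulrC -normrEsg.
have h2 : `|l^-1 * (f (U z) - f k)| <= `|U z - k|.
  by rewrite normrM gtr0_norm// -(ler_pM2l l0) mulrA li mul1r.
have h3 : l^-1 * sigma <= l^-1 * e by rewrite ler_pM2l.
move: dE h2 h3; rewrite ler_norml => dE /andP[h2 h2'] h3.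
have E : (- f k - sg * e + f (U z)) * (e^-1 * `|U z - k| + l^-1) +
    (k - U z) * (e^-1 * (Num.sg (U z - k) * (f (U z) - f k))) =
    l^-1 * (f (U z) - f k) - sg * (e * e^-1) * `|U z - k| - sg * (l^-1 * e)
    + e^-1 * (f (U z) - f k) * (`|U z - k| - (U z - k) * Num.sg (U z - k)) by ring.
rewrite E dE subrr mulr0 addr0 ei; move: h2 h2' h3.
by move: (l^-1 * (_ - _)) (`|_|) (l^-1 * sigma) (l^-1 * e) => x y s t; case: sgE => ->; lra.
Qed.

Variables (eta e1 e2 q : R -> R).
Hypothesis deta : forall x : R, is_derive x 1 eta (e1 x).
Hypothesis de1 : forall x : R, is_derive x 1 e1 (e2 x).
Hypothesis ce2 : continuous e2.
Hypothesis e2_gt0 : forall x, 0 < e2 x.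
Hypothesis dq : forall x : R, is_derive x 1 q (e1 x * g x).

(** The certificate is E = (eta U - eta p) / e + c and Q = (q U - q p) / e - e1 p. The constant in Q
    supplies the linear term that completes eta U - eta p to a strongly convex remainder. *)
Lemma excluded_below (P : set R) : (forall p, P p -> `|p| <= Z) ->
  (forall p z, P p -> 0 < z.1 ->
    0 <= (U z - p) * (q (U z) - q p) - (f (U z) - f p) * (eta (U z) - eta p)) ->
  dissipative (fun p => eta (U p)) (fun p => q (U p)) -> excluded 1 w f P.
Proof.
move=> PZ defect dis; apply: (excluded_of_certificate mU mN mu0 bU bN bu0 U_neg N_neg weakU).
  by rewrite mul1r.
have ceta := is_derive_continuous deta; have ce1 := is_derive_continuous de1.
have cq := is_derive_continuous dq.
move=> sigma sg0; have [l l0 Hl] := bounded_on_seg Z cg.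
have [Be Be0 HBe] := bounded_on_seg Z ceta; have [Bq Bq0 HBq] := bounded_on_seg Z cq.
have [B1 B10 HB1] := bounded_on_seg Z ce1; have [m m0 Hm] := positive_on_seg Z0 ce2 e2_gt0.
(* The largest c with c l ^ 2 <= m e for every e >= sigma. *)
pose c := m * sigma / l ^+ 2; have l20 : 0 < l ^+ 2 by rewrite exprn_gt0.
have c0 : 0 < c by rewrite divr_gt0// mulr_gt0.
have cl : c * l ^+ 2 = m * sigma by rewrite /c mulfVK// gt_eqF.
pose B := (Be + Bq) / sigma.
exists (2 * B + c + B1), (c * sigma / 2); split; first by rewrite divr_gt0// mulr_gt0.
move=> p e Pp se; have e0 := lt_le_trans sg0 se.
have inv X : `|X| <= Be + Bq -> `|e^-1 * X| <= B.
  have ie : 0 <= e^-1 by rewrite invr_ge0 ltW.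
  move=> XB; rewrite normrM (ger0_norm ie) mulrC ler_pM//.
  by rewrite lef_pV2 ?posrE.
have be x : `|x| <= Z -> `|eta x| <= Be + Bq.
  by move=> /HBe h; apply: le_trans h _; rewrite lerDl ltW.
have bq x : `|x| <= Z -> `|q x| <= Be + Bq.
  by move=> /HBq h; apply: le_trans h _; rewrite lerDr ltW.
exists (fun z => e^-1 * eta (U z) + (c - e^-1 * eta p)),
  (fun z => e^-1 * q (U z) + (- (e^-1 * q p) - e1 p)); split.
  split.
  - by apply: measurable_funD => //; apply: measurable_funM => //; exact: measurable_compU.
  - by apply: measurable_funD => //; apply: measurable_funM => //; exact: measurable_compU.
  - move=> z; have := inv _ (be _ (UZ z)); have := inv _ (be _ (PZ _ Pp)).
    rewrite !ler_norml; move: (e^-1 * _) (e^-1 * _) => x y; lra.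
  - move=> z; have := inv _ (bq _ (UZ z)); have := inv _ (bq _ (PZ _ Pp)); have := HB1 _ (PZ _ Pp).
    rewrite !ler_norml; move: (e^-1 * _) (e^-1 * _) => x y; lra.
  - have ie : 0 <= e^-1 by rewrite invr_ge0 ltW.
    exact: (dissipative_affine _ _ ie (measurable_compU ceta) (measurable_compU cq)
      (fun z => be _ (UZ z)) (fun z => bq _ (UZ z)) dis).
move=> z z0; rewrite NE// !mul1r.
have ei : e * e^-1 = 1 by rewrite mulfV// gt_eqF.
have cle : c * l ^+ 2 <= m * e by rewrite cl ler_pM2l.
have := entropy_field_le ei e0 m0 (ltW c0) (defect p z Pp z0)
  (strong_convexity deta de1 Hm (UZ z) (PZ _ Pp)) (lipschitz_on_seg df Hl (UZ z) (PZ _ Pp)) cle.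
rewrite (_ : (- f p - e + f (U z)) * _ + _ = (f (U z) - f p - e) *
  (e^-1 * (eta (U z) - eta p) + c) - (U z - p) * (e^-1 * (q (U z) - q p) - e1 p)); last by ring.
move=> /le_trans; apply; rewrite lerN2 ler_pM2r ?ler_pM2l//.
Qed.

End Exclusions.

(** * Recovering a solution from its potential *)

Section Recovery.
Context {R : realType}.

Local Notation mu := (@lebesgue_measure R).
Local Notation mm := (@lebesgue_measure R \x @lebesgue_measure R)%E.
Local Notation I g := (Rintegral (@lebesgue_measure R) setT g).
Local Notation II Z := (Rintegral mm setT Z).

Lemma potential_at0 (N N' : R * R -> R) (u0 : R -> R) x : (forall p, p.1 <= 0 -> N p = 0) ->
  (forall p, p.1 <= 0 -> N' p = 0) -> potential N u0 (0, x) = potential N' u0 (0, x).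
Proof.
move=> n1 n2; rewrite /potential; congr (lim (_ @ \oo)); apply/funext => n.
rewrite /potential_n; apply: (congr1 (fun z => _ - z)).
by apply: eq_Rintegral => y _; rewrite !flux_integral_neg.
Qed.

Variables (U N : R * R -> R) (u0 : R -> R) (M L : R).
Hypothesis mU : measurable_fun setT U.
Hypothesis mN : measurable_fun setT N.
Hypothesis mu0 : measurable_fun setT u0.
Hypothesis bU : forall p, `|U p| <= M.
Hypothesis bN : forall p, `|N p| <= L.
Hypothesis bu0 : forall x, `|u0 x| <= M.
Hypothesis U_neg : forall p, p.1 <= 0 -> U p = 0.
Hypothesis N_neg : forall p, p.1 <= 0 -> N p = 0.
Hypothesis weakU : forall phi, test_function phi ->
  II (fun p => U p * dt phi p + N p * dx phi p) + I (fun x => u0 x * phi (0, x)) = 0.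

Let w := potential N u0.

Lemma bounded_potential_increment (t1 t2 x1 x2 : R) : exists A B,
  bounded_on1 A B (fun t => (w (t, x2) - w (t, x1)) * (t1 <= t <= t2)%R%:R).
Proof.
have cw : continuous w := continuous_potential mU mN mu0 bU bN bu0 U_neg N_neg weakU.
have mw x : measurable_fun setT (fun t => w (t, x)).
  by apply: (measurableT_comp (continuous_plane_measurable cw)); exact: measurable_pair2.
exists (`|t1| + `|t2|), (1 * (M * `|x2 - x1|)).
rewrite (_ : (fun t => _) = (fun t => (t1 <= t <= t2)%R%:R * (w (t, x2) - w (t, x1)))); last first.
  by apply/funext => t; rewrite mulrC.
apply: bounded_on1_mul; [exact: bounded_itv_ind|exact: measurable_funB|move=> t].
have h := potential_lipschitz mU mN mu0 bU bN bu0 U_neg N_neg weakU (t, x2) (t, x1).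
by apply: le_trans h _; rewrite subrr normr0 mulr0 add0r.
Qed.

Lemma bounded_on2_rect C (Z : R * R -> R) t1 t2 x1 x2 : measurable_fun setT Z ->
  (forall p, `|Z p| <= C) ->
  exists A, bounded_on2 A C (fun p => Z p * rect_ind t1 t2 x1 x2 p).
Proof.
move=> mZ ZC; have [A HA] := bounded_rect_ind t1 t2 x1 x2; exists A.
rewrite (_ : (fun p => _) = (fun p => rect_ind t1 t2 x1 x2 p * Z p)); last first.
  by apply/funext => p; rewrite mulrC.
by rewrite -[C]mul1r; exact: bounded_on2_mul.
Qed.

(** By [rect_identity] the slope bound becomes a lower bound for the integral of U over every
    rectangle. *)
Lemma ae_ge_of_slope c :
  (forall t x y, 0 <= t -> x <= y -> c * (y - x) <= w (t, y) - w (t, x)) ->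
  {ae mm, forall p, 0 < p.1 -> c <= U p}.
Proof.
move=> slope; have mUc : measurable_fun setT (fun p => U p - c) by exact: measurable_funB.
have bUc p : `|U p - c| <= M + `|c| by apply: le_trans (ler_normB _ _) _; rewrite lerD2r.
suff : {ae mm, forall p, 0 < p.1 -> 0 <= U p - c}.
  by apply: ae_mono => p h /h; rewrite subr_ge0.
apply: (ae_ge0_of_rect mUc bUc) => t1 t2 x1 x2 t10 t12 x12.
have [A HA] := bounded_rect_ind t1 t2 x1 x2; have iR := bounded_integrable2 HA.
have [A' /bounded_integrable2 iU] := bounded_on2_rect t1 t2 x1 x2 mU bU.
have -> : II (fun p => (U p - c) * rect_ind t1 t2 x1 x2 p) =
    II (fun p => 1 * (U p * rect_ind t1 t2 x1 x2 p) + - c * rect_ind t1 t2 x1 x2 p).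
  by apply: eq_Rintegral => p _; ring.
rewrite Rintegral2_lincomb// mul1r Rintegral_rect_ind//.
rewrite (rect_identity mU mN mu0 bU bN bu0 U_neg N_neg weakU t10 t12 x12) -/w.
have [A1 [B1 /bounded_integrable1 iw]] := bounded_potential_increment t1 t2 x1 x2.
have i1 := bounded_integrable1 (bounded_itv_ind t1 t2).
have h t : setT t -> c * (x2 - x1) * (t1 <= t <= t2)%R%:R <=
    (w (t, x2) - w (t, x1)) * (t1 <= t <= t2)%R%:R.
  move=> _; case: (boolP (t1 <= t <= t2)) => [/andP[ht _]|]; last by rewrite !mulr0.
  by rewrite !mulr1; apply: slope; [exact: le_trans (ltW t10) ht|exact: ltW].
have := le_Rintegral measurableT (integrableZl measurableT (c * (x2 - x1)) i1) iw h.
rewrite RintegralZl// Rintegral_itv_cst//.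
by move: (I _) => J; rewrite -subr_ge0; congr (0 <= _); ring.
Qed.

Variables (V N' : R * R -> R).
Hypothesis mV : measurable_fun setT V.
Hypothesis mN' : measurable_fun setT N'.
Hypothesis bV : forall p, `|V p| <= M.
Hypothesis bN' : forall p, `|N' p| <= L.
Hypothesis V_neg : forall p, p.1 <= 0 -> V p = 0.
Hypothesis N'_neg : forall p, p.1 <= 0 -> N' p = 0.
Hypothesis weakV : forall phi, test_function phi ->
  II (fun p => V p * dt phi p + N' p * dx phi p) + I (fun x => u0 x * phi (0, x)) = 0.

(** Equal potentials have equal increments, so U and V have the same integral over every
    rectangle. *)
Lemma ae_le_of_potential : (forall t x, 0 <= t -> w (t, x) = potential N' u0 (t, x)) ->
  {ae mm, forall p, 0 < p.1 -> V p <= U p}.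
Proof.
move=> wE; have mUV : measurable_fun setT (fun p => U p - V p) by exact: measurable_funB.
have bUV p : `|U p - V p| <= M + M by apply: le_trans (ler_normB _ _) _; exact: lerD.
suff : {ae mm, forall p, 0 < p.1 -> 0 <= U p - V p}.
  by apply: ae_mono => p h /h; rewrite subr_ge0.
apply: (ae_ge0_of_rect mUV bUV) => t1 t2 x1 x2 t10 t12 x12.
have [A /bounded_integrable2 iU] := bounded_on2_rect t1 t2 x1 x2 mU bU.
have [A' /bounded_integrable2 iV] := bounded_on2_rect t1 t2 x1 x2 mV bV.
have -> : II (fun p => (U p - V p) * rect_ind t1 t2 x1 x2 p) =
    II (fun p => 1 * (U p * rect_ind t1 t2 x1 x2 p) + -1 * (V p * rect_ind t1 t2 x1 x2 p)).
  by apply: eq_Rintegral => p _; ring.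
rewrite Rintegral2_lincomb// mul1r mulN1r.
rewrite (rect_identity mU mN mu0 bU bN bu0 U_neg N_neg weakU t10 t12 x12) -/w.
rewrite (rect_identity mV mN' mu0 bV bN' bu0 V_neg N'_neg weakV t10 t12 x12).
rewrite subr_ge0 le_eqVlt; apply/orP; left; apply/eqP; apply: eq_Rintegral => t _.
have F (a b : R) (c : bool) : (c -> a = b) -> a * c%:R = b * c%:R.
  by case: c => [->//|_]; rewrite !mulr0.
apply: F => /andP[ht _]; have t0 : 0 <= t := le_trans (ltW t10) ht.
exact: (esym (congr2 (fun a b => a - b) (wE t x2 t0) (wE t x1 t0))).
Qed.

End Recovery.

(** * Extension of a weak solution to the plane *)

Section Extension.
Context {R : realType}.

Local Notation mu := (@lebesgue_measure R).
Local Notation mm := (@lebesgue_measure R \x @lebesgue_measure R)%E.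
Local Notation I g := (Rintegral (@lebesgue_measure R) setT g).
Local Notation II Z := (Rintegral mm setT Z).

Lemma measurable_half_plane : measurable (@half_plane R).
Proof.
have m1 : measurable_fun setT (fun p : R * R => (0 < p.1)).
  by apply: measurable_fun_ltr; [exact: measurable_cst|exact: measurable_fst].
by have := m1 measurableT [set true]; rewrite setTI; apply.
Qed.

Lemma Rintegral_half_plane (g h : R * R -> R) : measurable_fun half_plane g ->
  measurable_fun setT h -> {ae mm, forall p, half_plane p -> g p = h p} ->
  (forall p, p.1 <= 0 -> h p = 0) -> Rintegral mm half_plane g = II h.
Proof.
move=> mg mh gh h0; have mH := measurable_half_plane.
have -> : II h = Rintegral mm half_plane h.
  rewrite [RHS]Rintegral_mkcond; apply: eq_Rintegral => p _; rewrite patchE.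
  case: ifPn => // /negP np; apply: h0; rewrite leNgt; apply/negP => p0; apply: np.
  by rewrite inE.
rewrite /Rintegral; congr fine; apply: ae_eq_integral => //.
- exact/measurable_EFinP.
- by apply/measurable_EFinP; exact: measurable_funTS.
- by apply: ae_mono gh => p gp hp; rewrite gp.
Qed.

Definition clip (a b x : R) : R := Num.max a (Num.min b x).

Lemma clip_itv a b x : a <= b -> a <= clip a b x <= b.
Proof. by move=> ab; rewrite /clip le_max lexx ge_max ab ge_min lexx. Qed.

Lemma clip_id a b x : a <= x -> x <= b -> clip a b x = x.
Proof. by move=> ax xb; rewrite /clip (min_idPr xb) (max_idPr ax). Qed.

Lemma measurable_clip d (T : measurableType d) a b (g : T -> R) :
  measurable_fun setT g -> measurable_fun setT (fun x => clip a b (g x)).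
Proof.
by move=> mg; apply: measurable_maxr => //; exact: measurable_minr.
Qed.

(** Clipping makes bounds that hold almost everywhere hold everywhere, and the value 0 up to time 0
    gives a function on the whole plane. The level a records the lower bound known so far: - M at
    first, then one involving [phi_nat f bl]. Under that bound the solution changes only on a null
    set. *)
Definition extend (a b : R) (u : R * R -> R) (p : R * R) : R :=
  if 0 < p.1 then clip a b (u p) else 0.

Definition extend_flux (f : R -> R) (U : R * R -> R) (p : R * R) : R :=
  if 0 < p.1 then f (U p) else 0.

Lemma measurable_extend a b u : measurable_fun half_plane u ->
  measurable_fun setT (extend a b u).
Proof.
move=> mu'; have mu1' := (measurable_restrictT _ measurable_half_plane).1 mu'.
rewrite (_ : extend a b u = (fun p => if 0 < p.1 then clip a b ((u \_ half_plane) p) else 0)).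
  apply: measurable_fun_ifT => //; last exact: measurable_clip.
  by apply: measurable_fun_ltr; [exact: measurable_cst|exact: measurable_fst].
by apply/funext => p; rewrite /extend patchE; case: ifPn => // p0; rewrite mem_set.
Qed.

Lemma measurable_extend_flux f U : continuous f -> measurable_fun setT U ->
  measurable_fun setT (extend_flux f U).
Proof.
move=> cf mU; apply: measurable_fun_ifT => //.
  by apply: measurable_fun_ltr; [exact: measurable_cst|exact: measurable_fst].
by apply: (measurableT_comp _ mU); exact: continuous_measurable_fun.
Qed.

Lemma extend_neg a b u p : p.1 <= 0 -> extend a b u p = 0.
Proof. by rewrite /extend ltNge => ->. Qed.

Lemma extend_flux_neg f U p : p.1 <= 0 -> extend_flux f U p = 0.
Proof. by rewrite /extend_flux ltNge => ->. Qed.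

Lemma extend_flux_pos f U p : 0 < p.1 -> extend_flux f U p = f (U p).
Proof. by rewrite /extend_flux => ->. Qed.

Lemma extend_itv a b u p : a <= 0 -> 0 <= b -> a <= extend a b u p <= b.
Proof.
move=> a0 b0; rewrite /extend; case: ifP => _; last by rewrite a0.
by apply: clip_itv; exact: le_trans b0.
Qed.

Lemma extend_bound a b u p : - b <= a -> a <= 0 -> 0 <= b -> `|extend a b u p| <= b.
Proof.
move=> ab a0 b0; have /andP[h1 h2] := extend_itv u p a0 b0.
by rewrite ler_norml h2 andbT (le_trans ab).
Qed.

Section solution.
Variables (M a bl bu : R) (f u0 : R -> R) (u : R * R -> R).
Hypothesis cf : continuous f.
Hypothesis mu0 : measurable_fun setT u0.
Hypothesis ru0 : {ae mu1, forall x, bl <= u0 x <= bu}.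
Hypothesis weak : weak_solution M f u0 u.
Hypothesis range : {ae mu2, forall p, half_plane p -> a <= u p}.

Let U := extend a M u.
Let N := extend_flux f U.

Lemma extendE : {ae mu2, forall p, half_plane p -> U p = u p}.
Proof.
have [_ r _] := weak.
apply: (ae_mono _ (@filterI _ _ (ae_filter_ringOfSetsType mu2) _ _ r range)).
move=> p [h1 h2] hp; rewrite /U /extend; have -> : 0 < p.1 by [].
by rewrite clip_id ?h2//; have /andP[] := h1 hp.
Qed.

Lemma weak_extend phi : test_function phi ->
  II (fun p => U p * dt phi p + N p * dx phi p) +
  I (fun x => clip bl bu (u0 x) * phi (0, x)) = 0.
Proof.
move=> tp; have [mu' _ /(_ phi tp)] := weak.
have [A [C [[mp _ _] [mt _ _] [mx _ _]]]] := test_function_bounded tp.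
have mU : measurable_fun setT U by exact: measurable_extend.
have mN : measurable_fun setT N by exact: measurable_extend_flux.
have E1 : \int[mu2]_(p in half_plane) (u p * dt phi p + f (u p) * dx phi p) =
    II (fun p => U p * dt phi p + N p * dx phi p).
  apply: Rintegral_half_plane.
  - apply: measurable_funD; apply: measurable_funM => //; try exact: measurable_funTS.
    by apply: measurableT_comp => //; exact: continuous_measurable_fun.
  - by apply: measurable_funD; exact: measurable_funM.
  - apply: ae_mono extendE => p Up hp; rewrite /N extend_flux_pos//.
    by rewrite (Up hp).
  - by move=> p p0; rewrite /U /N extend_neg// extend_flux_neg// !mul0r addr0.
have E2 : \int[mu1]_(x in setT) (u0 x * phi (0, x)) =
    I (fun x => clip bl bu (u0 x) * phi (0, x)).
  have m0 : measurable_fun setT (fun x : R => phi (0, x)).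
    by apply: (measurableT_comp mp); exact: measurable_pair1.
  rewrite /Rintegral; congr fine; apply: ae_eq_integral => //.
  - by apply/measurable_EFinP; exact: measurable_funM.
  - by apply/measurable_EFinP; apply: measurable_funM => //; exact: measurable_clip.
  - by apply: ae_mono ru0 => x /andP[h1 h2] _ /=; rewrite clip_id.
by rewrite E1 E2.
Qed.

Lemma entropic_extend eta q : measurable_fun setT eta -> measurable_fun setT q ->
  entropic eta q u -> dissipative (fun p => eta (U p)) (fun p => q (U p)).
Proof.
move=> meta mq ent psi tp sp p0; have [mu' _ _] := weak.
have [A [C [_ [mt _ _] [mx _ _]]]] := test_function_bounded tp.
have mU : measurable_fun setT U by exact: measurable_extend.
rewrite -(_ : \int[mu2]_(p in half_plane) (eta (u p) * dt psi p + q (u p) * dx psi p) =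
    II (fun p => eta (U p) * dt psi p + q (U p) * dx psi p)); first exact: ent.
apply: Rintegral_half_plane.
- by apply: measurable_funD; apply: measurable_funM;
    [exact: measurableT_comp|exact: measurable_funTS|exact: measurableT_comp|exact: measurable_funTS].
- by apply: measurable_funD; apply: measurable_funM => //; exact: measurableT_comp.
- by apply: ae_mono extendE => p Up hp; rewrite (Up hp).
- move=> p hp; have np : ~ supp psi p by move=> /sp; rewrite /half_plane/= ltNge hp.
  by rewrite /dt /dx !derive_out_supp// !mulr0 addr0.
Qed.

End solution.
End Extension.

(** * Lower bound, comparison and uniqueness for weak solutions *)

Section Uniqueness.
Context {R : realType}.

Local Notation mm := (@lebesgue_measure R \x @lebesgue_measure R)%E.
Local Notation I g := (Rintegral (@lebesgue_measure R) setT g).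
Local Notation II Z := (Rintegral mm setT Z).

Lemma Cn_line_is_derive n i (f : R -> R) (x : R) : Cn_line n f -> (i < n)%N ->
  is_derive x 1 (derive1n i f) (derive1n i.+1 f x).
Proof.
move=> [df _] ni; have D := DeriveDef (df i ni x) (erefl _).
by rewrite /derive1n iterS derive1E.
Qed.

Variables (M : R) (f eta q : R -> R) (bl bu : R) (u0 : R -> R).
Hypothesis M0 : 0 < M.
Hypothesis flux : concave_convex_flux f.
Hypothesis entropy : strictly_convex_entropy_pair f eta q.
Hypothesis bl0 : 0 < bl.
Hypothesis blu : bl < bu.
Hypothesis buM : bu <= M.
Hypothesis mu0 : measurable_fun setT u0.
Hypothesis ru0 : {ae mu1, forall x, bl <= u0 x <= bu}.

Let g := derive1 f.
Let h := derive1 g.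
Let k := phi_nat f bl.
Let b0 x := clip bl bu (u0 x).

Let df (x : R) : is_derive x 1 f (g x).
Proof. by have [c4 _ _ _ _] := flux; exact: (@Cn_line_is_derive 4 0). Qed.

Let dg (x : R) : is_derive x 1 g (h x).
Proof. by have [c4 _ _ _ _] := flux; exact: (@Cn_line_is_derive 4 1). Qed.

Let inflection (x : R) : x != 0 -> 0 < x * h x.
Proof. by have [_ fx _ _ _] := flux; exact: fx. Qed.

Let cf : continuous f := is_derive_continuous df.
Let cg : continuous g := is_derive_continuous dg.

(** When a tangent point exists it is negative and satisfies the equation; otherwise [xget] returns
    its default 0, for which the second statement is void. *)
Let phi_nat_tangent : k <= 0 /\ (k < 0 -> f bl - f k = g k * (bl - k)).
Proof.
rewrite /k /phi_nat gt_eqF//.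
have [ex|nex] := pselect (exists v, v != bl /\ g v = (f bl - f v) / (bl - v)).
  have [nb gv] := xgetPex 0 ex; set v := xget _ _ in nb gv *.
  split; first exact: ltW (tangent_point_lt0 df dg inflection bl0 nb gv).
  by move=> _; rewrite gv mulfVK// subr_eq0 eq_sym.
rewrite xgetPN ?ltxx// => v hv; apply: nex; by exists v.
Qed.

Let k0 : k <= 0 := phi_nat_tangent.1.
Let tangent := phi_nat_tangent.2.

Let mb0 : measurable_fun setT b0. Proof. exact: measurable_clip. Qed.

Let bb0 x : `|b0 x| <= M.
Proof.
have /andP[h1 h2] := @clip_itv _ bl bu (u0 x) (ltW blu).
by rewrite ger0_norm ?(le_trans h2)// (le_trans (ltW bl0)).
Qed.

(** A sigma type, so that a single L can be named and shared by the potentials of all solutions at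
    both clipping levels. *)
Let flux_bound : {l : R | 0 < l & forall x : R, `|x| <= M -> `|f x| <= l}.
Proof. by have /cid2[l l0 Hl] := bounded_on_seg M cf; exists l. Qed.

Let L := s2val flux_bound.
Let L0 : 0 < L := s2valP flux_bound.
Let fL (x : R) : `|x| <= M -> `|f x| <= L. Proof. exact: (s2valP' flux_bound x). Qed.

Let bN (a : R) (u : R * R -> R) (p : R * R) : - M <= a -> a <= 0 -> `|extend_flux f (extend a M u) p| <= L.
Proof.
move=> aM a0; rewrite /extend_flux; case: ifP => _; last by rewrite normr0 ltW.
by apply: fL; exact: extend_bound (ltW M0).
Qed.

Section potentials.
Variables (a : R) (u : R * R -> R).
Hypothesis aM : - M <= a.
Hypothesis a0 : a <= 0.
Hypothesis weak : weak_solution M f u0 u.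
Hypothesis range : {ae mu2, forall p, half_plane p -> a <= u p}.

Let U := extend a M u.
Let N := extend_flux f U.
Definition solution_potential : R * R -> R := potential N b0.
Let w := solution_potential.

Let mU : measurable_fun setT U.
Proof. by have [mu _ _] := weak; exact: measurable_extend. Qed.
Let mN : measurable_fun setT N. Proof. exact: measurable_extend_flux. Qed.
Let bU (p : R * R) : `|U p| <= M. Proof. exact: extend_bound (ltW M0). Qed.
Let bN' (p : R * R) : `|N p| <= L. Proof. exact: bN. Qed.
Let U_neg (p : R * R) : p.1 <= 0 -> U p = 0. Proof. exact: extend_neg. Qed.
Let N_neg (p : R * R) : p.1 <= 0 -> N p = 0. Proof. exact: extend_flux_neg. Qed.
Let weakU := weak_extend cf mu0 ru0 weak range.
Let NE (p : R * R) : (0 : R) < p.1 -> N p = f (U p). Proof. exact: extend_flux_pos. Qed.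


Lemma lipschitz_solution : lipschitz_time L w.
Proof. exact: (lipschitz_time_potential mU mN mb0 bU bN' bb0 U_neg N_neg weakU). Qed.

Lemma lipschitz_solution_x t x y : `|w (t, x) - w (t, y)| <= M * `|x - y|.
Proof.
have H := potential_lipschitz mU mN mb0 bU bN' bb0 U_neg N_neg weakU (t, x) (t, y).
by apply: le_trans H _; rewrite subrr normr0 mulr0 add0r.
Qed.

Lemma solution_initial x y : x <= y -> bl * (y - x) <= w (0, y) - w (0, x).
Proof.
move=> xy; have cb z : bl <= b0 z by have /andP[] := @clip_itv _ bl bu (u0 z) (ltW blu).
exact: (potential_initial mb0 bb0 N_neg cb xy).
Qed.

Lemma solution_excluded_kruzkov sg : sg = 1 \/ sg = -1 ->
  entropic (kruzkov_entropy k) (kruzkov_flux f k) u -> excluded sg w f [set k].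
Proof.
move=> sgE ent; have MZ : M <= M + `|k| by rewrite lerDl.
apply: (excluded_kruzkov mU mN mb0 bU bN' bb0 U_neg N_neg weakU df cg NE MZ sgE).
  by rewrite lerDr ltW.
have mid : measurable_fun setT (fun x : R => x - k) by exact: measurable_funB.
apply: (entropic_extend weak range _ _ ent); first exact: measurableT_comp.
apply: measurable_funM; first exact: measurable_sgr.
by apply: measurable_funB => //; exact: continuous_measurable_fun.
Qed.

Lemma ae_ge_of_slope_solution c :
  (forall t x y, 0 <= t -> x <= y -> c * (y - x) <= w (t, y) - w (t, x)) ->
  {ae mu2, forall p, half_plane p -> c <= u p}.
Proof.
move=> slope.
have H := ae_ge_of_slope mU mN mb0 bU bN' bb0 U_neg N_neg weakU slope.
have E := extendE weak range.
apply: (ae_mono _ (@filterI _ _ (ae_filter_ringOfSetsType mu2) _ _ H E)).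
by move=> p [h1 h2] hp; rewrite -(h2 hp); exact: h1.
Qed.

Let PZ (p : R) : bl <= p <= bl + M -> `|p| <= bl + M.
Proof. by move=> /andP[h1 h2]; rewrite ger0_norm// (le_trans (ltW bl0)). Qed.

Let MZ : M <= bl + M. Proof. by rewrite lerDr ltW. Qed.

Let kU p : k <= a -> k <= U p.
Proof. by move=> /le_trans; apply; have /andP[] := @extend_itv _ a M u p a0 (ltW M0). Qed.

Lemma solution_excluded_below : k <= a -> entropic eta q u ->
  excluded 1 w f [set p | bl <= p <= bl + M].
Proof.
move=> ka ent; have [ceta eta2 qd qE] := entropy.
have deta (x : R) : is_derive x 1 eta (derive1 eta x) by exact: (@Cn_line_is_derive 3 0).
have de1 (x : R) : is_derive x 1 (derive1 eta) (derive1n 2 eta x).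
  exact: (@Cn_line_is_derive 3 1).
have de2 (x : R) : is_derive x 1 (derive1n 2 eta) (derive1n 3 eta x).
  exact: (@Cn_line_is_derive 3 2).
have dq (x : R) : is_derive x 1 q (derive1 eta x * g x).
  by have D := DeriveDef (qd x) (erefl _); rewrite -qE derive1E.
apply: (excluded_below mU mN mb0 bU bN' bb0 U_neg N_neg weakU df cg NE MZ deta de1
  (is_derive_continuous de2) eta2 dq PZ).
  move=> p z /= /andP[h1 h2] z0.
  exact: (entropy_defect_ge0 df dg inflection bl0 k0 tangent deta de1 eta2 dq (kU z ka) h1).
apply: (entropic_extend weak range _ _ ent); apply: continuous_measurable_fun.
  exact: is_derive_continuous deta.
exact: is_derive_continuous dq.
Qed.

Lemma solution_excluded_above : k <= a ->
  excluded (-1) w f [set p | bl <= p <= bl + M].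
Proof.
move=> ka.
apply: (excluded_above mU mN mb0 bU bN' bb0 U_neg N_neg weakU cg NE PZ).
move=> p z /= /andP[h1 h2] z0.
exact: (tangent_at_right df dg inflection bl0 k0 tangent (kU z ka) h1).
Qed.

End potentials.

(** A first pass with the trivial clipping level - M: the Kruzkov pair excludes the slope k in both
    directions, so the slopes of the potential, which start above bl, never fall below k. *)
Lemma solution_ge_phi_nat u : weak_solution M f u0 u ->
  entropic (kruzkov_entropy k) (kruzkov_flux f k) u ->
  {ae mu2, forall p, half_plane p -> k <= u p}.
Proof.
move=> weak ent; have MM : - M <= - M by [].
have M0' : - M <= 0 by rewrite oppr_le0 ltW.
have range : {ae mu2, forall p, half_plane p -> - M <= u p}.
  by have [_ r _] := weak; apply: ae_mono r => p r hp; have /andP[] := r hp.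
apply: (ae_ge_of_slope_solution MM M0' weak range).
exact: (slope_ge_of_excluded L0 M0 bl0 k0 (lipschitz_solution MM M0' weak range)
  (lipschitz_solution_x MM M0' weak range) (solution_initial (- M) u)
  (solution_excluded_kruzkov MM M0' weak range (or_introl erefl) ent)
  (solution_excluded_kruzkov MM M0' weak range (or_intror erefl) ent)).
Qed.

Section two_solutions.
Variables u v : R * R -> R.
Hypothesis weak_u : weak_solution M f u0 u.
Hypothesis weak_v : weak_solution M f u0 v.
Hypothesis entropic_u : entropic eta q u.
Hypothesis u_ge : {ae mu2, forall p, half_plane p -> k <= u p}.
Hypothesis v_ge : {ae mu2, forall p, half_plane p -> k <= v p}.

(** [k] may lie below - M, whereas the clipping level has to stay in [- M, 0]. *)
Let a := Num.max k (- M).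
Let ka : k <= a. Proof. by rewrite le_max lexx. Qed.
Let aM : - M <= a. Proof. by rewrite le_max lexx orbT. Qed.
Let a0 : a <= 0. Proof. by rewrite ge_max k0 oppr_le0 ltW. Qed.

Lemma range_max z : weak_solution M f u0 z -> {ae mu2, forall p, half_plane p -> k <= z p} ->
  {ae mu2, forall p, half_plane p -> Num.max k (- M) <= z p}.
Proof.
move=> [_ r _] zk.
apply: (ae_mono _ (@filterI _ _ (ae_filter_ringOfSetsType mu2) _ _ r zk)).
by move=> p [h1 h2] hp; rewrite ge_max h2//; have /andP[] := h1 hp.
Qed.

(** Here u enters as a strict supersolution through its entropy inequality, and v as a strict
    subsolution through the tangents of f; exchanging them gives the reverse inequality. *)
Lemma solution_potential_le t x : 0 <= t ->
  solution_potential (Num.max k (- M)) v (t, x) <= solution_potential (Num.max k (- M)) u (t, x).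
Proof.
have ru := range_max weak_u u_ge; have rv := range_max weak_v v_ge.
apply: (le_of_excluded L0 M0 bl0 (lipschitz_solution aM a0 weak_u ru)
  (lipschitz_solution aM a0 weak_v rv) (lipschitz_solution_x aM a0 weak_u ru)
  (solution_initial a u) _ (solution_excluded_below aM a0 weak_u ru ka entropic_u)
  (solution_excluded_above aM a0 weak_v rv ka)).
by move=> z; apply: potential_at0 => p; exact: extend_flux_neg.
Qed.

End two_solutions.

Lemma ae_le_of_solution_potential u v : weak_solution M f u0 u -> weak_solution M f u0 v ->
  {ae mu2, forall p, half_plane p -> k <= u p} -> {ae mu2, forall p, half_plane p -> k <= v p} ->
  (forall t x, 0 <= t -> solution_potential (Num.max k (- M)) u (t, x) =
    solution_potential (Num.max k (- M)) v (t, x)) ->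
  {ae mu2, forall p, half_plane p -> v p <= u p}.
Proof.
move=> wu wv ku kv; set a := Num.max k (- M) => E.
have ru := range_max wu ku; have rv := range_max wv kv.
have aM : - M <= a by rewrite le_max lexx orbT.
have a0 : a <= 0 by rewrite ge_max k0 oppr_le0 ltW.
have mE z : weak_solution M f u0 z -> measurable_fun setT (extend a M z).
  by move=> [mz _ _]; exact: measurable_extend.
have mF z : weak_solution M f u0 z -> measurable_fun setT (extend_flux f (extend a M z)).
  by move=> wz; apply: measurable_extend_flux => //; exact: mE.
have bE z p : `|extend a M z p| <= M := extend_bound z p aM a0 (ltW M0).
have H := ae_le_of_potential (mE u wu) (mF u wu) mb0 (bE u) (fun p => bN u p aM a0) bb0
  (fun p => @extend_neg _ a M u p) (fun p => @extend_flux_neg _ f (extend a M u) p)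
  (weak_extend cf mu0 ru0 wu ru) (mE v wv) (mF v wv) (bE v) (fun p => bN v p aM a0)
  (fun p => @extend_neg _ a M v p) (fun p => @extend_flux_neg _ f (extend a M v) p)
  (weak_extend cf mu0 ru0 wv rv) E.
have Eu := extendE wu ru; have Ev := extendE wv rv.
have Fuv := @filterI _ _ (ae_filter_ringOfSetsType mu2) _ _ Eu Ev.
apply: (ae_mono _ (@filterI _ _ (ae_filter_ringOfSetsType mu2) _ _ H Fuv)).
by move=> p [h1 [h2 h3]] hp; rewrite -(h2 hp) -(h3 hp); exact: h1.
Qed.

End Uniqueness.

Theorem theorem1p4 (R : realType) (M : R) (f eta q : R -> R) (bl bu : R)
    (u0 : R -> R) (u v : R * R -> R) :
  0 < M ->
  concave_convex_flux f ->
  strictly_convex_entropy_pair f eta q ->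
  0 < bl -> bl < bu -> bu <= M ->
  BV u0 -> {ae mu1, forall x, bl <= u0 x <= bu} ->
  weak_solution M f u0 u -> uniqueness_class f eta q (phi_nat f bl) u ->
  weak_solution M f u0 v -> uniqueness_class f eta q (phi_nat f bl) v ->
  {ae mu2, forall p, half_plane p -> u p = v p}.
Proof.
move=> M0 cc ep bl0 blu buM [mu0 _] ru0 wu [_ eu ku] wv [_ ev kv].
(* The lower bound places both solutions in the range where the chords and tangents of f at slopes
   from bl on are controlled. *)
have u_ge := solution_ge_phi_nat M0 cc bl0 blu buM mu0 ru0 wu ku.
have v_ge := solution_ge_phi_nat M0 cc bl0 blu buM mu0 ru0 wv kv.
have le_uv t x := solution_potential_le M0 cc ep bl0 blu buM mu0 ru0 wu wv eu u_ge v_ge (t := t) x.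
have le_vu t x := solution_potential_le M0 cc ep bl0 blu buM mu0 ru0 wv wu ev v_ge u_ge (t := t) x.
have H1 := ae_le_of_solution_potential M0 cc bl0 blu buM mu0 ru0 wu wv u_ge v_ge
  (fun t x t0 => le_anti (introT andP (conj (le_vu t x t0) (le_uv t x t0)))).
have H2 := ae_le_of_solution_potential M0 cc bl0 blu buM mu0 ru0 wv wu v_ge u_ge
  (fun t x t0 => le_anti (introT andP (conj (le_uv t x t0) (le_vu t x t0)))).
apply: (ae_mono _ (@filterI _ _ (ae_filter_ringOfSetsType mu2) _ _ H1 H2)).
by move=> p [h1 h2] hp; apply: le_anti; rewrite h1// h2.
Qed.
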